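(* Let $(B,+,\circ)$ be a Dedekind skew brace. (1) If $(B,+)$ is soluble-by-finite and minimax, then $B$ is centrally nilpotent. (2) If $(B,+)$ is torsion-free, soluble-by-finite and minimax, then $B$ is a trivial brace. (3) If $(B,\circ)$ is minimax abelian, then $B$ is centrally nilpotent. Moreover, if $(B,\circ)$ is also torsion-free, then $B$ is a trivial brace.
   Context: A skew brace is a triple $(B,+,\circ)$ with $(B,+)$, $(B,\circ)$ (not necessarily abelian) groups such that $a\circ(b+c)=a\circ b-a+a\circ c$ for all $a,b,c\in B$. The identities of the two groups coincide and are denoted by $0$. For $a\in B$ put $\lambda_a(b)=-a+a\circ b$; then $\lambda:a\mapsto\lambda_a$ is a homomorphism $(B,\circ)\to\operatorname{Aut}(B,+)$. A sub-skew brace is a subset that is a subgroup of both $(B,+)$ and $(B,\circ)$. An ideal is a subgroup of $(B,+)$ that is normal in $(B,+)$, invariant under all $\lambda_b$, and normal in $(B,\circ)$; one can form the quotient skew brace $B/I$. $B$ is Dedekind if all its sub-skew braces are ideals of $B$. $B$ is trivial (a trivial brace) if $a+b=a\circ b$ for all $a,b\in B$. The centre is the ideal $Z(B)=\operatorname{Ker}(\lambda)\cap Z(B,+)\cap Z(B,\circ)$; the upper central series is $Z_0(B)=\{0\}$, $Z_{k+1}(B)/Z_k(B)=Z(B/Z_k(B))$; $B$ is centrally nilpotent if $B=Z_n(B)$ for some non-negative integer $n$. A group is minimax if it has a finite series (each term normal in the next) whose factors satisfy either the minimal or the maximal condition on subgroups. A group is soluble-by-finite if it has a normal soluble subgroup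 of finite index. *)

(* Defs.v *)
From mathcomp Require Import all_boot.
From mathcomp Require Import boolp classical_sets functions cardinality.

Set Implicit Arguments.
Unset Strict Implicit.
Unset Printing Implicit Defensive.

Local Open Scope classical_set_scope.

(* A skew brace has two group laws on one carrier, and both may be infinite and
   non-abelian, so a group law is an explicit value instead of an instance of
   groupType attached to the carrier. *)

Record group_law (T : Type) := GroupLaw {
  gop : T -> T -> T;
  gid : T;
  ginv : T -> T;
  gopA : associative gop;
  gop1 : left_id gid gop;
  gopV : left_inverse gid ginv gop }.

Lemma ginvK_l T (G : group_law T) x y : gop G (ginv G x) (gop G x y) = y.
Proof. by rewrite gopA gopV gop1. Qed.

Lemma gop_inj T (G : group_law T) x : injective (gop G x).
Proof. by move=> y z e; rewrite -(ginvK_l G x y) e ginvK_l. Qed.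

Lemma gopr1 T (G : group_law T) : right_id (gid G) (gop G).
Proof. by move=> x; apply: (@gop_inj _ G (ginv G x)); rewrite ginvK_l gopV. Qed.

Lemma goprV T (G : group_law T) : right_inverse (gid G) (ginv G) (gop G).
Proof.
by move=> x; apply: (@gop_inj _ G (ginv G x)); rewrite ginvK_l gopr1.
Qed.

Lemma ginvK_r T (G : group_law T) x y : gop G x (gop G (ginv G x) y) = y.
Proof. by rewrite gopA goprV gop1. Qed.

Lemma ginv_uniq T (G : group_law T) x y : gop G x y = gid G -> y = ginv G x.
Proof. by move=> e; apply: (@gop_inj _ G x); rewrite e goprV. Qed.

Lemma ginv1 T (G : group_law T) : ginv G (gid G) = gid G.
Proof. by symmetry; apply: ginv_uniq; rewrite gop1. Qed.

Lemma ginv_inv T (G : group_law T) : involutive (ginv G).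
Proof. by move=> x; symmetry; apply: ginv_uniq; rewrite gopV. Qed.

Lemma ginvM T (G : group_law T) x y :
  ginv G (gop G x y) = gop G (ginv G y) (ginv G x).
Proof. by symmetry; apply: ginv_uniq; rewrite -gopA ginvK_r goprV. Qed.

Definition gpow T (G : group_law T) (x : T) (n : nat) : T :=
  iter n (gop G x) (gid G).

Definition abelian_law T (G : group_law T) : Prop := commutative (gop G).

Definition torsion_free T (G : group_law T) : Prop :=
  forall (x : T) (n : nat), (0 < n)%N -> gpow G x n = gid G -> x = gid G.

Definition subgroup T (G : group_law T) (H : set T) : Prop :=
  [/\ H (gid G), (forall x y, H x -> H y -> H (gop G x y))
    & forall x, H x -> H (ginv G x)].

Lemma subgroupT T (G : group_law T) : subgroup G setT.
Proof. by []. Qed.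

Definition normal_in T (G : group_law T) (N K : set T) : Prop :=
  [/\ subgroup G N, subgroup G K, N `<=` K
    & forall x y, K x -> N y -> N (gop G (gop G x y) (ginv G x))].

Definition coset T (G : group_law T) (N : set T) (x : T) : set T :=
  [set y | N (gop G (ginv G x) y)].

Lemma cosetP T (G : group_law T) (N : set T) (x y : T) : subgroup G N ->
  coset G N x = coset G N y <-> N (gop G (ginv G x) y).
Proof.
move=> [N1 NM NV]; split=> [e|Nxy].
  have : coset G N y y by rewrite /coset /= gopV.
  by rewrite -e.
apply/seteqP; split=> z; rewrite /coset /= => Nz.
  have -> : gop G (ginv G y) z =
      gop G (ginv G (gop G (ginv G x) y)) (gop G (ginv G x) z).
    by rewrite ginvM ginv_inv -gopA ginvK_r.
  by apply: NM => //; apply: NV.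
have -> : gop G (ginv G x) z =
    gop G (gop G (ginv G x) y) (gop G (ginv G y) z).
  by rewrite -gopA ginvK_r.
exact: NM.
Qed.

(* The group law on f(K) induced by that of the subgroup K, when the equality
   of values of f is compatible with the law on K.  It is computed on chosen
   preimages. *)

Definition compatible T U (G : group_law T) (K : set T) (f : T -> U) : Prop :=
  forall x x' y y', K x -> K x' -> K y -> K y' ->
    f x = f x' -> f y = f y' -> f (gop G x y) = f (gop G x' y').

Definition rep T U (K : set T) (f : T -> U) (A : f @` K) : T :=
  proj1_sig (cid2 (set_mem (valP A))).

Lemma repK T U (K : set T) (f : T -> U) (A : f @` K) : K (rep A).
Proof. by rewrite /rep; case: cid2. Qed.

Lemma repE T U (K : set T) (f : T -> U) (A : f @` K) : f (rep A) = val A.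
Proof. by rewrite /rep; case: cid2. Qed.

Definition proj T U (K : set T) (f : T -> U) (x : T) (Kx : K x) : f @` K :=
  exist _ (f x) (mem_set (imageP f Kx)).

Lemma rep_proj T U (K : set T) (f : T -> U) (x : T) (Kx : K x) :
  f (rep (proj f Kx)) = f x.
Proof. by rewrite repE. Qed.

Definition image_op T U (G : group_law T) (K : set T) (f : T -> U)
    (sK : subgroup G K) (A C : f @` K) : f @` K :=
  let: And3 _ KM _ := sK in proj f (KM _ _ (repK A) (repK C)).

Definition image_id T U (G : group_law T) (K : set T) (f : T -> U)
    (sK : subgroup G K) : f @` K :=
  let: And3 K1 _ _ := sK in proj f K1.

Definition image_inv T U (G : group_law T) (K : set T) (f : T -> U)
    (sK : subgroup G K) (A : f @` K) : f @` K :=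
  let: And3 _ _ KV := sK in proj f (KV _ (repK A)).

Lemma image_opE T U (G : group_law T) (K : set T) (f : T -> U)
    (sK : subgroup G K) (A C : f @` K) :
  val (image_op sK A C) = f (gop G (rep A) (rep C)).
Proof. by case: sK. Qed.

Lemma image_idE T U (G : group_law T) (K : set T) (f : T -> U)
    (sK : subgroup G K) : val (image_id f sK) = f (gid G).
Proof. by case: sK. Qed.

Lemma image_invE T U (G : group_law T) (K : set T) (f : T -> U)
    (sK : subgroup G K) (A : f @` K) :
  val (image_inv sK A) = f (ginv G (rep A)).
Proof. by case: sK. Qed.

Lemma image_opA T U (G : group_law T) (K : set T) (f : T -> U)
    (sK : subgroup G K) : compatible G K f -> associative (@image_op _ _ G K f sK).
Proof.
move=> cf A C D; apply: val_inj; rewrite !image_opE.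
have [_ KM _] := sK.
transitivity (f (gop G (rep A) (gop G (rep C) (rep D)))).
  by apply: cf; rewrite ?repE ?image_opE //; do ?[exact: repK | apply: KM].
by rewrite gopA; apply: cf; rewrite ?repE ?image_opE //;
  do ?[exact: repK | apply: KM].
Qed.

Lemma image_op1 T U (G : group_law T) (K : set T) (f : T -> U)
    (sK : subgroup G K) : compatible G K f ->
  left_id (image_id f sK) (@image_op _ _ G K f sK).
Proof.
move=> cf A; apply: val_inj; rewrite image_opE -repE -[in RHS](gop1 G (rep A)).
have [K1 _ _] := sK.
by apply: cf; rewrite ?repE ?image_idE //; exact: repK.
Qed.

Lemma image_opV T U (G : group_law T) (K : set T) (f : T -> U)
    (sK : subgroup G K) : compatible G K f ->
  left_inverse (image_id f sK) (@image_inv _ _ G K f sK)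
    (@image_op _ _ G K f sK).
Proof.
move=> cf A; apply: val_inj; rewrite image_opE image_idE -(gopV G (rep A)).
have [_ _ KV] := sK.
by apply: cf; rewrite ?repE ?image_invE //; do ?[exact: repK | apply: KV].
Qed.

Definition image_law T U (G : group_law T) (K : set T) (f : T -> U)
    (sK : subgroup G K) (cf : compatible G K f) : group_law (f @` K) :=
  GroupLaw (image_opA sK cf) (image_op1 sK cf) (image_opV sK cf).

Lemma coset_compatible T (G : group_law T) (N K : set T) :
  normal_in G N K -> compatible G K (coset G N).
Proof.
move=> [sN [_ _ KV] _ nN] x x' y y' Kx Kx' Ky Ky'.
move=> /(cosetP _ _ sN) Nx /(cosetP _ _ sN) Ny; apply/(cosetP _ _ sN).
have [_ NM _] := sN.
have -> : gop G (ginv G (gop G x y)) (gop G x' y') =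
    gop G (gop G (gop G (ginv G y) (gop G (ginv G x) x')) (ginv G (ginv G y)))
          (gop G (ginv G y) y').
  by rewrite ginvM ginv_inv -!gopA ginvK_r.
by apply: NM => //; apply: nN => //; apply: KV.
Qed.

(* The quotient group K/N. *)
Definition factor T (G : group_law T) (N K : set T) (nN : normal_in G N K) :
    group_law (coset G N @` K) :=
  let: And4 _ sK _ _ := nN in image_law sK (coset_compatible nN).

(* H has a finite series {1} = S 0 <| S 1 <| ... <| S n = H whose factors
   satisfy P. *)
Definition has_series (P : forall U : Type, group_law U -> Prop)
    T (G : group_law T) (H : set T) : Prop :=
  exists (n : nat) (S : nat -> set T)
         (nS : forall i : 'I_n, normal_in G (S i) (S i.+1)),
    [/\ S 0%N = [set gid G], S n = H & forall i : 'I_n, P _ (factor (nS i))].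

Definition min_condition T (G : group_law T) : Prop :=
  forall F : set (set T), F !=set0 -> F `<=` subgroup G ->
    exists2 M, F M & forall H, F H -> H `<=` M -> H = M.

Definition max_condition T (G : group_law T) : Prop :=
  forall F : set (set T), F !=set0 -> F `<=` subgroup G ->
    exists2 M, F M & forall H, F H -> M `<=` H -> H = M.

Definition minimax T (G : group_law T) : Prop :=
  has_series (fun U L => min_condition L \/ max_condition L) G setT.

Definition soluble T (G : group_law T) (H : set T) : Prop :=
  has_series abelian_law G H.

Definition soluble_by_finite T (G : group_law T) : Prop :=
  exists N : set T,
    [/\ normal_in G N setT, soluble G N & finite_set (coset G N @` setT)].

Record skewBrace := SkewBrace {
  carrier :> Type;
  addg : group_law carrier;
  circg : group_law carrier;
  circ_add : forall a b c : carrier,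
    gop circg a (gop addg b c) =
    gop addg (gop addg (gop circg a b) (ginv addg a)) (gop circg a c) }.

Declare Scope brace_scope.
Delimit Scope brace_scope with SB.
Notation "a + b" := (gop (addg _) a b) : brace_scope.
Notation "- a" := (ginv (addg _) a) : brace_scope.
Notation "a ** b" := (gop (circg _) a b) (at level 40, left associativity)
  : brace_scope.
Local Open Scope brace_scope.

Definition lambda (B : skewBrace) (a b : B) : B := - a + a ** b.

Definition sub_skew_brace (B : skewBrace) (S : set B) : Prop :=
  subgroup (addg B) S /\ subgroup (circg B) S.

Definition ideal (B : skewBrace) (I : set B) : Prop :=
  [/\ normal_in (addg B) I setT,
      (forall b x : B, I x -> I (lambda b x))
    & normal_in (circg B) I setT].

Definition dedekind (B : skewBrace) : Prop :=
  forall S : set B, sub_skew_brace S -> ideal S.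

Definition trivial_brace (B : skewBrace) : Prop :=
  forall a b : B, a + b = a ** b.

Lemma circr0 (B : skewBrace) (a : B) : a ** gid (addg B) = a.
Proof.
have e := circ_add a (gid (addg B)) (gid (addg B)).
rewrite gop1 -gopA in e.
have e' : gid (addg B) = - a + a ** gid (addg B).
  by apply: (@gop_inj _ (addg B) (a ** gid (addg B))); rewrite -e gopr1.
by rewrite -[RHS](gopr1 (addg B)) [in RHS]e' ginvK_r.
Qed.

Lemma circ_id (B : skewBrace) : gid (circg B) = gid (addg B).
Proof. by rewrite -[RHS](gop1 (circg B)) circr0. Qed.

Lemma circE (B : skewBrace) (a b : B) : a ** b = a + lambda a b.
Proof. by rewrite /lambda ginvK_r. Qed.

Lemma lambdaD (B : skewBrace) (a b c : B) :
  lambda a (b + c) = lambda a b + lambda a c.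
Proof. by rewrite /lambda circ_add -!gopA. Qed.

Lemma lambdaM (B : skewBrace) (a b c : B) :
  lambda (a ** b) c = lambda a (lambda b c).
Proof.
apply: (@gop_inj _ (addg B) (lambda a b)); rewrite -lambdaD -circE.
by rewrite /lambda gopA -[X in X + _]gopA goprV gopr1 -gopA.
Qed.

Lemma lambda_id (B : skewBrace) (b : B) : lambda (gid (addg B)) b = b.
Proof. by rewrite /lambda ginv1 gop1 -circ_id gop1. Qed.

(* An ideal has the same cosets for both laws. *)
Lemma ideal_coset (B : skewBrace) (I : set B) :
  ideal I -> coset (circg B) I = coset (addg B) I.
Proof.
move=> [_ Il _]; apply/funext => x; apply/seteqP; split=> y; rewrite /coset /=.
  move=> /(Il x); rewrite /lambda ginvK_r //.
move=> /(Il (ginv (circg B) x)).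
have {1}-> : - x + y = lambda x (ginv (circg B) x ** y).
  by rewrite /lambda ginvK_r.
by rewrite -lambdaM gopV circ_id lambda_id.
Qed.

Lemma ideal_circ_compatible (B : skewBrace) (I : set B) :
  ideal I -> compatible (circg B) setT (coset (addg B) I).
Proof.
by move=> iI; rewrite -ideal_coset //; apply: coset_compatible; case: iI.
Qed.

Lemma ideal_add_compatible (B : skewBrace) (I : set B) :
  ideal I -> compatible (addg B) setT (coset (addg B) I).
Proof. by move=> [nI _ _]; apply: coset_compatible. Qed.

Definition quot_add (B : skewBrace) (I : set B) (iI : ideal I) :
    group_law (coset (addg B) I @` setT) :=
  image_law (subgroupT (addg B)) (ideal_add_compatible iI).

Definition quot_circ (B : skewBrace) (I : set B) (iI : ideal I) :
    group_law (coset (addg B) I @` setT) :=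
  image_law (subgroupT (circg B)) (ideal_circ_compatible iI).

Definition quot_proj (B : skewBrace) (I : set B) (x : B) :
    coset (addg B) I @` setT :=
  @proj _ _ setT (coset (addg B) I) x Logic.I.

Lemma quot_projK (B : skewBrace) (I : set B) (A : coset (addg B) I @` setT) :
  quot_proj I (rep A) = A.
Proof. by apply: val_inj; rewrite /= repE. Qed.

Lemma quot_projD (B : skewBrace) (I : set B) (iI : ideal I) (x y : B) :
  quot_proj I (x + y) = gop (quot_add iI) (quot_proj I x) (quot_proj I y).
Proof.
apply: val_inj; rewrite image_opE.
by apply: (ideal_add_compatible iI) => //; rewrite rep_proj.
Qed.

Lemma quot_projM (B : skewBrace) (I : set B) (iI : ideal I) (x y : B) :
  quot_proj I (x ** y) = gop (quot_circ iI) (quot_proj I x) (quot_proj I y).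
Proof.
apply: val_inj; rewrite image_opE.
by apply: (ideal_circ_compatible iI) => //; rewrite rep_proj.
Qed.

Lemma quot_proj0 (B : skewBrace) (I : set B) (iI : ideal I) :
  quot_proj I (gid (addg B)) = gid (quot_add iI).
Proof. by apply: val_inj; rewrite image_idE. Qed.

Lemma quot_proj1 (B : skewBrace) (I : set B) (iI : ideal I) :
  quot_proj I (gid (circg B)) = gid (quot_circ iI).
Proof. by apply: val_inj; rewrite image_idE. Qed.

Lemma quot_projN (B : skewBrace) (I : set B) (iI : ideal I) (x : B) :
  quot_proj I (- x) = ginv (quot_add iI) (quot_proj I x).
Proof. by apply: ginv_uniq; rewrite -quot_projD goprV quot_proj0. Qed.

Lemma quot_projV (B : skewBrace) (I : set B) (iI : ideal I) (x : B) :
  quot_proj I (ginv (circg B) x) = ginv (quot_circ iI) (quot_proj I x).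
Proof. by apply: ginv_uniq; rewrite -quot_projM goprV quot_proj1. Qed.

Lemma quot_circ_add (B : skewBrace) (I : set B) (iI : ideal I)
    (a b c : coset (addg B) I @` setT) :
  gop (quot_circ iI) a (gop (quot_add iI) b c) =
  gop (quot_add iI)
    (gop (quot_add iI) (gop (quot_circ iI) a b) (ginv (quot_add iI) a))
    (gop (quot_circ iI) a c).
Proof.
rewrite -(quot_projK a) -(quot_projK b) -(quot_projK c).
by rewrite -quot_projN -!(quot_projD, quot_projM) circ_add.
Qed.

Definition quotient (B : skewBrace) (I : set B) (iI : ideal I) : skewBrace :=
  SkewBrace (quot_circ_add iI).

Definition center (B : skewBrace) : set B :=
  [set a | [/\ (forall b : B, lambda a b = b),
               (forall b : B, a + b = b + a)
             & (forall b : B, a ** b = b ** a)]].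
Arguments center B _ : clear implicits.

Lemma center_add_circ (B : skewBrace) (a b : B) :
  center B a -> a ** b = a + b.
Proof. by move=> [la _ _]; rewrite circE la. Qed.

Lemma center_inv (B : skewBrace) (a : B) :
  center B a -> ginv (circg B) a = - a.
Proof.
move=> Za; apply: ginv_uniq.
by rewrite -center_add_circ // goprV circ_id.
Qed.

Lemma centerD (B : skewBrace) (a b : B) :
  center B a -> center B b -> center B (a + b).
Proof.
move=> Za Zb; have [la Da Ma] := Za; have [lb Db Mb] := Zb; split=> c.
- by rewrite -center_add_circ // lambdaM lb la.
- by rewrite -gopA Db gopA Da -gopA.
- by rewrite -center_add_circ // -gopA Mb gopA Ma -gopA.
Qed.

Lemma centerN (B : skewBrace) (a : B) : center B a -> center B (- a).
Proof.
move=> Za; have [la Da Ma] := Za; split=> c.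
- rewrite -center_inv // -[X in lambda _ X]la -lambdaM gopV circ_id.
  exact: lambda_id.
- by apply: (@gop_inj _ (addg B) a); rewrite ginvK_r gopA Da -gopA goprV gopr1.
- rewrite -center_inv //; apply: (@gop_inj _ (circg B) a).
  by rewrite ginvK_r gopA Ma -gopA goprV gopr1.
Qed.

Lemma center0 (B : skewBrace) : center B (gid (addg B)).
Proof.
split=> b; first exact: lambda_id.
  by rewrite gop1 gopr1.
by rewrite -circ_id gop1 gopr1.
Qed.

Lemma center_ideal (B : skewBrace) : ideal (center B).
Proof.
split.
- split=> //.
    by split; [exact: center0 | exact: centerD | exact: centerN].
  by move=> x y _ Zy; have [_ Dy _] := Zy; rewrite -Dy -gopA goprV gopr1.
- move=> b x Zx; have [_ Dx Mx] := Zx.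
  by rewrite /lambda -Mx center_add_circ // Dx ginvK_l.
- split=> //.
    split; first by rewrite circ_id; exact: center0.
      by move=> x y Zx Zy; rewrite center_add_circ //; exact: centerD.
    by move=> x Zx; rewrite center_inv //; exact: centerN.
  by move=> x y _ Zy; have [_ _ My] := Zy; rewrite -My -gopA goprV gopr1.
Qed.

Lemma preimage_ideal (B : skewBrace) (I : set B) (iI : ideal I)
    (J : set (quotient iI)) : ideal J -> ideal (quot_proj I @^-1` J).
Proof.
move=> [[[J0 JD JN] _ _ Jn] Jl [[J1 JM JV] _ _ Jc]]; split.
- split=> //.
    split; first by rewrite /preimage /= (quot_proj0 iI).
      by move=> x y Jx Jy; rewrite /preimage /= (quot_projD iI); exact: JD.
    by move=> x Jx; rewrite /preimage /= (quot_projN iI); exact: JN.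
  move=> x y _ Jy; rewrite /preimage /= !(quot_projD iI) (quot_projN iI).
  exact: Jn.
- move=> b x Jx.
  rewrite /preimage /lambda /= (quot_projD iI) (quot_projN iI) (quot_projM iI).
  exact: (Jl (quot_proj I b)).
- split=> //.
    split; first by rewrite /preimage /= (quot_proj1 iI).
      by move=> x y Jx Jy; rewrite /preimage /= (quot_projM iI); exact: JM.
    by move=> x Jx; rewrite /preimage /= (quot_projV iI); exact: JV.
  move=> x y _ Jy; rewrite /preimage /= !(quot_projM iI) (quot_projV iI).
  exact: Jc.
Qed.

Lemma zero_ideal (B : skewBrace) : ideal [set gid (addg B)].
Proof.
split.
- split=> //; last by move=> x y _ ->; rewrite /= gopr1 goprV.
  by split=> [//|x y -> ->|x ->]; rewrite /= ?gop1 ?ginv1.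
- by move=> b x ->; rewrite /lambda /= circr0 gopV.
- rewrite -circ_id; split=> //; last by move=> x y _ ->; rewrite /= gopr1 goprV.
  by split=> [//|x y -> ->|x ->]; rewrite /= ?gop1 ?ginv1.
Qed.

(* Z_k(B), together with the proof that it is an ideal, which is needed to form
   B/Z_k(B); Z_(k+1)(B) is the preimage of the centre of B/Z_k(B). *)
Fixpoint upper_central_ideal (B : skewBrace) (k : nat) : {I : set B | ideal I} :=
  match k with
  | 0%N => exist _ [set gid (addg B)] (zero_ideal B)
  | k'.+1 =>
      let: exist Z iZ := upper_central_ideal B k' in
      exist _ (quot_proj Z @^-1` center (quotient iZ))
        (preimage_ideal (center_ideal (quotient iZ)))
  end.

Definition upper_central (B : skewBrace) (k : nat) : set B :=
  proj1_sig (upper_central_ideal B k).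
Arguments upper_central B k _ : clear implicits.

Definition centrally_nilpotent (B : skewBrace) : Prop :=
  exists n : nat, upper_central B n = setT.

(* Main.v *)
Require Import Defs.
From HB Require Import structures.
From mathcomp Require Import all_boot all_order all_algebra all_fingroup all_solvable.
From mathcomp Require Import boolp classical_sets functions cardinality.
From mathcomp Require Import zify ring.
Import Defs.

Set Implicit Arguments.
Unset Strict Implicit.
Unset Printing Implicit Defensive.

Import Order.TTheory GRing.Theory Num.Theory.
Local Open Scope classical_set_scope.
Local Open Scope brace_scope.

(** All parts of the theorem come from one fact: for suitable abelian ideals M
    of a Dedekind skew brace B, if B/M is centrally nilpotent then so is B.
    Every ideal that is needed is obtained as a sub-skew brace; a subgroup of
    (B,+) invariant under all lambda maps is one, and so is the cyclic group
    of an element x with lambda_x(x) = x.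

    The case of prime order. Let x have order p with lambda_x(x) = x, and let
    B be centrally nilpotent modulo <x>; then x is central
    (prime_ideal_center). Dividing by an ideal maximal among those that avoid
    x, one may assume that every non-zero sub-skew brace contains x. If some
    lambda map or conjugation moved x, every element z central modulo <x>
    would satisfy z^(2p(p-1)) = 0 for the circle law, because that power
    generates a sub-skew brace of fixed elements, which would contain x if it
    were not zero. A Cauchy theorem for finite skew braces (brace_cauchy),
    proved by letting a Sylow subgroup of the circle group act on the Sylow
    subgroups of the additive group and then on cosets, removes all primes
    except p. The exponent climbs along the upper central series
    (center_exponent), so every element acts on <x> with p-power order. It
    also acts with order dividing p - 1, hence trivially. Finite ideals follow
    (finite_ideal_nilpotent), and elementary abelian ones with a bound on the
    number of steps which depends only on the number of generators
    (elementary_ideal_nilpotent).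

    An abelian ideal A which is minimax (abelian_step). Reducing modulo almost
    all primes p and intersecting the pA makes B centrally nilpotent modulo
    the torsion subgroup T of A. By the finite case one may pass from T to its
    divisible part D. An element of D acts on D through an automorphism of
    finite order, and D has no proper subgroup of finite index, so D acts
    trivially on itself. Finally, each element a of B lies in an ideal W,
    built by cyclic central extensions, that meets D in a group of bounded
    exponent; the commutators of a with D lie in W and form a divisible group,
    so they vanish (divisible_center).

    If (B,+) is soluble-by-finite, a soluble normal subgroup of minimal finite
    index is invariant under the lambda maps, hence an ideal, and the terms of
    its derived series are ideals with minimax abelian factors
    (soluble_minimax_nilpotent). If moreover the centre is torsion-free, an
    argument in the second centre shows that B is its own centre, so that the
    two laws agree (torsion_free_center).

    If (B,circ) is abelian, the subgroup N generated by the elements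
    lambda_a(b) - b is abelian: this is Ito's theorem for a product of two
    abelian groups, here the circle group acting by lambda_a and by y |-> a +
    lambda_a(y) - a (defect_comm). N is an ideal, and B is central modulo N.
    The two laws of N are abelian, so N is an ideal of a commutative ring in
    which its circle law is the product of the elements 1 + x. For x in it the
    elements n x^2 + x^4 r form a sub-skew brace, thus an ideal, which
    contains x^3; so some unit multiple y of x multiplies x^2 by an integer n
    (square_rel). If x^2 has infinite order and n != 0, the elements 1 + m y
    act on x^2 as the integers 1 + m n, among which there are arbitrarily long
    multiplicatively independent families: this contradicts the finite rank of
    the circle group (cube_zero). So a torsion-free such skew brace is nil and
    then trivial, while an element of prime order has cube zero, whence its
    circle order bounds its additive order. Therefore (N,+) inherits from the
    circle group what the abelian step needs (bi_abelian_data). *)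

(** * Powers in a group law *)

(** Rewriting with these rules computes the reduced word of a group
    expression. *)
Definition greduce T (G : group_law T) :=
  (@ginvM T G, @ginv_inv T G, @ginv1 T G, fun x y z => esym (gopA G x y z),
   @ginvK_l T G, @ginvK_r T G, @gopV T G, @goprV T G, @gop1 T G, @gopr1 T G).

Section Powers.
Variables (T : Type) (G : group_law T).
Implicit Types (x y z : T) (n m : nat).
Local Notation "x * y" := (gop G x y).
Local Notation "x ^ n" := (gpow G x n).
Local Notation "1" := (gid G).

Lemma gop_injr x : injective (fun y => y * x).
Proof. by move=> y z /(congr1 (fun t => t * ginv G x)); rewrite !greduce. Qed.

Lemma gpow1 x : x ^ 1 = x. Proof. exact: gopr1. Qed.

Lemma gpowD x n m : x ^ (n + m)%N = x ^ n * x ^ m.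
Proof. by elim: n => [|n IH]; rewrite ?gop1 // addSn /= IH gopA. Qed.

Lemma gpowSr x n : x ^ n.+1 = x ^ n * x.
Proof. by rewrite -addn1 gpowD gpow1. Qed.

Lemma gpow_id n : 1 ^ n = 1.
Proof. by elim: n => //= n ->; rewrite gop1. Qed.

Lemma gpowM x n m : x ^ (n * m)%N = (x ^ n) ^ m.
Proof. by elim: m => [|m IH]; rewrite ?muln0 // mulnS gpowD IH. Qed.

Lemma gpow_comm x y n : x * y = y * x -> x ^ n * y = y * x ^ n.
Proof.
by move=> c; elim: n => [|n IH] /=; rewrite ?gop1 ?gopr1 // -gopA IH !gopA c.
Qed.

Lemma gpow_mul x y n : x * y = y * x -> (x * y) ^ n = x ^ n * y ^ n.
Proof.
move=> c; elim: n => [|n IH]; rewrite ?gop1 // [LHS]/= IH [x ^ n.+1]/= -!gopA.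
by congr (x * _); rewrite gopA -(gpow_comm n c) -gopA.
Qed.

Lemma gpow_inv x n : ginv G x ^ n = ginv G (x ^ n).
Proof. by elim: n => [|n IH]; rewrite ?ginv1 //=; rewrite -/(gpow G _ n) IH -ginvM -gpowSr. Qed.

Lemma subgroup_gpow (H : set T) x n : subgroup G H -> H x -> H (x ^ n).
Proof. by move=> [H1 HM _] Hx; elim: n => //= n; apply: HM. Qed.

Definition gz x (n : int) : T :=
  match n with Posz k => x ^ k | Negz k => ginv G (x ^ k.+1) end.

Lemma gzS x (n : int) : gz x (n + 1)%R = x * gz x n.
Proof.
case: n => [n|[|n]]; first by rewrite -PoszD addn1.
  by rewrite /= gopr1 goprV.
have -> : (Negz n.+1 + 1 = Negz n)%R by lia.
change (ginv G (x ^ n.+1) = x * ginv G (x ^ n.+2)).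
by rewrite (gpowSr x n.+1) ginvM ginvK_r.
Qed.

Lemma gzB1 x (n : int) : gz x (n - 1)%R = ginv G x * gz x n.
Proof. by rewrite -[in RHS](subrK 1%R n) gzS ginvK_l. Qed.

Lemma gzD x (n m : int) : gz x (n + m)%R = gz x n * gz x m.
Proof.
elim/int_ind: n => [|n IH|n IH]; first by rewrite add0r /= gop1.
  by rewrite -[n.+1]addn1 PoszD addrAC !gzS IH gopA.
by rewrite -[n.+1]addn1 PoszD opprD addrAC !gzB1 IH gopA.
Qed.

Lemma gzN x (n : int) : gz x (- n)%R = ginv G (gz x n).
Proof. by apply: ginv_uniq; rewrite -gzD subrr. Qed.

Lemma gz0 x : gz x 0%R = 1. Proof. by []. Qed.

Lemma gz1 x : gz x 1%R = x. Proof. exact: gpow1. Qed.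

Lemma subgroup_gz (H : set T) x (n : int) : subgroup G H -> H x -> H (gz x n).
Proof.
move=> sH Hx; case: n => n /=; first exact: subgroup_gpow.
by have [_ _ HV] := sH; apply/HV/(subgroup_gpow n.+1 sH).
Qed.

Lemma subgroup_cap (H K : set T) :
  subgroup G H -> subgroup G K -> subgroup G (H `&` K).
Proof.
move=> [H1 HM HV] [K1 KM KV]; split=> //.
  by move=> x y [? ?] [? ?]; split; [apply: HM | apply: KM].
by move=> x [? ?]; split; [apply: HV | apply: KV].
Qed.

Lemma gz_nat x n : gz x n%:Z = x ^ n. Proof. by []. Qed.

Lemma gzM x (n m : int) : gz x (n * m)%R = gz (gz x n) m.
Proof.
elim/int_ind: m => [|m IH|m IH]; first by rewrite mulr0 !gz0.
  have -> : (n * m.+1 = n + n * m)%R by lia.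
  by rewrite gzD IH -[m.+1]addn1 PoszD addrC gzD -/(1%R) gz1.
have -> : (n * - m.+1%:Z = - n + n * - m%:Z)%R by lia.
have -> : (- m.+1%:Z = - 1%R + - m%:Z)%R by lia.
by rewrite gzD IH gzN [in RHS]gzD (gzN (gz x n) 1%R) gz1.
Qed.

Lemma gz_id (n : int) : gz 1 n = 1.
Proof. by case: n => n; rewrite /gz gpow_id ?ginv1. Qed.

Lemma gz_modn x n (m : int) : (0 < n)%N -> x ^ n = 1 ->
  exists k : nat, gz x m = x ^ k.
Proof.
move=> n0 xn; exists `|(m %% n)%Z|%N.
rewrite -gz_nat gez0_abs ?modz_ge0 //; last by lia.
rewrite {1}(divz_eq m n) gzD mulrC gzM gz_nat xn.
by rewrite gz_id gop1.
Qed.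

Lemma gpow_gcd x n m : x ^ n = 1 -> x ^ m = 1 -> coprime n m -> x = 1.
Proof.
move=> xn xm; case: n xn => [|n] xn; first by rewrite /coprime gcd0n => /eqP e;
  rewrite e gpow1 in xm.
case: (egcdnP m (ltn0Sn n)) => kn km e _ /eqP g.
by rewrite -(gpow1 x) -g -[RHS](gpow_id kn) -xn -gpowM mulnC e gpowD mulnC
  gpowM xm gpow_id gop1.
Qed.

End Powers.

Lemma gpow_morph T U (G : group_law T) (H : group_law U) (f : T -> U) x n :
  f (gid G) = gid H ->
  (forall y, f (gop G x y) = gop H (f x) (f y)) ->
  f (gpow G x n) = gpow H (f x) n.
Proof. by move=> f1 fM; elim: n => //= n <-. Qed.

Lemma morph_id T U (G : group_law T) (H : group_law U) (f : T -> U) :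
  {morph f : x y / gop G x y >-> gop H x y} -> f (gid G) = gid H.
Proof.
by move=> fM; apply: (@gop_inj _ H (f (gid G))); rewrite -fM gop1 gopr1.
Qed.

Lemma morph_inv T U (G : group_law T) (H : group_law U) (f : T -> U) x :
  {morph f : x y / gop G x y >-> gop H x y} -> f (ginv G x) = ginv H (f x).
Proof. by move=> fM; apply: ginv_uniq; rewrite -fM goprV (morph_id fM). Qed.

Lemma morph_gz T U (G : group_law T) (H : group_law U) (f : T -> U) x n :
  {morph f : x y / gop G x y >-> gop H x y} -> f (gz G x n) = gz H (f x) n.
Proof.
move=> fM; have fX k : f (gpow G x k) = gpow H (f x) k.
  by apply: gpow_morph => [|y]; rewrite ?(morph_id fM).
by case: n => n; rewrite /gz ?(morph_inv _ fM) fX.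
Qed.

(** * Skew braces, morphisms and relative centres *)

Notation "0" := (gid (addg _)) : brace_scope.
Notation "x *+ n" := (gpow (addg _) x n) : brace_scope.
Notation "x *~ n" := (gz (addg _) x n) : brace_scope.
Notation "x ^+ n" := (gpow (circg _) x n) : brace_scope.
Notation "x ^-1" := (ginv (circg _) x) : brace_scope.

Section Lambda.
Variable B : skewBrace.
Implicit Types (a b x y : B) (S : set B).

Lemma lambda0 a : lambda a 0 = 0 :> B.
Proof. by rewrite /lambda circr0 gopV. Qed.

Lemma lambdaN a x : lambda a (- x) = - lambda a x.
Proof. exact: (morph_inv _ (lambdaD a)). Qed.

Lemma lambdaX a x n : lambda a (x *+ n) = lambda a x *+ n.
Proof. by apply: gpow_morph => [|y]; rewrite ?lambda0 ?lambdaD. Qed.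

Lemma lambdaK a : cancel (lambda a) (lambda a^-1).
Proof. by move=> x; rewrite -lambdaM gopV circ_id lambda_id. Qed.

Lemma lambdaVK a : cancel (lambda a^-1) (lambda a).
Proof. by move=> x; rewrite -lambdaM goprV circ_id lambda_id. Qed.

Lemma lambda_inj a : injective (lambda a).
Proof. exact: can_inj (lambdaK a). Qed.

Lemma lambda_pow a n x : lambda (a ^+ n) x = iter n (lambda a) x.
Proof. by elim: n => [|n IH] /=; rewrite ?circ_id ?lambda_id ?lambdaM ?IH. Qed.

Lemma addE a b : a + b = a ** lambda a^-1 b.
Proof. by rewrite circE lambdaVK. Qed.

Lemma cinvE a : a^-1 = - lambda a^-1 a.
Proof.
apply: ginv_uniq; apply: (@lambda_inj a).
rewrite lambdaD lambdaVK lambda0 -[X in X + _](@lambdaVK a) lambdaVK.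
by rewrite -circE goprV circ_id.
Qed.

Lemma sub_of_lambda S : subgroup (addg B) S ->
  (forall a b, S a -> S b -> S (lambda a b)) ->
  (forall a b, S a -> S b -> S (lambda a^-1 b)) -> sub_skew_brace S.
Proof.
move=> sS L LV; split=> //; have [S0 SD SN] := sS; split.
- by rewrite circ_id.
- by move=> x y Sx Sy; rewrite circE; apply/SD/L.
- by move=> x Sx; rewrite cinvE; apply/SN/LV.
Qed.

Lemma left_ideal_sub S : subgroup (addg B) S ->
  (forall a b, S b -> S (lambda a b)) -> sub_skew_brace S.
Proof. by move=> sS L; apply: sub_of_lambda => // a b _; apply: L. Qed.

Lemma cyclic_subgroup T (G : group_law T) (x : T) : subgroup G (range (gz G x)).
Proof.
split; first by exists 0%R.
  by move=> _ _ [n _ <-] [m _ <-]; exists (n + m)%R => //; rewrite gzD.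
by move=> _ [n _ <-]; exists (- n)%R => //; rewrite gzN.
Qed.

(** An element fixed by its own lambda map generates the same cyclic group, with
    the same powers, for both laws: this is the source of all the small
    sub-braces below. *)
Lemma pow_self x n : lambda x x = x -> x ^+ n = x *+ n.
Proof.
move=> lx; elim: n => [|n IH]; first by rewrite /= circ_id.
by rewrite /= -/(gpow (circg B) x n) IH circE lambdaX lx.
Qed.

Lemma gz_self x (n : int) : lambda x x = x -> gz (circg B) x n = x *~ n.
Proof.
move=> lx; case: n => n; first exact: pow_self.
have lV : lambda x^-1 x = x by rewrite -{2}lx lambdaK.
have eV : x^-1 = - x by rewrite cinvE lV.
change ((x ^+ n.+1)^-1 = - (x *+ n.+1)); rewrite -!gpow_inv eV.
by apply: pow_self; rewrite -[X in lambda X _]eV lambdaN lV.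
Qed.

Lemma cyclic_sub x : lambda x x = x -> sub_skew_brace (range (gz (addg B) x)).
Proof.
move=> lx; split; first exact: cyclic_subgroup.
have <- : gz (circg B) x = gz (addg B) x.
  by apply/funext => n; apply: gz_self.
exact: cyclic_subgroup.
Qed.

End Lambda.

Lemma ideal_sub (B : skewBrace) (I : set B) : ideal I -> sub_skew_brace I.
Proof. by move=> [[? _ _ _] _ [? _ _ _]]. Qed.

(** ** Morphisms *)

Record bhom (B C : skewBrace) := BHom {
  bfun :> B -> C;
  bhomD : {morph bfun : x y / x + y};
  bhomM : {morph bfun : x y / x ** y} }.

Section Morphisms.
Variables (B C : skewBrace) (f : bhom B C).

Lemma bhom0 : f 0 = 0. Proof. exact: morph_id (bhomD f). Qed.
Lemma bhomN x : f (- x) = - f x. Proof. exact: (morph_inv _ (bhomD f)). Qed.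
Lemma bhomV x : f x^-1 = (f x)^-1. Proof. exact: (morph_inv _ (bhomM f)). Qed.
Lemma bhomL a x : f (lambda a x) = lambda (f a) (f x).
Proof. by rewrite /lambda bhomD bhomN bhomM. Qed.
Lemma bhom_gz x n : f (x *~ n) = f x *~ n.
Proof. exact: (morph_gz _ _ (bhomD f)). Qed.
Lemma bhomX x n : f (x *+ n) = f x *+ n. Proof. exact: (bhom_gz x n). Qed.
Lemma bhom_pow x n : f (x ^+ n) = f x ^+ n.
Proof. exact: (morph_gz x n (bhomM f)). Qed.

Definition surj := forall y, exists x, f x = y.

Lemma preim_sub (S : set C) : sub_skew_brace S -> sub_skew_brace (f @^-1` S).
Proof.
move=> [[S0 SD SN] [S1 SM SV]]; rewrite /preimage; split; split=> /=.
- by rewrite bhom0.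
- by move=> x y; rewrite bhomD; apply: SD.
- by move=> x; rewrite bhomN; apply: SN.
- by rewrite circ_id bhom0 -circ_id.
- by move=> x y; rewrite bhomM; apply: SM.
- by move=> x; rewrite bhomV; apply: SV.
Qed.

Lemma preim_ideal (I : set C) : ideal I -> ideal (f @^-1` I).
Proof.
move=> iI; have [sA sC] := preim_sub (ideal_sub iI).
have [[_ _ _ cA] L [_ _ _ cC]] := iI.
split; [split=> // | move=> b x | split=> //]; rewrite /preimage /=.
- by move=> x y _ ?; rewrite !bhomD bhomN; apply: cA.
- by rewrite bhomL; apply: L.
- by move=> x y _ ?; rewrite !bhomM bhomV; apply: cC.
Qed.

Lemma image_ideal (I : set B) : surj -> ideal I -> ideal (f @` I).
Proof.
move=> sf [[[I0 ID IN] _ _ cA] L [[I1 IM IV] _ _ cC]].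
split; [split=> //; first split | move=> b _ [x Ix <-] | split=> //; first split].
- by exists 0; rewrite ?bhom0.
- by move=> _ _ [x Ix <-] [y Iy <-]; exists (x + y); rewrite ?bhomD //; apply: ID.
- by move=> _ [x Ix <-]; exists (- x); rewrite ?bhomN //; apply: IN.
- move=> x _ _ [y Iy <-]; have [x' <-] := sf x.
  by exists (x' + y + - x'); rewrite ?bhomD ?bhomN //; apply: cA.
- by have [b' <-] := sf b; exists (lambda b' x); rewrite ?bhomL //; apply: L.
- by exists (gid (circg B)); rewrite // (morph_id (bhomM f)).
- by move=> _ _ [x Ix <-] [y Iy <-]; exists (x ** y); rewrite ?bhomM //; apply: IM.
- by move=> _ [x Ix <-]; exists (x^-1); rewrite ?bhomV //; apply: IV.
- move=> x _ _ [y Iy <-]; have [x' <-] := sf x.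
  by exists (x' ** y ** x'^-1); rewrite ?bhomM ?bhomV //; apply: cC.
Qed.

Lemma dedekind_surj : surj -> dedekind B -> dedekind C.
Proof.
move=> sf dB S sS; have := image_ideal sf (dB _ (preim_sub sS)).
suff -> : f @` (f @^-1` S) = S by [].
apply/seteqP; split=> [_ [x Sx <-] //|y Sy].
by have [x xy] := sf y; exists x; rewrite /preimage /= ?xy.
Qed.

End Morphisms.

Definition quot_hom (B : skewBrace) (I : set B) (iI : ideal I) :
    bhom B (quotient iI) :=
  @BHom B (quotient iI) (@quot_proj B I) (quot_projD iI) (quot_projM iI).

Lemma quot_homP (B : skewBrace) (I : set B) (iI : ideal I) x y :
  quot_hom iI x = quot_hom iI y <-> I (- x + y).
Proof.
rewrite -(cosetP _ _ (ideal_sub iI).1); split; first by move/(congr1 val).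
by move=> e; apply: val_inj.
Qed.

Lemma quot_hom_surj (B : skewBrace) (I : set B) (iI : ideal I) :
  surj (quot_hom iI).
Proof. by move=> y; exists (rep y); apply: quot_projK. Qed.

(** Congruences modulo an ideal are proved as equalities in the quotient. *)
Lemma quot_ex (B : skewBrace) (I : set B) : ideal I -> exists (C : skewBrace)
  (f : bhom B C), surj f /\ (forall x y, f x = f y <-> I (- x + y)).
Proof.
move=> iI; exists (quotient iI), (quot_hom iI).
by split; [apply: quot_hom_surj | apply: quot_homP].
Qed.

Lemma ker0 (B C : skewBrace) (f : bhom B C) (I : set B) :
  (forall x y, f x = f y <-> I (- x + y)) -> forall x, f x = 0 <-> I x.
Proof.
by move=> k x; have := k 0 x; rewrite bhom0 ginv1 gop1 => <-; split=> ->.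
Qed.

Lemma preim0 (B C : skewBrace) (f : bhom B C) (I : set B) :
  (forall x, f x = 0 <-> I x) -> f @^-1` [set 0] = I.
Proof. by move=> k; apply/seteqP; split=> x /k. Qed.

(** ** The centre modulo an ideal *)

Lemma centerE (B : skewBrace) (x : B) : center B x <->
  forall b, [/\ x + b = b + x, x + b = x ** b & x + b = b ** x].
Proof.
split=> [[L A M] b|h]; first by rewrite -M circE L; split=> //; rewrite A.
split=> b; have [e1 e2 e3] := h b; rewrite -?e2 -?e3 //.
by rewrite /lambda -e2 ginvK_l.
Qed.

Lemma lambda_center (B : skewBrace) (x b : B) : center B x -> lambda b x = x.
Proof.
move=> /centerE/(_ b) [e1 e2 e3]; apply: (@gop_inj _ (addg B) b).
by rewrite -circE -e3 e1.
Qed.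

Section Centres.
Variable B : skewBrace.
Implicit Types (x y a b : B) (J I : set B).

(** For an ideal J these are the elements that are central modulo J; the three
    conditions also make b fix x modulo J in the lambda action. *)
Definition cen J : set B := [set x | forall b,
  [/\ J (- (x + b) + (b + x)), J (- (x + b) + x ** b) & J (- (x + b) + b ** x)]].

(** The upper central series modulo J. *)
Definition zs J k : set B := iter k cen J.

Lemma cen_sub J I : J `<=` I -> cen J `<=` cen I.
Proof. by move=> JI x cx b; have [? ? ?] := cx b; split; apply: JI. Qed.

Lemma zs_sub J I k : J `<=` I -> zs J k `<=` zs I k.
Proof. by move=> JI; elim: k => //= k; apply: cen_sub. Qed.

Lemma zsD J k m : zs J (k + m) = zs (zs J m) k.
Proof. exact: iterD. Qed.

Lemma cen_ker C (f : bhom B C) J : surj f ->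
  (forall x y, f x = f y <-> J (- x + y)) ->
  forall x, cen J x <-> center C (f x).
Proof.
move=> sf k x; rewrite centerE; split=> [c y|c b].
  have [b <-] := sf y; have [/k e1 /k e2 /k e3] := c b.
  by move: e1 e2 e3; rewrite !bhomD !bhomM.
have := c (f b); rewrite -!bhomD -!bhomM => -[/k ? /k ? /k ?].
by split.
Qed.

Lemma cen_ideal J : ideal J -> ideal (cen J).
Proof.
move=> /quot_ex [C [f [sf k]]]; have := preim_ideal f (center_ideal C).
suff -> : cen J = f @^-1` center C by [].
by apply/seteqP; split=> x /(cen_ker sf k).
Qed.

Lemma zs_ideal J k : ideal J -> ideal (zs J k).
Proof. by move=> iJ; elim: k => //= k; apply: cen_ideal. Qed.

Lemma sub_cen J : ideal J -> J `<=` cen J.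
Proof.
move=> /quot_ex [C [f [sf k]]] x /(ker0 k) fx.
by apply/(cen_ker sf k); rewrite fx; apply: center0.
Qed.

Lemma zs_le J k m : ideal J -> (k <= m)%N -> zs J k `<=` zs J m.
Proof.
move=> iJ /subnK <-; elim: (m - k)%N => // d IH x /IH.
by rewrite addSn; apply/sub_cen/zs_ideal.
Qed.

Lemma zs_top J k m : ideal J -> (k <= m)%N -> zs J k = setT -> zs J m = setT.
Proof. by move=> iJ km e; rewrite -subTset -e; apply: zs_le. Qed.

Lemma zs0T k : zs setT k = setT.
Proof.
by elim: k => //= k ->; apply/seteqP; split=> // x _ b.
Qed.

Lemma cen0 : cen [set 0] = center B.
Proof.
apply/seteqP; split=> x; rewrite centerE => h b; have := h b.
  by case=> e1 e2 e3; rewrite (ginv_uniq e1) (ginv_uniq e2) (ginv_uniq e3) ginv_inv.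
by move=> [<- <- <-]; rewrite gopV.
Qed.

End Centres.

Lemma cen_preim (B C : skewBrace) (f : bhom B C) (J : set C) : surj f ->
  cen (f @^-1` J) = f @^-1` cen J.
Proof.
move=> sf; apply/seteqP; split=> x c.
  move=> y; have [b <-] := sf y; have := c b; rewrite /preimage /=.
  by rewrite !bhomD !bhomN !bhomD !bhomM.
by move=> b; have := c (f b); rewrite /preimage /= !bhomD !bhomN !bhomD !bhomM.
Qed.

Lemma zs_preim (B C : skewBrace) (f : bhom B C) (J : set C) k : surj f ->
  zs (f @^-1` J) k = f @^-1` zs J k.
Proof. by move=> sf; elim: k => //= k ->; apply: cen_preim. Qed.

Lemma zs_quot (B C : skewBrace) (f : bhom B C) (J : set C) k : surj f ->
  zs (f @^-1` J) k = setT <-> zs J k = setT.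
Proof.
move=> sf; rewrite zs_preim //; split=> [e|->]; last by rewrite preimage_setT.
by rewrite -subTset => y _; have [x <-] := sf y; rewrite -[zs J k _]/((f @^-1` zs J k) x) e.
Qed.

Lemma upper_central_zs (B : skewBrace) k : upper_central B k = zs [set (0 : B)] k.
Proof.
elim: k => //= k <-; rewrite /upper_central /=.
case: (upper_central_ideal B k) => Z iZ /=.
by apply/seteqP; split=> x /(cen_ker (@quot_hom_surj _ _ iZ) (@quot_homP _ _ iZ)).
Qed.

Lemma centrally_nilpotentP (B : skewBrace) :
  centrally_nilpotent B <-> exists n, zs [set (0 : B)] n = setT.
Proof. by split=> -[n e]; exists n; rewrite -e upper_central_zs. Qed.

(** * Cauchy's theorem for finite skew braces *)

Section SubBrace.
Variables (B : skewBrace) (S : set B).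

Section SubLaw.
Variables (G : group_law B) (sS : subgroup G S).
Let sM (x y : S) : S :=
  exist _ (gop G (val x) (val y))
    (let: And3 _ M _ := sS in mem_set (M _ _ (set_mem (valP x)) (set_mem (valP y)))).
Let s1 : S := exist _ (gid G) (let: And3 e _ _ := sS in mem_set e).
Let sV (x : S) : S :=
  exist _ (ginv G (val x)) (let: And3 _ _ V := sS in mem_set (V _ (set_mem (valP x)))).
Let sA : associative sM. Proof. by move=> x y z; apply/val_inj/gopA. Qed.
Let s1M : left_id s1 sM. Proof. by move=> x; apply/val_inj/gop1. Qed.
Let sVM : left_inverse s1 sV sM. Proof. by move=> x; apply/val_inj/gopV. Qed.
Definition sub_law : group_law S := GroupLaw sA s1M sVM.
End SubLaw.

Hypothesis sS : sub_skew_brace S.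

Lemma sub_circ_add (a b c : S) :
  gop (sub_law sS.2) a (gop (sub_law sS.1) b c) =
  gop (sub_law sS.1)
    (gop (sub_law sS.1) (gop (sub_law sS.2) a b) (ginv (sub_law sS.1) a))
    (gop (sub_law sS.2) a c).
Proof. exact/val_inj/circ_add. Qed.

Definition sub_brace : skewBrace := SkewBrace sub_circ_add.

Definition sub_incl : bhom sub_brace B :=
  @BHom sub_brace B (fun x : S => val x) (fun _ _ => erefl) (fun _ _ => erefl).

Lemma sub_incl_inj : injective sub_incl. Proof. exact: val_inj. Qed.

Lemma sub_inclP x : S x <-> exists y, sub_incl y = x.
Proof.
split=> [Sx|[y <-]]; last exact: set_mem (valP y).
by exists (exist _ x (mem_set Sx)).
Qed.

Lemma dedekind_sub : dedekind B -> dedekind sub_brace.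
Proof.
move=> dB S' [[a1 aM aV] [c1 cM cV]].
have iS' : ideal (sub_incl @` S').
  apply: dB; split; split.
  - by exists 0; rewrite ?bhom0.
  - by move=> _ _ [x ? <-] [y ? <-]; exists (x + y); [apply: aM | rewrite bhomD].
  - by move=> _ [x ? <-]; exists (- x); [apply: aV | rewrite bhomN].
  - by exists (gid (circg _)) => //.
  - by move=> _ _ [x ? <-] [y ? <-]; exists (x ** y); [apply: cM | rewrite bhomM].
  - by move=> _ [x ? <-]; exists x^-1; [apply: cV | rewrite bhomV].
have := preim_ideal sub_incl iS'; suff -> : sub_incl @^-1` (sub_incl @` S') = S' by [].
apply/seteqP; split=> [x [y Sy /sub_incl_inj <-] //|x Sx].
by exists x.
Qed.

End SubBrace.

Definition fin_of (T : Type) (h : finite_set [set: T]) : Type := T.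

Section FinOf.
Variables (T : Type) (h : finite_set [set: T]).
HB.instance Definition _ := gen_eqMixin (fin_of h).
HB.instance Definition _ := gen_choiceMixin (fin_of h).

Lemma fin_of_enum : exists e : seq (fin_of h), Finite.axiom e.
Proof.
have /finite_seqP[s sE] : finite_set [set: fin_of h] := h.
exists (undup s) => x; rewrite count_uniq_mem ?undup_uniq // mem_undup.
have xs : [set` s] x by rewrite -sE.
by rewrite /= in xs; rewrite xs.
Qed.

Let enum_fin : seq (fin_of h) := sval (cid fin_of_enum).
Let enum_finP : Finite.axiom enum_fin := svalP (cid fin_of_enum).

Lemma fin_of_pcan :
  pcancel (fun x : fin_of h => index x enum_fin) (fun n => onth enum_fin n).
Proof.
move=> x; have xe : x \in enum_fin by rewrite -has_pred1 has_count enum_finP.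
by rewrite (onthE enum_fin) (nth_map x) ?nth_index ?index_mem.
Qed.
HB.instance Definition _ := PCanIsCountable fin_of_pcan.
HB.instance Definition _ := isFinite.Build (fin_of h) enum_finP.
End FinOf.

Definition law_group (fT : finType) (G : group_law fT) : Type := fT.
HB.instance Definition _ (fT : finType) (G : group_law fT) :=
  Finite.on (law_group G).
HB.instance Definition _ (fT : finType) (G : group_law fT) :=
  Finite_isGroup.Build (law_group G) (@gopA _ G) (@gop1 _ G) (@gopV _ G).

Section FiniteBrace.
Local Open Scope group_scope.
Local Open Scope set_scope.
Local Open Scope brace_scope.
Variables (fT : finType) (A C : group_law fT).
Hypothesis ca : forall a b c : fT,
  gop C a (gop A b c) = gop A (gop A (gop C a b) (ginv A a)) (gop C a c).
Let B := SkewBrace ca.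
Local Notation gA := (law_group A).
Local Notation gC := (law_group C).
Variable q : nat.
Hypothesis qp : prime q.

Definition lam_fun (x : gA) (a : gC) : gA := lambda ((a : B)^-1 : B) (x : B).
Definition mul_fun (x : gA) (a : gC) : gA := (a : B)^-1 ** (x : B).

Fact lam_fun1 : lam_fun^~ 1%g =1 id.
Proof. by move=> x; rewrite /lam_fun ginv1 circ_id lambda_id. Qed.
Fact lam_funM x : act_morph lam_fun x.
Proof. by move=> a b; rewrite /lam_fun ginvM lambdaM. Qed.
Definition lam_act := TotalAction lam_fun1 lam_funM.

Fact mul_fun1 : mul_fun^~ 1%g =1 id.
Proof. by move=> x; rewrite /mul_fun ginv1 gop1. Qed.
Fact mul_funM x : act_morph mul_fun x.
Proof. by move=> a b; rewrite /mul_fun ginvM gopA. Qed.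
Definition mul_act := TotalAction mul_fun1 mul_funM.

Lemma acts_total (T : finType) (to : {action gC &-> T}) (P : {group gC}) (S : {set T}) :
  (forall a x, a \in P -> x \in S -> to x a \in S) -> [acts P, on S | to].
Proof.
move=> h; apply/actsP => a Pa x; apply/idP/idP => [tS|/h]; last exact.
by rewrite -(actK to a x); apply: h; rewrite ?groupV.
Qed.

Lemma lam_image_group (Q : {group gA}) (a : gC) : group_set ((lam_act^*)%act (Q : {set gA}) a).
Proof.
apply/group_setP; split.
  by apply/imsetP; exists 1%g; rewrite ?group1 //=; symmetry; apply: (@lambda0 B).
move=> _ _ /imsetP[x Qx ->] /imsetP[y Qy ->]; apply/imsetP.
by exists (x * y)%g; rewrite ?groupM //; symmetry; apply: (@lambdaD B).
Qed.

(** A Sylow subgroup P of the circle group acts on the Sylow subgroups of the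
    additive group and then, by left multiplication, on the cosets of a fixed
    one Q; both sets have order prime to q. A fixed coset x + Q yields a
    conjugate of P that is also an additive Sylow subgroup. *)
Lemma sylow_sub_brace : exists (P : {group gC}) (Q : {group gA}),
  [/\ q.-Sylow([set: gC]) P, q.-Sylow([set: gA]) Q &
    forall z : fT, ((z : gC) \in P) = ((z : gA) \in Q)].
Proof.
have [P sP] := Sylow_exists q [set: gC].
have pP := pHall_pgroup sP.
have q1 := prime_gt1 qp.
pose S1 := [set gval Q | Q in 'Syl_q([set: gA])].
have act1 : [acts P, on S1 | lam_act^*].
  apply: acts_total => a _ Pa /imsetP[Q sQ ->]; apply/imsetP.
  exists (Group (lam_image_group Q a)) => //; move: sQ; rewrite !inE !pHallE !finset.subsetT /=.
  by rewrite card_setact.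
have [Q sQ fQ] : exists2 Q : {group gA}, q.-Sylow([set: gA]) Q
    & forall a, a \in P -> (lam_act^*)%act (Q : {set gA}) a = Q.
  have := pgroup_fix_mod pP act1; rewrite card_imset; last exact: val_inj.
  rewrite card_Syl_mod // => e.
  have /card_gt0P[X] : (0 < #|'Fix_(S1 | lam_act^*)(P)|)%N.
    by case: #|_| e => //; rewrite mod0n.
  rewrite inE => /andP[/imsetP[Q sQ ->] /afixP fQ].
  by exists Q => //; move: sQ; rewrite inE.
pose S2 := lcosets Q [set: gA].
have act2 : [acts P, on S2 | mul_act^*].
  apply: acts_total => a _ Pa /lcosetsP[x _ ->]; apply/lcosetsP.
  exists (mul_act x a) => //; apply/setP => y.
  have circ_coset (z : gA) : mul_fun (x * z)%g a = (mul_fun x a * lam_fun z a)%g.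
    rewrite /mul_fun /lam_fun; transitivity (((a : B)^-1 ** x + lambda ((a : B)^-1) z) : B) => //.
    by rewrite /lambda gopA -circ_add.
  apply/imsetP/lcosetP => [[_ /lcosetP[z Qz ->] ->]|[z Qz ->]].
    exists (lam_fun z a); last exact: circ_coset.
    by rewrite -{1}(fQ a Pa); apply/imsetP; exists z; rewrite /=.
  move: Qz; rewrite -{1}(fQ a Pa) => /imsetP[z' Qz' ->].
  by exists (x * z')%g; [apply/lcosetP; exists z' | exact: esym (circ_coset z')].
have [x fx] : exists x : gA, forall a, a \in P -> (mul_act^*)%act (x *: Q) a = x *: Q.
  have := pgroup_fix_mod pP act2; rewrite card_lcosets => e.
  have /card_gt0P[X] : (0 < #|'Fix_(S2 | mul_act^*)(P)|)%N.
    rewrite lt0n; apply/eqP => e0; move: e; rewrite e0 mod0n => /eqP.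
    rewrite -[_ == _]/(q %| _)%N; apply/negP; rewrite -prime_coprime //.
    by have /and3P[_ _] := sQ; rewrite p'natE // prime_coprime.
  rewrite inE => /andP[/lcosetsP[x _ ->] /afixP fx].
  by exists x.
exists (P :^ (x : gC))%G, (Group (lam_image_group Q (x : gC))); split.
- by rewrite pHallJ ?inE.
- by move: sQ; rewrite !pHallE !finset.subsetT /= card_setact.
suff PQ : forall z : fT, ((z : gC) \in (P :^ (x : gC))%G) ->
    ((z : gA) \in Group (lam_image_group Q (x : gC))).
  pose P' : {pred gA} := fun z => (z : gC) \in (P :^ (x : gC))%G.
  pose Q' : {pred gA} := fun z => (z : gA) \in Group (lam_image_group Q (x : gC)).
  suff e : P' =i Q' by [].
  apply/subset_cardP; last by apply/fintype.subsetP => z; apply: PQ.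
  have -> : #|P'| = #|(P :^ (x : gC))%G| by apply: (@eq_card gC).
  have -> : #|Q'| = #|Group (lam_image_group Q (x : gC))| by apply: (@eq_card gA).
  rewrite /= cardJg card_setact.
  by have := card_Hall sP; have := card_Hall sQ; rewrite !cardsT => -> ->.
move=> _ /imsetP[a Pa ->].
have : mul_fun x (a^-1)%g \in x *: Q.
  by rewrite -(fx (a^-1)%g) ?groupV //; apply/imsetP; exists x => //; apply: lcoset_refl.
case/lcosetP => z Qz e; apply/imsetP; exists z => //.
have {e} e : (a : B) ** (x : B) = (x : B) + z.
  by rewrite -[RHS]e /mul_fun -[X in X ** _](ginv_inv C).
transitivity ((x : B)^-1 ** ((a : B) ** (x : B))); first by [].
by rewrite e addE ginvK_l.
Qed.

Lemma brace_cauchy_fin (y : B) : y <> 0 -> y ^+ q = 0 ->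
  exists t : B, [/\ t <> 0, t *+ q = 0 & lambda t t = t].
Proof.
move=> y0 yq; have [P [Q [sP sQ PQ]]] := sylow_sub_brace.
have q1 := prime_gt1 qp.
have expE (x : gC) n : (x ^+ n)%g = gpow C x n.
  by elim: n => // n IH; rewrite expgS IH.
have expA (x : gA) n : (x ^+ n)%g = gpow A x n.
  by elim: n => // n IH; rewrite expgS IH.
have qdv : (q %| #|[set: gA]|)%N.
  have <- : #[y : gC] = q.
    apply: nt_prime_order => //; first by rewrite expE yq -circ_id.
    by apply/eqP => y1; apply: y0; rewrite -circ_id.
  have -> : #|[set: gA]| = #|[set: gC]| by rewrite !cardsT.
  by apply: order_dvdG; rewrite inE.
have PA (z : fT) : (z \in (P : {set gC})) = (z \in (Q : {set gA})) := PQ z.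
have actP : [acts P, on (Q : {set gA}) | lam_act].
  apply: acts_total => a z Pa Qz; rewrite /= /lam_fun /lambda.
  have PaV : (a^-1)%g \in P by rewrite groupV.
  have Pz : (z : gC) \in P by rewrite PA.
  have QaV : ((a^-1)%g : gA) \in Q by rewrite -PA.
  have Qaz : ((a^-1 * (z : gC))%g : gA) \in Q.
    by rewrite -PA; apply: (@groupM _ P).
  by have := groupM (groupVr QaV) Qaz.
have [z [Qz z1 fz]] : exists z : gA,
    [/\ z \in Q, z != 1%g & forall a : gC, a \in P -> lam_act z a = z].
  pose F := 'Fix_((Q : {set gA}) | lam_act)(P).
  have F1 : 1%g \in F.
    rewrite inE group1; apply/afixP => a _; exact: (@lambda0 B).
  have : (1 < #|F|)%N.
    have := pgroup_fix_mod (pHall_pgroup sP) actP.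
    have -> : #|Q| = 0 %[mod q].
      apply/eqP; rewrite mod0n; rewrite -[_ == _]/(q %| _)%N.
      rewrite (card_Hall sQ) p_part dvdn_exp // logn_gt0 mem_primes qp qdv.
      by rewrite andbT; apply/card_gt0P; exists (1%g : gA).
    rewrite mod0n => /esym/eqP; rewrite -[_ == _]/(q %| _)%N => /dvdn_leq le.
    by apply: leq_trans q1 (le _); apply/card_gt0P; exists 1%g.
  rewrite (cardsD1 1%g) F1 ltnS => /card_gt0P[z].
  rewrite in_setD1 finset.in_setI => /and3P[z1 Qz /afixP fz].
  by exists z.
have [k ok] := p_natP (mem_p_elt (pHall_pgroup sQ) Qz).
case: k ok => [|k] ok; first by case/eqP: z1; apply/eqP; rewrite -order_eq1 ok.
exists (gpow A z (q ^ k)); split.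
- move=> e; have : (#[z] %| q ^ k)%N by rewrite order_dvdn expA; apply/eqP.
  by rewrite ok dvdn_Pexp2l // ltnn.
- by apply: etrans (expg_order z); rewrite expA ok expnSr gpowM.
- have Pt : (gpow A z (q ^ k) : gC) \in P.
    by rewrite PA -expA; apply: (@groupX _ Q).
  apply: (@lambda_inj B (ginv C (gpow A z (q ^ k)))).
  rewrite -lambdaM gopV circ_id lambda_id lambdaX.
  by congr (gpow A _ _); symmetry; apply: fz Pt.
Qed.
End FiniteBrace.

(** The sub-brace generated by t has order q for both laws. *)
Lemma brace_cauchy (B : skewBrace) (S : set B) (q : nat) (y : B) :
  sub_skew_brace S -> finite_set S -> prime q ->
  S y -> y <> 0 -> y ^+ q = 0 ->
  exists t, [/\ S t, t <> 0, t *+ q = 0 & lambda t t = t].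
Proof.
move=> sS fS qp Sy y0 yq.
have fC : finite_set [set: sub_brace sS].
  rewrite -[setT]/(setT : set S).
  suff -> : [set: S] = sub_incl sS @^-1` S.
    by apply: finite_preimage fS => x z _ _; apply: sub_incl_inj.
  by apply/seteqP; split=> x _ //; apply/sub_inclP; exists x.
have /(sub_inclP sS)[y' y'y] := Sy.
have [] := @brace_cauchy_fin (fin_of fC) _ _ (@circ_add (sub_brace sS)) q qp y'.
- by move=> e; apply: y0; rewrite -y'y e bhom0.
- apply: (@sub_incl_inj _ _ sS); apply: etrans (bhom_pow (sub_incl sS) y' q) _.
  by rewrite y'y yq.
move=> t [t0 tq lt]; exists (sub_incl sS t); split.
- by apply/(sub_inclP sS); exists t.
- by rewrite -(bhom0 (sub_incl sS)) => /sub_incl_inj.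
- by rewrite -bhomX -(bhom0 (sub_incl sS)); congr (sub_incl sS _).
- by rewrite -bhomL; congr (sub_incl sS _).
Qed.

(** * An ideal of prime order below a centrally nilpotent quotient is central *)

Section Adjoin.
Variable B : skewBrace.
Implicit Types (V : set B) (y t : B).

Definition adj V y : set B := [set t | exists n : int, V (- (y *~ n) + t)].

Lemma adj_preim (C : skewBrace) (f : bhom B C) V y :
  (forall x z, f x = f z <-> V (- x + z)) ->
  adj V y = f @^-1` range (gz (addg C) (f y)).
Proof.
move=> k; apply/seteqP; split=> t.
  by move=> [n /k e]; exists n; rewrite // -e bhom_gz.
by move=> [n _ e]; exists n; apply/k; rewrite bhom_gz e.
Qed.

Lemma adj_sub V y : ideal V -> V (- y + lambda y y) -> sub_skew_brace (adj V y).
Proof.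
move=> /quot_ex [C [f [sf k]]] /k ly; rewrite (adj_preim y k).
by apply/preim_sub/cyclic_sub; rewrite -bhomL ly.
Qed.

Lemma sub_adj V y : V `<=` adj V y.
Proof. by move=> t Vt; exists 0%R; rewrite /= ginv1 gop1. Qed.

Lemma mem_adj V y : ideal V -> adj V y y.
Proof.
by move=> /ideal_sub[[V0 _ _] _]; exists 1%R; rewrite gz1 gopV.
Qed.

Lemma cen_lambda V y b : cen V y -> ideal V -> V (- y + lambda b y).
Proof.
move=> cy /quot_ex [C [f [sf k]]]; apply/k; rewrite bhomL lambda_center //.
exact/(cen_ker sf k).
Qed.

Lemma adj_cen_sub V y : ideal V -> cen V y -> sub_skew_brace (adj V y).
Proof. by move=> iV cy; apply: adj_sub => //; apply: cen_lambda. Qed.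

End Adjoin.

Lemma zorn_above T (Phi : set (set T)) S0 : Phi S0 ->
  (forall F : set (set T), F !=set0 -> F `<=` Phi -> total_on F subset ->
    Phi (\bigcup_(X in F) X)) ->
  exists M, [/\ Phi M, S0 `<=` M & forall S, Phi S -> M `<=` S -> S = M].
Proof.
move=> P0 PU; pose P S := S = set0 \/ Phi S /\ S0 `<=` S.
have [F FP tF|M [[M0|[PM SM]] mM]] := @Zorn_bigcup T P.
- have [[X [FX [PX SX]]]|no] := pselect (exists X, F X /\ (Phi X /\ S0 `<=` X)).
    right; split; last by move=> t /SX Xt; exists X.
    have -> : \bigcup_(X in F) X = \bigcup_(X in F `&` (fun X => Phi X /\ S0 `<=` X)) X.
      apply/seteqP; split=> t [Y FY Yt]; exists Y => //; last by case: FY.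
      by split=> //; have [Y0|//] := FP _ FY; rewrite Y0 in Yt.
    apply: PU; first by exists X.
      by move=> Y [_ []].
    by move=> Y Z [? _] [? _]; apply: tF.
  left; apply/seteqP; split=> // t [X FX Xt].
  by have [X0|?] := FP _ FX; [rewrite X0 in Xt | case: no; exists X].
- have [[t St]|nS] := pselect (exists t, S0 t).
    case: (mM S0); last by right; split.
    by split; [rewrite M0 | rewrite M0 => /(_ _ St)].
  exists S0; split=> // S PS _; have [->|SS] := pselect (S = S0); first by [].
  have S00 : S0 = set0 by apply/seteqP; split=> // t St; case: nS; exists t.
  case: (mM S); last by right; split=> //; rewrite S00.
  split; rewrite M0 // => SS0; apply: SS; rewrite S00.
  by apply/seteqP; split.
- exists M; split=> // S PS MS; apply/seteqP; split=> //; apply: contrapT => n.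
  by case: (mM S); [split | right; split=> //; apply: subset_trans MS].
Qed.

Lemma subgroup_bigcup T (G : group_law T) (F : set (set T)) : F !=set0 ->
  F `<=` subgroup G -> total_on F subset -> subgroup G (\bigcup_(X in F) X).
Proof.
move=> [X FX] FG tF; split.
- by exists X => //; case: (FG _ FX).
- move=> x y [Y FY Yx] [Z FZ Zy].
  have [YZ|ZY] := tF _ _ FY FZ.
    by exists Z => //; have [_ M _] := FG _ FZ; apply: M => //; apply: YZ.
  by exists Y => //; have [_ M _] := FG _ FY; apply: M => //; apply: ZY.
- by move=> x [Y FY Yx]; exists Y => //; have [_ _ V] := FG _ FY; apply: V.
Qed.

Definition monolithic (B : skewBrace) (x : B) : Prop :=
  forall (S : set B) y, sub_skew_brace S -> S y -> y <> 0 -> S x.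

(** Divide by a sub-brace maximal among those that miss x. It is an ideal, and
    every larger sub-brace contains x. *)
Lemma monolithic_quotient (B : skewBrace) (x : B) : dedekind B -> x <> 0 ->
  exists (C : skewBrace) (f : bhom B C),
    [/\ surj f, dedekind C, f x <> 0 & monolithic (f x)].
Proof.
move=> dB x0; have s0 : sub_skew_brace [set (0 : B)] by apply/ideal_sub/zero_ideal.
pose Phi (S : set B) := sub_skew_brace S /\ ~ S x.
have [||M [[sM Mx] _ mM]] := @zorn_above B Phi [set 0].
- by split=> // x0'; apply: x0.
- move=> F F0 FP tF; split; last by move=> [X /FP[_ nX]].
  by split; apply: subgroup_bigcup => // X /FP[[]].
have /quot_ex[C [f [sf k]]] := dB _ sM.
exists C, f; split=> //; first exact: dedekind_surj sf dB.
  by move/(ker0 k).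
move=> S y sS Sy y0; apply: contrapT => nx; have [z fz] := sf y.
have e : f @^-1` S = M.
  apply: mM; first by split=> //; apply: preim_sub.
  by move=> t /(ker0 k) ft; rewrite /preimage /= ft; case: sS => [[]].
by apply: y0; rewrite -fz; apply/(ker0 k); rewrite -e /preimage /= fz.
Qed.

Lemma prime_power T (G : group_law T) (y : T) m : (0 < m)%N ->
  y <> gid G -> gpow G y m = gid G ->
  exists q k, [/\ prime q, (q %| m)%N, gpow G y k <> gid G &
    gpow G (gpow G y k) q = gid G].
Proof.
elim/ltn_ind: m y => m IH y m0 y1 ym.
have m1 : (1 < m)%N by case: m {IH} m0 ym => [|[|]] //; rewrite gpow1.
have qp := pdiv_prime m1; have /dvdnP[d md] := pdiv_dvd m.
have [e|ne] := pselect (gpow G y d = gid G); last first.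
  by exists (pdiv m), d; split; rewrite ?pdiv_dvd // -gpowM -md.
have d0 : (0 < d)%N by case: d md e => // m0'; rewrite m0' in m0.
have dm : (d < m)%N by rewrite md ltn_Pmulr // prime_gt1.
have [q [k [? qd ? ?]]] := IH d dm y d0 y1 e.
by exists q, k; split=> //; rewrite md dvdn_mulr.
Qed.

Lemma iter_mul T (phi : T -> T) x n r : iter n phi x = x -> iter (n * r) phi x = x.
Proof. by move=> e; elim: r => [|r IH]; rewrite ?muln0 // mulnS iterD IH. Qed.

(** Fermat's little theorem for an automorphism of a group of order p. *)
Lemma fermat_iter T (G : group_law T) (p k : nat) (phi : T -> T) (x : T) :
  prime p -> x <> gid G -> gpow G x p = gid G ->
  {morph phi : y z / gop G y z} -> injective phi -> phi x = gpow G x k ->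
  iter p.-1 phi x = x.
Proof.
move=> pp x1 xp phiM phiI xk.
have itE n : iter n phi x = gpow G x (k ^ n).
  elim: n => [|n IH]; first by rewrite expn0 gpow1.
  rewrite iterS IH; have := morph_gz x (k ^ n)%N phiM.
  by rewrite /gz => ->; rewrite xk expnS gpowM.
have pk : coprime k p.
  rewrite coprime_sym prime_coprime //; apply/negP => /dvdnP[r kr]; apply: x1.
  by apply: phiI; rewrite (morph_id phiM) xk kr mulnC gpowM xp gpow_id.
have := Euler_exp_totient pk; rewrite totient_prime // itE => e.
rewrite (divn_eq (k ^ p.-1) p) e modn_small ?prime_gt1 // gpowD gpow1.
by rewrite mulnC gpowM xp gpow_id gop1.
Qed.

Lemma conj_iter T (G : group_law T) (a x : T) n :
  iter n (fun t => gop G (gop G a t) (ginv G a)) x =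
  gop G (gop G (gpow G a n) x) (ginv G (gpow G a n)).
Proof.
elim: n => [|n IH]; first by rewrite /= ginv1 gop1 gopr1.
by rewrite iterS IH [gpow G a n.+1]/= ginvM -!gopA.
Qed.

Lemma conj_morph T (G : group_law T) (a : T) :
  {morph (fun t => gop G (gop G a t) (ginv G a)) : y z / gop G y z}.
Proof. by move=> y z; rewrite !greduce. Qed.

Lemma conj_inj T (G : group_law T) (a : T) :
  injective (fun t => gop G (gop G a t) (ginv G a)).
Proof.
by move=> y z /= e; apply: (@gop_inj _ G a); apply: (@gop_injr _ G (ginv G a) _ _ e).
Qed.

Lemma conj_fix T (G : group_law T) (a x : T) :
  gop G (gop G a x) (ginv G a) = x <-> gop G a x = gop G x a.
Proof.
split=> [e|->]; last by rewrite !greduce.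
by rewrite -{2}e !greduce.
Qed.

Lemma cen_pow (B : skewBrace) (J : set B) b n : ideal J -> cen J b ->
  J (- (b *+ n) + b ^+ n).
Proof.
move=> /quot_ex [C [f [sf k]]] /(cen_ker sf k) cb; apply/k.
by rewrite bhomX bhom_pow pow_self // lambda_center.
Qed.

(** The exponent of the centre bounds that of the next central factor: for b in
    the second centre the maps sending u to the commutators of b with u take
    central values, and are multiplicative in b. *)
Lemma center_exponent (B : skewBrace) N :
  (forall z : B, center B z -> z *+ N = 0) ->
  forall b : B, cen (center B) b -> center B (b *+ N) /\ center B (b ^+ N).
Proof.
move=> ZN b cb; have iZ := center_ideal B.
have [[Z0 ZD ZV] ZC] := ideal_sub iZ.
have cpow := cen_pow N iZ cb.
suff cN : center B (b ^+ N).
  split=> //; rewrite -(ginv_inv (addg B) (b *+ N)).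
  have -> : - (b *+ N) = - (b *+ N) + b ^+ N + - (b ^+ N).
    by rewrite -gopA goprV gopr1.
  by apply/ZV/ZD => //; apply/ZV.
have lamE n u : lambda (b ^+ n) u = u + (- u + lambda b u) *+ n.
  have cg : center B (- u + lambda b u).
    have [_] := cb u; rewrite circE => + _; rewrite ginvM -gopA ginvK_l //.
  elim: n => [|n IH]; first by rewrite /= circ_id lambda_id gopr1.
  rewrite [b ^+ n.+1]/= lambdaM IH lambdaD lambdaX (lambda_center b cg).
  have e : lambda b u = u + (- u + lambda b u) by rewrite ginvK_r.
  by rewrite {1}e -gopA.
have [eA eL eM] : [/\ forall u, b *+ N + u = u + b *+ N,
    forall u, lambda (b ^+ N) u = u & forall u, b ^+ N ** u = u ** b ^+ N].
  split=> u.
  - pose h := - (u + b) + (b + u).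
    have ch : center B h.
      have [h1 _ _] := cb u; move: (ZV _ h1); rewrite ginvM ginv_inv; exact.
    have hb v : h + v = v + h by have [-> _ _] := (centerE h).1 ch v.
    have e : b + u = u + (b + h) by rewrite gopA /h ginvK_r.
    clearbody h; apply/conj_fix; rewrite -[LHS]conj_iter.
    suff it n : iter n (fun t => b + t + - b) u = u + h *+ n by rewrite it ZN ?gopr1.
    elim: n => [|n IH]; first by rewrite gopr1.
    rewrite iterS IH gopA e -!gopA (gpow_comm n (hb (- b))).
    by rewrite [h + (- b + _)]gopA (hb (- b)) -gopA ginvK_r.
  - rewrite lamE ZN ?gopr1 //.
    have [_] := cb u; rewrite circE => + _; rewrite ginvM -gopA ginvK_l //.
  - pose h := (u ** b)^-1 ** (b ** u).
    have ch : center B h.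
      have /quot_ex[C [f [sf k]]] := iZ.
      have /(cen_ker sf k)/centerE/(_ (f u)) [e1 e2 e3] := cb.
      apply/(ker0 k); rewrite bhomM bhomV !bhomM -e2 e3 gopV.
      exact: circ_id.
    have hb v : h ** v = v ** h.
      by have [_ <- <-] := (centerE h).1 ch v.
    have e : b ** u = u ** (b ** h) by rewrite gopA /h ginvK_r.
    clearbody h; apply/conj_fix; rewrite -[LHS]conj_iter.
    have hN : h ^+ N = gid (circg B).
      by rewrite pow_self ?ZN ?circ_id // lambda_center.
    suff it n : iter n (fun t => b ** t ** b^-1) u = u ** h ^+ n by rewrite it hN gopr1.
    elim: n => [|n IH]; first by rewrite gopr1.
    rewrite iterS IH gopA e -!gopA (gpow_comm n (hb (b^-1))).
    by rewrite [h ** (b^-1 ** _)]gopA (hb (b^-1)) -gopA ginvK_r.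
apply/centerE => u; rewrite circE eL.
split=> //; last by rewrite -eM circE eL.
have := cpow; move/(ZV _); rewrite ginvM ginv_inv => /centerE/(_ u) [c _ _].
have -> : b ^+ N = b *+ N + - (- (b ^+ N) + b *+ N) by rewrite ginvM ginv_inv ginvK_r.
have c' : u + - (- (b ^+ N) + b *+ N) = - (- (b ^+ N) + b *+ N) + u.
  apply: (@gop_inj _ (addg B) (- (b ^+ N) + b *+ N)).
  by rewrite gopA c -gopA goprV gopr1 ginvK_r.
by rewrite -gopA -c' gopA eA -gopA.
Qed.

(** The three ways in which an element acts on a skew brace: the lambda map, and
    conjugation for each law. They are treated uniformly: each is an
    automorphism of one of the two groups, and a homomorphism in a for one of
    the two laws. *)
Inductive action_kind := Lam | AddConj | CircConj.

Section Actions.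
Variable B : skewBrace.
Implicit Types (i : action_kind) (a x y t : B) (J : set B).

Definition act i a : B -> B :=
  match i with
  | Lam => lambda a
  | AddConj => fun t => a + t + - a
  | CircConj => fun t => a ** t ** a^-1
  end.

Definition act_law i : group_law B := if i is CircConj then circg B else addg B.

Definition act_pow i a n : B := if i is AddConj then a *+ n else a ^+ n.

Lemma act_morph i a : {morph act i a : y z / gop (act_law i) y z}.
Proof.
by case: i => y z /=; rewrite ?lambdaD //; apply: (conj_morph _ a).
Qed.

Lemma act_inj i a : injective (act i a).
Proof. by case: i => /=; [apply: lambda_inj | apply: conj_inj | apply: conj_inj]. Qed.

Lemma act_iter i a n x : iter n (act i a) x = act i (act_pow i a n) x.
Proof. by case: i; rewrite /= ?lambda_pow ?conj_iter. Qed.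

Lemma act_center x : center B x <-> forall i a, act i a x = x.
Proof.
split=> [cx i a|h].
  have := (centerE x).1 cx a; case: i => -[e1 e2 e3] /=; first exact: lambda_center.
    by apply/conj_fix.
  by apply/conj_fix; rewrite -e2 -e3.
apply/centerE => b.
have /= e1 := h Lam b; have /= /conj_fix e2 := h AddConj b.
have /= /conj_fix e3 := h CircConj b.
by split; rewrite // -?e3 circE e1 e2.
Qed.

Lemma act_ideal i a J t : ideal J -> J t -> J (act i a t).
Proof.
move=> [[_ _ _ cA] L [_ _ _ cC]] Jt.
by case: i => /=; [apply: L | apply: cA | apply: cC].
Qed.

Lemma act_bhom (C : skewBrace) (f : bhom B C) i a t :
  f (act i a t) = match i with
    Lam => lambda (f a) (f t) | AddConj => f a + f t + - f a
  | CircConj => f a ** f t ** (f a)^-1 end.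
Proof. by case: i; rewrite /= ?bhomL ?bhomD ?bhomN ?bhomM ?bhomV. Qed.

Lemma gz_law i v n : lambda v v = v -> gz (act_law i) v n = v *~ n.
Proof. by case: i => //= lv; apply: gz_self. Qed.

End Actions.

Lemma act_cen (B : skewBrace) (J : set B) i (a u : B) :
  ideal J -> cen J u -> J (- u + act i a u).
Proof.
move=> /quot_ex[C [f [sf k]]] /(cen_ker sf k) /act_center cu; apply/k.
by rewrite act_bhom -[LHS](cu i (f a)); case: i.
Qed.

Section PrimeIdeal.
Variables (B : skewBrace) (x : B) (p c : nat).
Hypotheses (dB : dedekind B) (pp : prime p) (x0 : x <> 0) (xp : x *+ p = 0).
Hypotheses (lx : lambda x x = x) (mx : monolithic x).
Let I : set B := range (gz (addg B) x).
Hypothesis hc : zs I c = setT.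

Let iI : ideal I. Proof. exact/dB/cyclic_sub. Qed.
Let Ix : I x. Proof. by exists 1%R; rewrite ?gz1. Qed.
Let p0 : (0 < p)%N. Proof. exact: prime_gt0. Qed.

Let Inat t : I t -> exists n, t = x *+ n.
Proof. by move=> [n _ <-]; apply: gz_modn xp. Qed.

Let Ip t m : I t -> t *+ (p * m) = 0.
Proof. by move=> /Inat[n ->]; rewrite -gpowM mulnC -mulnA gpowM xp gpow_id. Qed.

Let Iself t : I t -> lambda t t = t.
Proof.
by move=> /Inat[n ->]; rewrite -{1}pow_self // lambdaX lambda_pow; congr (_ *+ n);
  elim: n => //= n ->.
Qed.

Let powI i t n : I t -> gpow (act_law B i) t n = t *+ n.
Proof. by move=> /Iself It; apply: (gz_law i n It). Qed.

Let fermat_act i a : iter p.-1 (act i a) x = x.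
Proof.
have [k xk] := Inat (act_ideal i a iI Ix).
apply: (@fermat_iter _ (act_law B i) p k) => //.
- by case: (i); rewrite //= circ_id.
- by rewrite powI // xp; case: (i); rewrite //= circ_id.
- exact: act_morph.
- exact: act_inj.
- by rewrite powI.
Qed.

(** If u is central modulo I and centralises I, then v = 2p u generates the same
    cyclic group for both laws and is fixed by every action; the factor 2 makes
    the binomial coefficient 'C(2p, 2) a multiple of p even for p = 2. As every
    non-zero sub-brace contains x, either v = 0 or x is fixed too. *)
Let fixed_multiple i a u : cen I u -> lambda u x = x -> u + x = x + u ->
  u ** x = x ** u -> act i a x = x \/ u ^+ (2 * p) = 0.
Proof.
move=> cu lu au mu; set N := (2 * p)%N.
have lxu : lambda x u = u.
  by apply: (@gop_inj _ (addg B) x); rewrite -circE -mu circE lu au.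
have Iau t : I t -> t + u = u + t.
  by move=> /Inat[n ->]; apply: gpow_comm.
have Ilu t : I t -> lambda u t = t.
  by move=> /Inat[n ->]; rewrite lambdaX lu.
have Imu t : I t -> t ** u = u ** t.
  move=> /Inat[n ->]; rewrite -(pow_self n lx).
  by apply: gpow_comm.
have IN t : I t -> t *+ N = 0 by move=> It; rewrite /N mulnC; apply: Ip.
pose j := - u + lambda u u; have luj : lambda u u = u + j by rewrite ginvK_r.
have Ij : I j by apply: act_cen Lam _ _ iI cu.
clearbody j.
have powu n : u ^+ n = u *+ n + j *+ 'C(n, 2).
  elim: n => [|n IH]; first by rewrite /= circ_id gop1.
  rewrite [u ^+ n.+1]/= -/(gpow _ u n) IH circE lambdaD !lambdaX luj (Ilu _ Ij).
  by rewrite gpow_mul ?Iau // binS bin1 addnC gpowD !gopA.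
have eN : u ^+ N = u *+ N.
  have -> : u ^+ N = u *+ N + j *+ (p * N.-1).
    by rewrite powu bin2 {2}/N -mulnA mul2n doubleK.
  by rewrite Ip // gopr1.
have lN : lambda (u ^+ N) u = u.
  have it n : iter n (lambda u) u = u + j *+ n.
    elim: n => [|n IH]; first by rewrite gopr1.
    by rewrite iterS IH lambdaD luj lambdaX (Ilu _ Ij) -gopA.
  by rewrite lambda_pow it IN // gopr1.
set v := u ^+ N; have lv : lambda v v = v by rewrite {2 3}/v eN lambdaX lN.
have av : act i a v = v.
  have additive b : I (- u + b) -> b *+ N = v.
    move=> It; rewrite -(ginvK_r (addg B) u b) gpow_mul ?(Iau _ It) //.
    by rewrite (IN _ It) gopr1 -eN.
  have ci := act_cen i a iI cu; case: i ci => ci.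
  - by rewrite {1}/v eN [LHS]lambdaX; apply: additive.
  - rewrite {1}/v eN (morph_gz u N (act_morph AddConj a)).
    exact: additive.
  - rewrite {1}/v (morph_gz u N (act_morph CircConj a)) /act_law.
    have It : I (u^-1 ** act CircConj a u).
      have [C [f [sf k]]] := quot_ex iI; apply/(ker0 k).
      by rewrite bhomM bhomV -((k _ _).2 ci) gopV circ_id.
    rewrite -[act _ a u](ginvK_r (circg B) u) -[LHS]/(_ ^+ N) gpow_mul ?(Imu _ It) //.
    by rewrite (powI CircConj _ It) (IN _ It) -circ_id gopr1.
have [v0|vn0] := pselect (v = 0); [by right | left].
have [n _ <-] := mx (cyclic_sub lv) (ex_intro2 _ _ 1%R Logic.I (gz1 _ v)) vn0.
by rewrite -(gz_law i n lv) (morph_gz v n (act_morph i a)) av.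
Qed.

Hypothesis moved : ~ center B x.

Let E := (p.-1 * (2 * p))%N.

Let E0 : (0 < E)%N.
Proof. by rewrite !muln_gt0 p0 andbT; case: p pp => [|[]]. Qed.

Let center_torsion z : cen I z -> z ^+ E = 0.
Proof.
move=> cz; set u := z ^+ p.-1.
have [[_ _ _ _] _ [sC _ _ _]] := cen_ideal iI.
have cu : cen I u by exact: (subgroup_gpow _ sC cz).
have uz : I (- (z *+ p.-1) + u) by apply: cen_pow.
have au : u + x = x + u.
  have -> : u = z *+ p.-1 + (- (z *+ p.-1) + u) by rewrite ginvK_r.
  have e1 : z *+ p.-1 + x = x + z *+ p.-1.
    apply/conj_fix; rewrite -[LHS]/(act AddConj (act_pow AddConj z p.-1) x).
    by rewrite -act_iter fermat_act.
  by have [n ->] := Inat uz; rewrite -gopA (gpow_comm n (erefl (x + x))) gopA e1 -gopA.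
have mu : u ** x = x ** u.
  apply/conj_fix; rewrite -[LHS]/(act CircConj (act_pow CircConj z p.-1) x).
  by rewrite -act_iter fermat_act.
have lu : lambda u x = x.
  rewrite -[LHS]/(act Lam (act_pow Lam z p.-1) x).
  by rewrite -act_iter fermat_act.
apply: contrapT => zE; apply: moved; apply/act_center => i a.
by have [//|u0] := fixed_multiple i a cu lu au mu; case: zE; rewrite gpowM.
Qed.

Let N := (p ^ E)%N.

(** Elements of order a prime q <> p would give, by Cauchy's theorem, a sub-brace
    of order q, which cannot contain x. *)
Let center_p_torsion z : cen I z -> z ^+ N = 0.
Proof.
move=> cz; apply: contrapT => zN; rewrite -circ_id in zN.
have iZ := cen_ideal iI; have [_ _ [sC _ _ _]] := iZ.
have EE : (N * E`_p^' = E * (p ^ (E - logn p E)))%N.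
  rewrite -[X in (X * p ^ _)%N](partnC p E0) p_part mulnAC; congr (_ * _)%N.
  by rewrite -expnD subnKC //; apply/ltnW/ltn_logl.
have [||q [k [qp qE yk yq]]] := @prime_power _ (circg B) (z ^+ N) E`_p^' _ zN.
- exact: part_gt0.
- by rewrite -gpowM EE gpowM center_torsion // -circ_id gpow_id.
have {qE} qnp : coprime q p.
  rewrite prime_coprime // dvdn_prime2 //; apply/eqP => qp'.
  rewrite qp' in qE; have := pnat_dvd qE (part_pnat p^' E).
  by rewrite p'natE ?dvdnn.
set y := _ ^+ k in yk yq; rewrite circ_id in yk yq.
have cy : cen I y.
  by exact: (subgroup_gpow _ sC (subgroup_gpow _ sC cz)).
have sV := adj_cen_sub iI cy.
have qy : I (y *+ q).
  have := cen_pow q iI cy; rewrite yq gopr1; have [[_ _ V] _] := ideal_sub iI.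
  by move/V; rewrite ginv_inv.
have fV : finite_set (adj I y).
  apply: (@sub_finite_set _ _ ((fun nk => y *+ nk.1 + x *+ nk.2) @` (`I_q `*` `I_p))).
    move=> t [n nt]; have q0 := prime_gt0 qp.
    pose m := `|(n %% q)%Z|%N; have mE : Posz m = (n %% q)%Z.
      by rewrite /m gez0_abs ?modz_ge0 //; lia.
    have [r rE] : exists r, - (y *+ m) + t = x *+ r.
      apply: Inat; have [[_ aD _] _] := ideal_sub iI.
      rewrite -(ginvK_r (addg B) (y *~ n) t) gopA; apply: aD => //.
      rewrite (divz_eq n q) addrC mulrC gzD -mE gz_nat ginvK_l gzM gz_nat.
      exact: subgroup_gz (ideal_sub iI).1 qy.
    exists (m, (r %% p)%N).
      split=> /=; last by rewrite ltn_mod.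
      by rewrite -ltz_nat mE ltz_pmod.
    rewrite /= -{1}(ginvK_r (addg B) (y *+ m) t) rE {2}(divn_eq r p) gpowD mulnC.
    by rewrite gpowM xp gpow_id gop1.
  apply: finite_image; exact: finite_setX.
have [t [Vt t0 tq lt]] := brace_cauchy sV fV qp (mem_adj y iI) yk yq.
have [n _ xt] := mx (cyclic_sub lt) (ex_intro2 _ _ 1%R Logic.I (gz1 _ t)) t0.
apply: x0; apply: (gpow_gcd _ xp qnp).
rewrite -xt -gz_nat -gzM mulrC gzM gz_nat tq; exact: gz_id.
Qed.
Let factor_exponent k b : zs I k.+1 b -> zs I k (b ^+ N) /\ zs I k (b *+ N).
Proof.
elim: k b => [|k IH] b cb.
  have [[[I0 ID IV] _ _ _] _ _] := iI.
  have bN := center_p_torsion cb; rewrite /zs /= bN; split=> //.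
  have := cen_pow N iI cb; rewrite bN gopr1 => /IV; rewrite ginv_inv; exact.
have iJ := zs_ideal k iI; have [C [f [sf ker]]] := quot_ex iJ.
have cE : cen (zs I k) = f @^-1` center C.
  by apply/seteqP; split=> t /(cen_ker sf ker).
have [||c1 c2] := @center_exponent C N _ (f b).
- move=> z; have [t <-] := sf z; move=> /(cen_ker sf ker)/IH[_ tN].
  by rewrite -bhomX; apply/(ker0 ker).
- by rewrite -[cen _ _]/((f @^-1` cen (center C)) b) -cen_preim // -cE.
by split; apply/(cen_ker sf ker); rewrite ?bhom_pow ?bhomX.
Qed.

Let total_exponent a : I (a ^+ (N ^ c)%N) /\ I (a *+ (N ^ c)%N).
Proof.
have : zs I c a by rewrite hc.
elim: (c) a => [|k IH] a; first by rewrite !gpow1.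
by move=> /factor_exponent[/IH[h1 _] /IH[_ h2]]; rewrite expnS !gpowM.
Qed.

Let I_fixes i t : I t -> act i t x = x.
Proof.
move=> /Inat[n ->]; case: i => /=.
- by rewrite -pow_self // lambda_pow; elim: n => //= n ->.
- by apply/conj_fix; apply: gpow_comm.
- by apply/conj_fix; rewrite -pow_self //; apply: gpow_comm.
Qed.

Lemma monolith_contra : False.
Proof.
apply: moved; apply/act_center => i a.
have e1 : iter (N ^ c) (act i a) x = x.
  by rewrite act_iter; apply: I_fixes; have [? ?] := total_exponent a; case: (i).
have e2 := iter_mul (\sum_(j < E * c) p ^ j)%N (fermat_act i a).
have NE : (N ^ c = (p.-1 * \sum_(j < E * c) p ^ j).+1)%N.
  by rewrite -predn_exp prednK ?expn_gt0 ?p0 // -expnM.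
by rewrite -[RHS]e1 NE iterS e2.
Qed.

End PrimeIdeal.

(** In a central series the action of a on the order-p ideal generated by x has
    both an order dividing p - 1 and, in the quotient where x is made
    unavoidable, a p-power order. *)
Lemma prime_ideal_center (B : skewBrace) (x : B) p c : dedekind B -> prime p ->
  x <> 0 -> x *+ p = 0 -> lambda x x = x ->
  zs (range (gz (addg B) x)) c = setT -> center B x.
Proof.
move=> dB pp x0 xp lx hc; have [C [f [sf dC fx0 mfx]]] := monolithic_quotient dB x0.
have fxp : f x *+ p = 0 by rewrite -bhomX xp bhom0.
have lfx : lambda (f x) (f x) = f x by rewrite -bhomL lx.
have cfx : center C (f x).
  apply: contrapT => nc; apply: (monolith_contra dC pp fx0 fxp lfx mfx _ nc).
  apply/(zs_quot _ _ sf); rewrite -subTset -hc; apply: zs_sub.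
  by move=> _ [n _ <-]; exists n; rewrite ?bhom_gz.
have iI : ideal (range (gz (addg B) x)) by apply/dB/cyclic_sub.
have Ix : range (gz (addg B) x) x by exists 1%R; rewrite ?gz1.
apply/act_center => i a.
have [[_ ID IV] _] := ideal_sub iI.
have [n _ e] := ID _ _ (IV _ Ix) (act_ideal i a iI Ix).
have [k ek] := gz_modn n (prime_gt0 pp) xp.
have fe : f x *+ k = 0.
  rewrite -bhomX -ek e bhomD bhomN act_bhom.
  by have := (act_center (f x)).1 cfx i (f a); case: (i) => /= ->; rewrite gopV.
suff xk : x *+ k = 0.
  by rewrite -[LHS](ginvK_r (addg B) x) -e ek xk gopr1.
have [/dvdnP[r ->]|npk] := boolP (p %| k)%N; first by rewrite mulnC gpowM xp gpow_id.
by case: fx0; apply: (gpow_gcd fxp fe); rewrite prime_coprime.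
Qed.

Lemma prime_factor_center (B : skewBrace) (J : set B) (x : B) p c :
  dedekind B -> ideal J -> prime p -> ~ J x -> J (x *+ p) ->
  J (- x + lambda x x) -> zs (adj J x) c = setT -> cen J x.
Proof.
move=> dB iJ pp nx xp lx hc; have [C [f [sf k]]] := quot_ex iJ.
apply/(cen_ker sf k); apply: (@prime_ideal_center _ _ p c) => //.
- exact: dedekind_surj sf dB.
- by move/(ker0 k).
- by rewrite -bhomX; apply/(ker0 k).
- by rewrite -bhomL; symmetry; apply/k.
- by apply/(zs_quot _ _ sf); rewrite -(adj_preim x k).
Qed.

(** * Finite and elementary abelian ideals *)

Section FiniteOrder.
Variables (T : Type) (G : group_law T).

Lemma finite_order (H : set T) (y : T) : subgroup G H -> finite_set H -> H y ->
  exists2 m, (0 < m)%N & gpow G y m = gid G.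
Proof.
move=> sH fH Hy; apply: contrapT => no.
have inj : injective (gpow G y).
  move=> n m; wlog nm : n m / (n <= m)%N => [W e|e].
    by case: (leqP n m) => [/W ->|/ltnW/W ->].
  apply/eqP; rewrite eqn_leq nm /= -subn_eq0 -leqn0 leqNgt; apply/negP => d0.
  apply: no; exists (m - n)%N => //; apply: (@gop_inj _ G (gpow G y n)).
  by rewrite -gpowD subnKC // gopr1.
have : finite_set (gpow G y @^-1` H).
  by apply: finite_preimage fH => n m _ _; apply: inj.
suff -> : gpow G y @^-1` H = setT by apply: infinite_nat.
by apply/seteqP; split=> // n _; apply: subgroup_gpow.
Qed.

Definition cover (J F : set T) n :=
  exists L : nat -> T, forall y, F y -> exists2 i, (i < n)%N & J (gop G (ginv G (L i)) y).

Lemma cover_finite (J F : set T) n : subgroup G J -> cover J F n ->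
  finite_set (coset G J @` F).
Proof.
move=> sJ [L cL]; apply: (@sub_finite_set _ _ ((fun i => coset G J (L i)) @` `I_n)).
  by move=> _ [y /cL[i il Ji] <-]; exists i => //; apply/cosetP.
exact/finite_image/finite_II.
Qed.

(** Enlarging J by an element of F merges two of the cosets. *)
Lemma cover_merge (J K F : set T) n x : subgroup G J -> subgroup G K -> J `<=` K ->
  F (gid G) -> F x -> K x -> ~ J x -> cover J F n ->
  exists2 m, n = m.+1 & cover K F m.
Proof.
move=> [J1 JM JV] [K1 KM KV] JK F1 Fx Kx nx [L cL].
have [i0 i0n] := cL _ F1; rewrite gopr1 => h0.
have [i1 i1n h1] := cL _ Fx.
case: n => // m in cL i0n i1n *; exists m => //.
have i01 : i0 != i1.
  apply/eqP => e; rewrite e in h0; apply: nx.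
  by rewrite -(ginvK_r G (L i1) x); apply: JM => //; rewrite -(ginv_inv G (L i1)); apply: JV.
exists (fun k => L (bump i1 k)) => y /cL[i im hi].
have [j jm ji] : exists2 j, (j < m.+1)%N & (j != i1) && `[< K (gop G (ginv G (L j)) y) >].
  have [e|ne] := eqVneq i i1; last first.
    by exists i => //; rewrite ne /=; apply/asboolP/JK.
  exists i0 => //; rewrite i01 /=; apply/asboolP; rewrite e in hi.
  apply: (KM _ _ (JK _ h0)).
  rewrite -(ginvK_r G (L i1) y); apply/KM; last exact: JK.
  rewrite -(ginv_inv G (L i1)); apply/KV.
  rewrite -[X in K X](gopr1 G) -(goprV G x) gopA; apply/KM; last exact: KV.
  exact: JK.
move/andP: ji => [ji /asboolP hj]; exists (unbump i1 j).
  by move: ji jm i1n; rewrite /unbump; case: (ltngtP j i1) => //; lia.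
by rewrite unbumpK.
Qed.

End FiniteOrder.

Lemma adj_min (B : skewBrace) (J F : set B) x :
  subgroup (addg B) F -> J `<=` F -> F x -> adj J x `<=` F.
Proof.
move=> sF JF Fx t [n nt]; rewrite -(ginvK_r (addg B) (x *~ n) t).
by have [_ FD _] := sF; apply: FD; [apply: subgroup_gz | apply: JF].
Qed.

Lemma zs_step (B : skewBrace) (J K : set B) m :
  K `<=` cen J -> zs K m = setT -> zs J m.+1 = setT.
Proof.
move=> KJ hK; rewrite -subTset -hK -addn1 zsD; exact: zs_sub KJ.
Qed.

Lemma prime_step (B : skewBrace) (J : set B) (x : B) p c :
  dedekind B -> ideal J -> prime p -> ~ J x -> J (x *+ p) ->
  J (- x + lambda x x) -> zs (adj J x) c = setT -> zs J c.+1 = setT.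
Proof.
move=> dB iJ pp nx xp lx hc; apply: zs_step (hc).
apply: adj_min; first by have [] := ideal_sub (cen_ideal iJ).
  exact: sub_cen.
exact: (prime_factor_center dB iJ pp nx xp lx hc).
Qed.

(** Cauchy's theorem, applied to the image of F modulo J. *)
Lemma prime_factor_ex (B : skewBrace) (J F : set B) : ideal J -> ideal F ->
  finite_set (coset (addg B) J @` F) -> ~ F `<=` J ->
  exists x p, [/\ F x, ~ J x, prime p, J (x *+ p) & J (- x + lambda x x)].
Proof.
move=> iJ iF fF nFJ; have [C [f [sf k]]] := quot_ex iJ.
have [y Fy Jy] : exists2 y, F y & ~ J y.
  by apply: contrapT => no; apply: nFJ => y Fy; apply: contrapT => ?; apply: no; exists y.
have sS := ideal_sub (image_ideal sf iF).
have fS : finite_set (f @` F).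
  pose g (A : set B) : C :=
    if pselect (exists z, A z) is left e then f (sval (cid e)) else 0.
  have gE z : g (coset (addg B) J z) = f z.
    rewrite /g; case: pselect => [e|no].
      by symmetry; apply/k; apply: (svalP (cid e)).
    by case: no; exists z; rewrite /coset /= gopV; case: iJ => [[[]]].
  have -> : f @` F = g @` (coset (addg B) J @` F).
    apply/seteqP; split=> [_ [z Fz <-]|_ [_ [z Fz <-] <-]].
      by exists (coset (addg B) J z); [exists z | rewrite gE].
    by exists z; rewrite ?gE.
  exact: finite_image.
have fy0 : f y <> gid (circg C) by rewrite circ_id; move/(ker0 k).
have Sy : (f @` F) (f y) by exists y.
have [m m0 ym] := finite_order sS.2 fS Sy.
have [q [n [qp _ yn ynq]]] := prime_power m0 fy0 ym.
rewrite circ_id in yn ynq.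
have [t [[x Fx <-] t0 tq lt]] := brace_cauchy sS fS qp (subgroup_gpow n sS.2 Sy) yn ynq.
exists x, q; split=> //.
- by move/(ker0 k).
- by apply/(ker0 k); rewrite bhomX.
- by apply/k; rewrite bhomL lt.
Qed.

(** An element of prime order modulo J is central modulo J, and adjoining it
    lowers the number of cosets. *)
Lemma finite_ideal_nilpotent (B : skewBrace) (J F : set B) n c : dedekind B ->
  ideal J -> ideal F -> J `<=` F -> cover (addg B) J F n -> zs F c = setT ->
  exists m, zs J m = setT.
Proof.
move=> dB iJ iF JF cJ hc; elim: n J iJ JF cJ => [|n IH] J iJ JF cJ.
  by have [[[F0 _ _] _ _ _] _ _] := iF; have [L /(_ _ F0)[]] := cJ.
have [FJ|nFJ] := pselect (F `<=` J).
  by exists c; have -> : J = F by apply/seteqP.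
have fF := cover_finite (ideal_sub iJ).1 cJ.
have [x [p [Fx nx pp xp lx]]] := prime_factor_ex iJ iF fF nFJ.
have iK : ideal (adj J x) by apply/dB/adj_sub.
have F0 : F 0 by have [[[]]] := iF.
have [_ [<-] cK] := cover_merge (ideal_sub iJ).1 (ideal_sub iK).1 (@sub_adj _ J x)
  F0 Fx (mem_adj x iJ) nx cJ.
have [m hm] := IH _ iK (adj_min (ideal_sub iF).1 JF Fx) cK.
by exists m.+1; exact: (prime_step dB iJ pp nx xp lx hm).
Qed.

(** ** Abelian ideals, presented by an additive map from a Z-module *)

Definition zlaw (A : zmodType) : group_law A :=
  GroupLaw (@addrA A) (@add0r A) (@addNr A).

Lemma zlaw_pow (A : zmodType) (a : A) n : gpow (zlaw A) a n = (a *+ n)%R.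
Proof. by elim: n => [|n IH]; rewrite ?mulr0n // mulrS -IH. Qed.

Lemma zlaw_gz (A : zmodType) (a : A) n : gz (zlaw A) a n = (a *~ n)%R.
Proof.
case: n => n; first exact: zlaw_pow.
by change (- gpow (zlaw A) a n.+1 = a *~ Negz n)%R; rewrite zlaw_pow.
Qed.

Section Additive.
Variables (A D : zmodType) (g : A -> D).
Hypothesis gD : {morph g : x y / (x + y)%R}.

Lemma zadd0 : g 0%R = 0%R.
Proof. exact: (@morph_id _ _ (zlaw A) (zlaw D)). Qed.

Lemma zaddZ a n : g (a *~ n)%R = (g a *~ n)%R.
Proof. by rewrite -!zlaw_gz; exact: (@morph_gz _ _ (zlaw A) (zlaw D)). Qed.

Lemma zaddX a n : g (a *+ n)%R = (g a *+ n)%R.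
Proof. by rewrite !pmulrn zaddZ. Qed.

End Additive.

Fixpoint zspan (A : zmodType) (gs : seq A) : set A :=
  if gs is g :: gs' then [set a | exists n s, zspan gs' s /\ a = (g *~ n + s)%R]
  else [set 0%R].

Section Span.
Variable A : zmodType.
Local Open Scope ring_scope.
Implicit Types (a b s : A) (gs : seq A).

Lemma zspan0 gs : zspan gs 0.
Proof. by elim: gs => //= g gs IH; exists 0, 0; rewrite mulr0z addr0. Qed.

Lemma zspanD gs a b : zspan gs a -> zspan gs b -> zspan gs (a + b).
Proof.
elim: gs a b => [|g gs IH] a b /=; first by move=> -> ->; rewrite addr0.
move=> [n [s [hs ->]]] [m [t [ht ->]]]; exists (n + m), (s + t).
by split; [apply: IH | rewrite mulrzDr addrACA].
Qed.

Lemma zspanZ gs a n : zspan gs a -> zspan gs (a *~ n).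
Proof.
elim: gs a => [|g gs IH] a /=; first by move=> ->; rewrite mul0rz.
move=> [m [s [hs ->]]]; exists (m * n), (s *~ n).
by split; [apply: IH | rewrite mulrzDl mulrzA].
Qed.

Lemma zspan_cons g gs a : zspan gs a -> zspan (g :: gs) a.
Proof. by move=> h; exists 0, a; rewrite mulr0z add0r. Qed.

End Span.

(** Steinitz exchange modulo a subgroup K with quotient of exponent p. *)
Lemma zspan_exchange (A : zmodType) (p : nat) (K : set A) (gs : seq A) (t : A) :
  prime p -> subgroup (zlaw A) K -> (forall a, K (a *+ p)%R) ->
  zspan gs t -> ~ K t ->
  exists gs', (size gs').+1 = size gs /\ forall s, zspan gs s ->
    exists n s', zspan gs' s' /\ K (s - (t *~ n + s'))%R.
Proof.
move=> pp sK Kp; have [K0 KD KN] := sK.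
have KZp a (n : int) : K (a *~ (n * p%:Z))%R by rewrite mulrzA -pmulrn.
elim: gs t => [|g gs IH] t; first by move=> /= -> /(_ K0).
move=> /= [k [t1 [ht1 tE]]] nKt.
have [pk|npk] := boolP (p%:Z %| k)%Z.
  have Kg : K (g *~ k)%R by have /dvdzP[r ->] := pk.
  have [|gs' [sz hgs']] := IH t1 ht1.
    by move=> Kt1; apply: nKt; rewrite tE; apply: KD.
  exists (g :: gs'); split; first by rewrite /= sz.
  move=> _ [a [s [hs ->]]]; have [n [s' [hs' e]]] := hgs' s hs.
  exists n, (g *~ a + s')%R; split; first by exists a, s'.
  have -> : (g *~ a + s - (t *~ n + (g *~ a + s')) =
      (s - (t1 *~ n + s')) - g *~ k *~ n)%R.
    rewrite tE mulrzDl; set X := (g *~ k *~ n)%R; set Y := (t1 *~ n)%R.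
    have -> : (X + Y + (g *~ a + s') = g *~ a + ((Y + s') + X))%R.
      by rewrite addrCA -addrA [(X + _)%R]addrC.
    by rewrite opprD addrACA subrr add0r opprD addrA.
  apply: KD => //; apply: KN.
  by rewrite -(zlaw_gz (g *~ k)%R); apply: subgroup_gz.
exists gs; split=> // _ [a [s [hs ->]]].
have /coprimezP[[u v] /= uv] : coprimez k p.
  rewrite coprimez_sym; move: npk; rewrite /coprimez /gcdz /dvdz absz_nat => npk.
  by rewrite -[_ == _]/(coprime p `|k|) prime_coprime.
exists (u * a)%R, (t1 *~ (- (u * a)) + s)%R.
split; first by apply: zspanD => //; apply: zspanZ.
have -> : (g *~ a + s - (t *~ (u * a) + (t1 *~ - (u * a) + s)) =
    g *~ ((a * v) * p%:Z))%R.
  rewrite tE mulrzDl mulrNz addrA addrK opprD addrACA subrr addr0.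
  rewrite -mulrzA -mulrzBr; congr (_ *~ _)%R.
  have -> : (a * v * p%:Z = a * (v * p%:Z))%R by ring.
  have -> : (v * p%:Z = 1 - u * k)%R by rewrite -uv; ring.
  by ring.
exact: KZp.
Qed.

Section AbelianIdeal.
Variable A : zmodType.

Lemma zmorph_mul (B : skewBrace) (i : A -> B) (n : nat) a :
  {morph i : a b / (a + b)%R >-> a + b} -> i (a *+ n)%R = i a *+ n.
Proof.
by move=> iD; rewrite -zlaw_pow; have := @morph_gz _ _ (zlaw A) (addg B) i a n iD.
Qed.

Lemma zmorph_mulz (B : skewBrace) (i : A -> B) (n : int) a :
  {morph i : a b / (a + b)%R >-> a + b} -> i (a *~ n)%R = i a *~ n.
Proof. by move=> iD; rewrite -zlaw_gz; exact: (@morph_gz _ _ (zlaw A) (addg B)). Qed.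

Lemma zmorph0 (B : skewBrace) (i : A -> B) :
  {morph i : a b / (a + b)%R >-> a + b} -> i 0%R = 0.
Proof. by move=> iD; exact: (@morph_id _ _ (zlaw A) (addg B)). Qed.

Lemma zmorphN (B : skewBrace) (i : A -> B) a :
  {morph i : a b / (a + b)%R >-> a + b} -> i (- a)%R = - i a.
Proof. by move=> iD; exact: (@morph_inv _ _ (zlaw A) (addg B)). Qed.

Lemma adj0 (B : skewBrace) (x : B) : adj [set 0] x = range (gz (addg B) x).
Proof.
apply/seteqP; split=> [t [n /= nt]|_ [n _ <-]]; exists n => //=; last exact: gopV.
by rewrite -[LHS](gopr1 (addg B)) -nt ginvK_r.
Qed.

(** The number of generators, unlike the order of the ideal, bounds the number
    of central steps uniformly in the prime p. *)
Lemma elementary_ideal_nilpotent (p c : nat) (gs : seq A) (B : skewBrace)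
    (i : A -> B) :
  prime p -> dedekind B -> {morph i : a b / (a + b)%R >-> a + b} ->
  ideal (range i) -> (forall a, i (a *+ p)%R = 0) ->
  (forall a, exists2 s, zspan gs s & i a = i s) ->
  zs (range i) c = setT -> zs [set (0 : B)] (c + size gs) = setT.
Proof.
move=> pp; move Egs: (size gs) => n; elim: n gs Egs B i => [|n IH] gs Egs B i dB iD iM ip ig hc.
  rewrite addn0; suff <- : range i = [set 0] by [].
  apply/seteqP; split=> [_ [a _ <-]|_ ->]; last by exists 0%R; rewrite ?zmorph0.
  have [s hs ->] := ig a; case: gs Egs hs {ig} => //= _ ->; exact: zmorph0.
have [all0|n0] := pselect (range i `<=` [set 0]).
  apply: (zs_top (k := c)); [exact: zero_ideal | exact: leq_addr |].
  rewrite -hc; congr (zs _ c); apply/seteqP; split=> // _ ->.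
  by exists 0%R; rewrite ?zmorph0.
have fM : finite_set (range i).
  have -> : range i = i @` zspan gs.
    apply/seteqP; split=> [_ [a _ <-]|_ [s _ <-]]; last by exists s.
    by have [s hs ->] := ig a; exists s.
  elim: (gs) => [|g l IHl] /=; first by rewrite image_set1; exact: finite_set1.
  apply: (@sub_finite_set _ _
      ((fun ky => i (g *+ ky.1)%R + ky.2) @` (`I_p `*` (i @` zspan l)))); last first.
    by apply: finite_image; apply: finite_setX => //; exact: finite_II.
  move=> _ [_ [k [s [hs ->]]] <-]; exists (`|(k %% p)%Z|%N, i s).
    split=> /=; last by exists s.
    by rewrite -ltz_nat gez0_abs ?modz_ge0 ?ltz_pmod //; have := prime_gt0 pp; lia.
  rewrite /= iD; congr (_ + _); rewrite [in RHS](divz_eq k p) mulrzDr iD mulrzA.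
  rewrite -pmulrn ip gop1 pmulrn gez0_abs ?modz_ge0 //.
  by have := prime_gt0 pp; lia.
have [x [q [[t0 _ t0x] nx qp xq lx]]] :=
  prime_factor_ex (zero_ideal B) iM (finite_image _ fM) n0.
have [t ht tx] := ig t0; rewrite tx in t0x.
have sK : subgroup (zlaw A) [set a | i a = 0].
  split=> [|a b /= a0 b0|a /= a0]; first exact: zmorph0.
    by rewrite iD a0 b0 gop1.
  by rewrite zmorphN // a0 ginv1.
have nKt : ~ [set a | i a = 0] t by rewrite /= t0x.
have [gs' [sz hgs']] := zspan_exchange pp sK ip ht nKt.
have lx' : lambda x x = x.
  by rewrite -[RHS](gopr1 (addg B)) -[X in x + X](lx : - x + lambda x x = 0) ginvK_r.
have iJ : ideal (adj [set 0] x) by rewrite adj0; exact/dB/cyclic_sub.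
have [C [f [sf k]]] := quot_ex iJ.
have fx : f x = 0 by apply/(ker0 k)/mem_adj/zero_ideal.
have hJ : zs (adj [set 0] x) (c + n) = setT.
  rewrite -(preim0 (ker0 k)); apply/(zs_quot _ _ sf).
  have ifM : range (f \o i) = f @` range i by rewrite image_comp.
  apply: (IH gs' _ _ (f \o i)).
  - by move: sz; rewrite Egs => -[].
  - exact: dedekind_surj sf dB.
  - by move=> a b /=; rewrite iD bhomD.
  - by rewrite ifM; apply: image_ideal.
  - by move=> a /=; rewrite ip bhom0.
  - move=> a; have [s hs ia] := ig a; rewrite /= ia; have [m [s' [hs' e]]] := hgs' s hs.
    exists s' => //; have -> : i s = i (t *~ m + s')%R.
      rewrite -[in LHS](subrK (t *~ m + s')%R s) iD.
      by rewrite (e : i _ = 0) gop1.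
    rewrite iD zmorph_mulz // t0x bhomD bhom_gz fx.
    by rewrite gz_id gop1.
  - apply/(zs_quot _ _ sf); rewrite -subTset -hc; apply: zs_sub.
    by rewrite ifM => y My; exists y.
by rewrite addnS; apply: (prime_step dB (zero_ideal B) qp nx xq lx hJ).
Qed.

(** Abelian minimax groups enter only through these consequences: inverting Q
    makes the group finitely generated, the torsion subgroup is a Q-group with
    finite layers, and the intersection of the subgroups pA over almost all
    primes p is torsion. *)
Record minimax_data (Q : nat) (gs : seq A) : Prop := MinimaxData {
  data_pos : (0 < Q)%N;
  data_gen : forall a : A, exists j, zspan gs (a *+ (Q ^ j))%R;
  data_sep : forall (a : A) P,
    (forall p, prime p -> (P < p)%N -> exists b : A, a = (b *+ p)%R) ->
    exists j, (a *+ (Q ^ j))%R = 0%R;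
  data_tors : forall (a : A) k, (0 < k)%N -> (a *+ k)%R = 0%R ->
    exists j, (a *+ (Q ^ j))%R = 0%R;
  data_fin : forall m, (0 < m)%N -> finite_set [set a : A | (a *+ m)%R = 0%R] }.

Definition Qtors (Q : nat) : set A := [set a | exists j, (a *+ (Q ^ j))%R = 0%R].

Lemma Qtors_subgroup Q : subgroup (zlaw A) (Qtors Q).
Proof.
split=> [|a b [j ja] [k kb]|a [j ja]].
- by exists 0%N; rewrite mul0rn.
- exists (j + k)%N; rewrite /= mulrnDl expnD mulrnA ja mul0rn add0r.
  by rewrite mulnC mulrnA kb mul0rn.
- by exists j; rewrite /= mulNrn ja oppr0.
Qed.

Variables (Q : nat) (gs : seq A).
Hypothesis dA : minimax_data Q gs.

Section Residual.
Variables (B : skewBrace) (i : A -> B) (c : nat).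
Hypotheses (dB : dedekind B) (iD : {morph i : a b / (a + b)%R >-> a + b}).
Hypotheses (iI : injective i) (iM : ideal (range i)).
Hypothesis hc : zs (range i) c = setT.

(** The lambda maps restrict to additive endomorphisms of the abelian ideal i(A),
    and a subgroup invariant under all of them is a sub-brace. *)
Lemma char_ideal (H : set A) : subgroup (zlaw A) H ->
  (forall g : A -> A, {morph g : a b / (a + b)%R} -> forall a, H a -> H (g a)) ->
  ideal (i @` H).
Proof.
move=> [H0 HD HN] Hg; apply/dB/left_ideal_sub.
  split.
  - by exists 0%R => //; exact: zmorph0.
  - by move=> _ _ [a Ha <-] [b Hb <-]; exists (a + b)%R; rewrite ?iD //; exact: HD.
  - by move=> _ [a Ha <-]; exists (- a)%R; rewrite ?zmorphN //; exact: HN.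
move=> b _ [a Ha <-].
have ex (a' : A) : exists a1, i a1 = lambda b (i a').
  have [_ L _] := iM; have [|a1 _ e] := L b (i a'); first by exists a'.
  by exists a1.
pose g a' := sval (cid (ex a')); have gE a' : i (g a') = lambda b (i a').
  exact: svalP (cid (ex a')).
exists (g a); rewrite ?gE //; apply: Hg => // a1 a2; apply: iI.
by rewrite iD !gE iD lambdaD.
Qed.

Lemma Qtors_ideal : ideal (i @` Qtors Q).
Proof.
apply: char_ideal; first exact: Qtors_subgroup.
move=> g gD a [j ja]; exists j => /=.
by rewrite -(zaddX gD) ja zadd0.
Qed.

Lemma zs_bigcap I (D : set I) (J : I -> set B) k :
  (forall j, D j -> zs (J j) k = setT) -> zs (\bigcap_(j in D) J j) k = setT.
Proof.
move=> h; rewrite -subTset => x _.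
have : (\bigcap_(j in D) zs (J j) k) x by move=> j /h ->.
elim: k x {h} => //= k IH x hx b.
by split; apply: IH => j Dj; have [] := hx j Dj b.
Qed.

(** For almost all primes p the factor A/pA is elementary abelian and central in
    a number of steps bounded independently of p; the intersection of the pA is
    torsion. *)
Lemma torsion_quotient_nilpotent : zs (i @` Qtors Q) (c + size gs) = setT.
Proof.
have mod_p p : prime p /\ coprime p Q ->
    zs (i @` [set (a *+ p)%R | a in setT]) (c + size gs) = setT.
  move=> [pp cpQ]; have iJ : ideal (i @` [set (a *+ p)%R | a in setT]).
    apply: char_ideal.
      split=> [|_ _ [a _ <-] [b _ <-]|_ [a _ <-]].
      - by exists 0%R; rewrite ?mul0rn.
      - by exists (a + b)%R; rewrite ?mulrnDl.
      - by exists (- a)%R; rewrite ?mulNrn.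
    by move=> g gD _ [a _ <-]; exists (g a); rewrite ?(zaddX gD).
  have [C [f [sf k]]] := quot_ex iJ.
  have fp a : f (i (a *+ p)%R) = 0 by apply/(ker0 k); exists (a *+ p)%R => //; exists a.
  rewrite -(preim0 (ker0 k)); apply/(zs_quot _ _ sf).
  have ifM : range (f \o i) = f @` range i by rewrite image_comp.
  apply: (@elementary_ideal_nilpotent p c gs C (f \o i)) => //.
  - exact: dedekind_surj sf dB.
  - by move=> a b /=; rewrite iD bhomD.
  - by rewrite ifM; apply: image_ideal.
  - move=> a; have [j hj] := data_gen dA a.
    have /coprimezP[[u v] /= uv] : coprimez (Q ^ j)%N p.
      by rewrite coprimezE /= coprimeXl // coprime_sym.
    exists (a *+ (Q ^ j) *~ u)%R; first exact: zspanZ.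
    have ea : a = (a *+ (Q ^ j) *~ u + (a *~ v) *+ p)%R.
      rewrite pmulrn [(a *~ v *+ p)%R]pmulrn -!mulrzA -mulrzDr.
      by rewrite [((Q ^ j)%N%:Z * u)%R]mulrC uv mulr1z.
    by rewrite /= [in LHS]ea iD bhomD fp gopr1.
  - apply/(zs_quot _ _ sf); rewrite -subTset -hc; apply: zs_sub.
    by rewrite ifM => y My; exists y.
rewrite -subTset -(zs_bigcap mod_p); apply: zs_sub => y hy.
have [p0 p0Q p0p] := prime_above Q.
have cop p : prime p -> (Q < p)%N -> coprime p Q.
  move=> pp Qp; rewrite prime_coprime //; apply/negP => /(dvdn_leq (data_pos dA)).
  by rewrite leqNgt Qp.
have [_ [a _ <-] ya] := hy p0 (conj p0p (cop _ p0p p0Q)).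
exists (a *+ p0)%R => //; apply: (data_sep dA (P := Q)) => p pp pQ.
have [_ [b _ <-]] := hy p (conj pp (cop p pp pQ)); rewrite -ya => /iI e.
by exists b.
Qed.

End Residual.
End AbelianIdeal.

(** * Divisible torsion ideals are central *)

Lemma decreasing_stable (A : eqType) (S : set A) (P : A -> nat -> Prop) :
  finite_set S -> (forall a k, P a k.+1 -> P a k) ->
  exists k0, forall a, S a -> P a k0 -> forall k, P a k.
Proof.
move=> /finite_seqP[s ->] Pd.
have Ple a k m : (k <= m)%N -> P a m -> P a k.
  by move=> /subnK <-; elim: (m - k)%N => // d IH /Pd.
elim: s => [|a s [k0 IH]]; first by exists 0%N.
have [all|/existsNP[k1 nk1]] := pselect (forall k, P a k).
  by exists k0 => b; rewrite /= inE => /orP[/eqP -> _|/IH].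
exists (maxn k0 k1) => b; rewrite /= inE => /orP[/eqP -> h|bs h].
  by case: nk1; apply: Ple h; apply: leq_maxr.
by apply: IH bs _; apply: Ple h; apply: leq_maxl.
Qed.

Lemma coprime_split m Q : (0 < m)%N -> (0 < Q)%N ->
  exists b e, [/\ (0 < b)%N, coprime b Q & (m %| b * Q ^ e)%N].
Proof.
elim/ltn_ind: m => m IH m0 Q0.
have [c|nc] := boolP (coprime m Q).
  by exists m, 0%N; rewrite expn0 muln1.
have g0 : (0 < gcdn m Q)%N by rewrite gcdn_gt0 m0.
have g1 : (1 < gcdn m Q)%N by rewrite ltn_neqAle eq_sym nc.
have /dvdnP[m' mE] := dvdn_gcdl m Q.
have m'0 : (0 < m')%N by move: m0; rewrite mE; case: m' {mE}.
have [|b [e [b0 bQ md]]] := IH m' _ m'0 Q0; first by rewrite [X in (_ < X)%N]mE ltn_Pmulr.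
exists b, e.+1; split=> //; rewrite mE expnSr mulnA.
by apply: dvdn_mul => //; apply: dvdn_gcdr.
Qed.

Section Divisible.
Variables (A : zmodType) (Q : nat).
Hypothesis fin : finite_set [set a : A | (a *+ Q)%R = 0%R].
Local Open Scope ring_scope.

(** With finite Q-torsion, the chain Q^k T stabilises at a divisible group: the
    socle pieces Q^k T \cap A[Q] stabilise, and one climbs by the order of the
    elements. *)
Lemma divisible_part : exists k0, forall (a b : A) m, a *+ (Q ^ m) = 0 ->
  a = b *+ (Q ^ k0) -> exists b' : A, a = b' *+ (Q ^ k0.+1).
Proof.
have [||k0 st] := @decreasing_stable A [set a | a *+ Q = 0]
    (fun a k => exists b : A, a = b *+ (Q ^ k)).
- exact: fin.
- by move=> a k [b ->]; exists (b *+ Q); rewrite -mulrnA expnS.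
exists k0 => a b m; elim: m a b => [|m IH] a b.
  by rewrite expn0 mulr1n => -> _; exists 0; rewrite mul0rn.
move=> am ab; have [||b1 e] := st (a *+ (Q ^ m)) _ _ (k0.+1 + m)%N.
- by rewrite /= -mulrnA -expnSr.
- by exists (b *+ (Q ^ m)); rewrite ab -!mulrnA mulnC.
have [||b2 e2] := IH (a - b1 *+ (Q ^ k0.+1)) (b - b1 *+ Q).
- by rewrite mulrnBl e expnD mulrnA subrr.
- by rewrite ab mulrnBl -!mulrnA -expnS.
by exists (b1 + b2); rewrite mulrnDl -e2 addrC subrK.
Qed.

End Divisible.

Section DivisibleIdeal.
Variables (B : skewBrace) (D : set B) (Q : nat).
Hypotheses (dB : dedekind B) (iD : ideal D) (Q0 : (0 < Q)%N).
Hypothesis DC : forall x y, D x -> D y -> x + y = y + x.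
Hypothesis Dt : forall x, D x -> exists j, x *+ (Q ^ j) = 0.
Hypothesis Dd : forall x, D x -> exists2 y, D y & x = y *+ Q.

Let sD : subgroup (addg B) D. Proof. by have [] := ideal_sub iD. Qed.
Let D0 : D 0. Proof. by have [] := sD. Qed.
Let DD x y : D x -> D y -> D (x + y). Proof. by have [_ + _] := sD; apply. Qed.
Let DN x : D x -> D (- x). Proof. by have [_ _] := sD; apply. Qed.
Let DX x n : D x -> D (x *+ n). Proof. exact: subgroup_gpow. Qed.
Let DL a x : D x -> D (lambda a x). Proof. by have [_ L _] := iD; apply: L. Qed.

Lemma divisible_pow j x : D x -> exists2 y, D y & x = y *+ (Q ^ j).
Proof.
elim: j x => [|j IH] x Dx; first by exists x; rewrite ?gpow1.
have [y Dy ->] := IH x Dx; have [z Dz ->] := Dd Dy.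
by exists z; rewrite // expnS gpowM.
Qed.

Section FiniteOrderAut.
Variable g : B -> B.
Hypotheses (gD : {morph g : x y / x + y}) (gS : forall x, D x -> D (g x)).
Hypothesis g2 : forall x, D x -> x *+ (Q ^ 2) = 0 -> g x = x.

Let h x := - x + g x.
Let Dh x : D x -> D (h x). Proof. by move=> Dx; apply: DD; [apply: DN | apply: gS]. Qed.
Let gh x : g x = x + h x. Proof. by rewrite /h ginvK_r. Qed.
Let hX x n : D x -> h (x *+ n) = h x *+ n.
Proof.
move=> Dx; rewrite /h gpow_mul ?gpow_inv ?(morph_gz x n gD) //.
by apply: DC; [apply: DN | apply: gS].
Qed.
Let h0 x : h x = 0 <-> g x = x.
Proof. by split=> [e|e]; rewrite ?gh ?e ?gopr1 // /h e gopV. Qed.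
Let it x n : g (h x) = h x -> iter n g x = x + h x *+ n.
Proof.
move=> e; elim: n => [|n IH]; first by rewrite gopr1.
by rewrite iterS IH gD (morph_gz (h x) n gD) e gh -gopA.
Qed.
Let fixed_of_iter x n : g (h x) = h x -> iter n g x = x -> h x *+ n = 0.
Proof.
by move=> e; rewrite it // => e'; apply: (@gop_inj _ (addg B) x); rewrite e' gopr1.
Qed.

Lemma prime_order_trivial q : prime q -> (forall x, D x -> iter q g x = x) ->
  forall x, D x -> g x = x.
Proof.
move=> qp gq; suff H j x : D x -> x *+ (Q ^ j.+2) = 0 -> g x = x.
  move=> x Dx; have [j xj] := Dt Dx; apply: (H j) => //.
  by rewrite -addn2 expnD gpowM xj gpow_id.
elim: j x => [|j IH] x Dx; first exact: g2.
move=> xj; have hQ : h x *+ Q = 0.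
  rewrite -hX //; apply/h0/IH; first exact: DX.
  by rewrite -gpowM -expnS.
have ghx : g (h x) = h x.
  apply: g2; first exact: Dh.
  by rewrite expnS gpowM hQ gpow_id.
have hq := fixed_of_iter ghx (gq x Dx).
have [/dvdnP[r Qr]|nqQ] := boolP (q %| Q)%N; last first.
  by apply/h0/(gpow_gcd hq hQ); rewrite prime_coprime.
have [y Dy yx] : exists2 y, D y & x = y *+ q.
  have [d Dd' ->] := Dd Dx; exists (d *+ r); first exact: DX.
  by rewrite -gpowM -Qr.
have hyq : h y *+ q = h x by rewrite -hX // -yx.
have ghy : g (h y) = h y.
  apply: g2; first exact: Dh.
  rewrite expnS expn1 {1}Qr [(r * q)%N]mulnC -mulnA gpowM hyq mulnC gpowM hQ.
  exact: gpow_id.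
by apply/h0; rewrite -hyq; apply: fixed_of_iter ghy (gq y Dy).
Qed.

End FiniteOrderAut.

(** Reduced to prime order q, the automorphism is shown to fix x by induction on
    the exponent Q^j of x, dividing x by q when q divides Q. Starting from the
    exponent Q would not do for the prime 2, as inversion shows. *)
Lemma finite_order_trivial n (g : B -> B) : (0 < n)%N ->
  {morph g : x y / x + y} -> (forall x, D x -> D (g x)) ->
  (forall x, D x -> x *+ (Q ^ 2) = 0 -> g x = x) ->
  (forall x, D x -> iter n g x = x) -> forall x, D x -> g x = x.
Proof.
elim/ltn_ind: n g => n IH g n0 gD gS g2 gn.
have [n1|n1] := leqP n 1.
  have e : n = 1%N by apply/eqP; rewrite eqn_leq n1.
  by move=> x /gn; rewrite e.
have qp := pdiv_prime n1; have /dvdnP[m nm] := pdiv_dvd n; set q := pdiv n in qp nm.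
have m0 : (0 < m)%N by case: m nm => // e; rewrite e in n0.
apply: (IH m) => //; first by rewrite nm ltn_Pmulr // prime_gt1.
have itD : {morph iter m g : x y / x + y}.
  by move=> x y; elim: (m) => //= k ->; rewrite gD.
have itS x : D x -> D (iter m g x) by move=> Dx; elim: (m) => //= k; apply: gS.
apply: (prime_order_trivial itD itS _ qp) => [x Dx x2|x Dx].
  by elim: (m) => //= k ->; apply: g2.
have <- : iter n g x = iter q (iter m g) x; last exact: gn.
by rewrite nm mulnC; elim: (q) => // k IHk; rewrite mulSn iterD IHk.
Qed.

Hypothesis Df : forall j, finite_set (D `&` [set x | x *+ (Q ^ j) = 0]).

Let lambda_finite_order d : D d ->
  exists2 n, (0 < n)%N & forall x, iter n (lambda d) x = x.
Proof.
move=> Dd'; have [j dj] := Dt Dd'.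
have sS : sub_skew_brace (D `&` [set x | x *+ (Q ^ j) = 0]).
  apply: left_ideal_sub; first split=> [|x y [Dx xj] [Dy yj]|x [Dx xj]] /=.
  - by split; rewrite ?gpow_id.
  - by split; [apply: DD | rewrite gpow_mul ?xj ?yj ?gop1 //; apply: DC].
  - by split; [apply: DN | rewrite gpow_inv xj ginv1].
  - by move=> a x [Dx /= xj]; split; [apply: DL | rewrite /= -lambdaX xj lambda0].
have [n n0 dn] := finite_order sS.2 (Df j) (conj Dd' dj).
by exists n => // x; rewrite -lambda_pow dn circ_id lambda_id.
Qed.

Let K := D `&` [set d | forall x, D x -> lambda d x = x].

Let K_sub : sub_skew_brace K.
Proof.
have DE d1 d2 : K d1 -> K d2 -> d1 + d2 = d1 ** d2.
  by move=> [_ h1] [D2 _]; rewrite circE h1.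
have KV d1 : K d1 -> forall x, D x -> lambda d1^-1 x = x.
  by move=> [_ h1] x Dx; rewrite -{1}(h1 x Dx) lambdaK.
apply: sub_of_lambda.
- split; first by split=> // x _; rewrite /= lambda_id.
    move=> d1 d2 K1 K2; rewrite DE //; case: K1 K2 => [D1 h1] [D2 h2]; split.
      by rewrite circE h1 //; apply: DD.
    by move=> x Dx; rewrite lambdaM h2 // h1.
  move=> d1 K1; have [D1 h1] := K1.
  have -> : - d1 = d1^-1 by rewrite cinvE (KV _ K1).
  split; last exact: KV.
  by rewrite cinvE (KV _ K1) //; apply: DN.
- by move=> a b [Da ha] Kb; have [Db _] := Kb; rewrite ha.
- by move=> a b Ka Kb; have [Db _] := Kb; rewrite (KV _ Ka).
Qed.

Let K_of_same d d' : D d -> D d' ->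
  (forall x, D x -> x *+ (Q ^ 2) = 0 -> lambda d x = lambda d' x) -> K (- d + d').
Proof.
move=> Dd1 Dd' e; have Kd : forall x, D x -> lambda (d^-1 ** d') x = x.
  have [[_ _ _] [_ DM DV]] := ideal_sub iD.
  have [n n0 dn] := lambda_finite_order (DM _ _ (DV _ Dd1) Dd').
  apply: (finite_order_trivial n0 (lambdaD _) (@DL _) _ (fun x _ => dn x)) => x Dx x2.
  by rewrite lambdaM -e // lambdaK.
have [_ L _] := dB K_sub.
have -> : - d + d' = lambda d (d^-1 ** d') by rewrite /lambda ginvK_r.
apply: L; split=> //.
by have [_ [_ DM DV]] := ideal_sub iD; apply/DM => //; apply: DV.
Qed.

Let cover_K : exists n, cover (addg B) K D n.
Proof.
pose S := D `&` [set x | x *+ (Q ^ 2) = 0].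
have fC : finite_set [set: S].
  have -> : [set: S] = (fun x : S => val x) @^-1` S.
    by apply/seteqP; split=> x _ //; exact: set_mem (valP x).
  by apply: finite_preimage (Df 2) => x z _ _; apply: val_inj.
pose F := fin_of fC.
have LS d (x : F) : S (lambda d (val (x : S))).
  have [Dx /= x2] : S (val (x : S)) by exact: set_mem (valP (x : S)).
  by split; [apply: DL | rewrite /= -lambdaX x2 lambda0].
pose rho d : {ffun F -> F} := [ffun x : F => exist _ (lambda d (val (x : S))) (mem_set (LS d x)) : F].
have rhoK d d' : D d -> D d' -> rho d = rho d' -> K (- d + d').
  move=> D1 D2 e; apply: K_of_same => // x Dx x2.
  pose x' : F := exist _ x (mem_set (conj Dx x2) : x \in S).
  by have /ffunP/(_ x') := e; rewrite !ffunE => /(congr1 val).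
pose L (k : nat) := if pselect (exists d, D d /\
    exists2 i : 'I_#|{ffun F -> F}|, k = i :> nat & rho d = enum_val i)
  is left e then sval (cid e) else 0.
exists #|{ffun F -> F}|, L => d Dd'.
exists (enum_rank (rho d)) => //; rewrite /L; case: pselect => [e|[]]; last first.
  by exists d; split=> //; exists (enum_rank (rho d)); rewrite ?enum_rankK.
case: (cid e) => /= d' [D' [i /val_inj ei e']].
by apply: rhoK => //; rewrite e' -ei enum_rankK.
Qed.

(** Elements of D that act alike on the finitely many elements of exponent Q^2
    act alike on D. So the kernel K of the action of D on itself has finite
    index, and a divisible group has no proper subgroup of finite index. *)
Lemma divisible_trivial d x : D d -> D x -> lambda d x = x.
Proof.
move=> Dd1 Dx; have [n [L cL]] := cover_K.
have sK := K_sub.1; have [_ KD KN] := sK; have [j dj] := Dt Dd1.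
have Kmult y : D y -> K (y *+ n`!).
  move=> Dy; have ex (k : 'I_n.+1) : exists i : 'I_n, K (- L i + y *+ k).
    by have [i il Ki] := cL _ (DX k Dy); exists (Ordinal il).
  pose t k := sval (cid (ex k)); have tP k : K (- L (t k) + y *+ k) := svalP (cid (ex k)).
  have /injectivePn[k1 [k2 k12 tk]] : ~~ injectiveb t.
    apply/negP => /injectiveP/leq_card; by rewrite !card_ord ltnn.
  wlog lt12 : k1 k2 k12 tk / (k1 < k2)%N => [W|].
    have [lt|gt|/val_inj e] := ltngtP k1 k2; first exact: (W k1 k2).
      by apply: (W k2 k1); rewrite // eq_sym.
    by rewrite e eqxx in k12.
  have Kd : K (y *+ (k2 - k1)).
    have := KD _ _ (KN _ (tP k1)) (tP k2); rewrite tk ginvM ginv_inv -gopA ginvK_r.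
    by rewrite -{1}(subnKC (ltnW lt12)) gpowD ginvK_l.
  have /dvdnP[r ->] : (k2 - k1 %| n`!)%N.
    apply: dvdn_fact; rewrite subn_gt0 lt12 /=.
    by apply: leq_trans (leq_subr _ _) _; rewrite -ltnS.
  by rewrite mulnC gpowM; apply: subgroup_gpow.
have [b [e [b0 bQ /dvdnP[r re]]]] := coprime_split (fact_gt0 n) Q0.
have [y Dy dy] := divisible_pow e Dd1.
have Kb : K (d *+ b).
  by rewrite dy -gpowM mulnC re mulnC gpowM; apply: subgroup_gpow => //; apply: Kmult.
suff [_ h] : K d by apply: h.
have bj : coprime b (Q ^ j) by apply: coprimeXr.
have [km kn e1 _] := egcdnP (Q ^ j) b0; move: e1; rewrite (eqP bj) => e1.
have -> : d = (d *+ b) *+ km.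
  by rewrite -gpowM mulnC e1 gpowD gpow1 mulnC gpowM dj gpow_id gop1.
exact: subgroup_gpow.
Qed.

End DivisibleIdeal.

(** ** Chains with cyclic central factors *)

Inductive cyclic_chain (B : skewBrace) (D : set B) : set B -> Prop :=
| ChainNil : cyclic_chain D D
| ChainCons V y : cyclic_chain D V -> cen V y -> cyclic_chain D (adj V y).

Section Chains.
Variable B : skewBrace.
Hypothesis dB : dedekind B.
Implicit Types (D V W J : set B) (Phi : set B -> Prop).

Lemma chain_ideal D V : ideal D -> cyclic_chain D V -> ideal V.
Proof. by move=> iD; elim=> // {}V y _ iV cy; apply/dB/adj_cen_sub. Qed.

Lemma chain_sub D V : cyclic_chain D V -> D `<=` V.
Proof. by elim=> // {}V y _ DV _ t /DV; apply: sub_adj. Qed.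

Lemma multiples_in V (y : B) : subgroup (addg B) V ->
  exists r : nat, V (y *+ r) /\ forall n : int, V (y *~ n) -> (r %| n)%Z.
Proof.
move=> sV; have [V0 VD VN] := sV.
have nz (n : int) : V (y *~ n) -> V (y *+ `|n|).
  by case: n => n // h; have := VN _ h; rewrite [y *~ _]/= ginv_inv.
have [ex|no] := pselect (exists r, (0 < r)%N && `[< V (y *+ r) >]); last first.
  exists 0%N; split=> // n /nz h; rewrite dvd0z -absz_eq0; apply/eqP.
  by apply: contrapT => /eqP; rewrite -lt0n => n0; apply: no; exists `|n|%N; rewrite n0; apply/asboolP.
case: (ex_minnP ex) => r /andP[r0 /asboolP Vr] rmin; exists r; split=> // n hn.
apply: contrapT => /negP nd.
have m0 : (0 < `|(n %% r)%Z|)%N.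
  by rewrite lt0n absz_eq0; apply: contra nd => /eqP e; apply/dvdz_mod0P.
have hm : V (y *+ `|(n %% r)%Z|).
  apply: nz; have -> : (n %% r)%Z = (n - r%:Z * (n %/ r)%Z)%R.
    by rewrite {2}(divz_eq n r); ring.
  by rewrite gzD gzN gzM; apply/VD => //; apply/VN/(subgroup_gz _ sV Vr).
have := rmin `|(n %% r)%Z|%N; rewrite m0 (asboolT hm) => /(_ isT).
have : ((n %% r)%Z < r%:Z)%R by apply: ltz_pmod.
have : (0 <= (n %% r)%Z)%R by apply: modz_ge0; lia.
by lia.
Qed.

(** Lifting a chain: every step V + <y> can be followed inside a smaller ideal W
    with W + D = V, at the cost of adding two elements of D at each step, which
    absorb the lambda-cocycle of y and the relation satisfied by y modulo V. All
    the ideals W exist because B is Dedekind. *)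
Lemma chain_lift D J V Phi : ideal D ->
  (forall W, Phi W -> ideal W) -> Phi J -> J `<=` D ->
  (forall W d, Phi W -> D d -> Phi (adj W d)) ->
  (forall W y, Phi W -> cen W y -> adj W y `&` D `<=` W -> Phi (adj W y)) ->
  cyclic_chain D V -> exists W, [/\ Phi W, W `<=` V &
    forall v, V v -> exists w d, [/\ W w, D d & v = w + d]].
Proof.
move=> iD PI PJ JD PD PC; elim=> [|{}V y cV [W [PW WV hW]] cy].
  exists J; split=> // v Dv; exists 0, v; rewrite gop1; split=> //.
  by have [[[]]] := PI _ PJ.
have iV := chain_ideal iD cV; have DV := chain_sub cV.
have [[V0 VD VN] _] := ideal_sub iV.
have [w1 [d1 [Ww1 Dd1 e1]]] := hW _ (cen_lambda y cy iV).
have [r [Vr rP]] := multiples_in y (ideal_sub iV).1.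
have [w3 [d3 [Ww3 Dd3 e3]]] := hW _ Vr.
pose W1 := adj (adj W d1) d3.
have P1 : Phi W1 by do 2 apply: (PD) => //.
have i1 := PI _ P1; have s1 := (ideal_sub i1).1; have [W10 W1D W1N] := s1.
have WW1 : W `<=` W1 by move=> t /(@sub_adj _ _ d1)/(@sub_adj _ _ d3).
have i1' : ideal (adj W d1) by apply/PI/PD.
have W1d1 : W1 d1 by apply/sub_adj/mem_adj/PI.
have W1d3 : W1 d3 by apply: mem_adj.
have W1V : W1 `<=` V.
  do 2 (apply: adj_min; [by have [] := ideal_sub iV | | exact: DV]).
  exact: WV.
have W1l : W1 (- y + lambda y y) by rewrite e1; apply: W1D => //; apply: WW1.
have W1r : W1 (y *+ r) by rewrite e3; apply/W1D => //; apply: WW1.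
have i2 : ideal (adj W1 y) by apply/dB/adj_sub.
have meet : adj W1 y `&` V `<=` W1.
  move=> t [[n nt] Vt].
  have Vy : V (y *~ n).
    have -> : y *~ n = t + - (- (y *~ n) + t) by rewrite ginvM ginv_inv ginvK_r.
    by apply/VD => //; apply/VN/W1V.
  have /dvdzP[k nk] := rP n Vy.
  rewrite -(ginvK_r (addg B) (y *~ n) t); apply/W1D => //.
  by rewrite nk mulrC gzM; apply: subgroup_gz.
have c1 : cen W1 y.
  move=> b; have [h1 h2 h3] := sub_cen i2 (mem_adj y i1) b.
  by have [k1 k2 k3] := cy b; split; apply: meet.
exists (adj W1 y); split.
- by apply: PC => // t [h /DV Vt]; apply: meet.
- apply: adj_min; first by have [] := ideal_sub (chain_ideal iD (ChainCons cV cy)).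
    by move=> t /W1V; apply: sub_adj.
  exact: mem_adj.
- move=> v [n /hW[w [d [Ww Dd e]]]]; exists (y *~ n + w), d; split=> //.
    by exists n; rewrite ginvK_l; apply: WW1.
  by rewrite -gopA -e ginvK_r.
Qed.

(** Descending along the central series, chain_lift replaces the bottom term by
    the previous one, and the part of a in the old bottom is adjoined on top. *)
Lemma cyclic_chain_ex J c a : ideal J -> zs J c = setT ->
  exists2 V, cyclic_chain J V & V a.
Proof.
move=> iJ hc; suff H i : (exists2 V, cyclic_chain (zs J i) V & V a) ->
    exists2 V, cyclic_chain J V & V a.
  by apply: (H c); exists setT => //; rewrite hc; constructor.
elim: i => // i IH [V cV Va]; apply: IH.
have iZ := zs_ideal i iJ; have iZ' := zs_ideal i.+1 iJ.
have [|||W d cW Zd|W y cW cy _|W [cW WV hW]] :=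
    @chain_lift (zs J i.+1) (zs J i) V (cyclic_chain (zs J i)) iZ' _ _ _ _ _ cV.
- by move=> W; apply: chain_ideal.
- exact: ChainNil.
- exact: sub_cen.
- by apply: ChainCons => //; apply: cen_sub Zd; apply: chain_sub.
- exact: ChainCons.
have [w [d [Ww Zd ->]]] := hW a Va.
have cd : cen W d by apply: cen_sub Zd; apply: chain_sub.
exists (adj W d); first exact: ChainCons.
have iW' := chain_ideal iZ (ChainCons cW cd).
have [[_ AD _] _] := ideal_sub iW'.
by apply/AD; [apply: sub_adj | apply/mem_adj/(chain_ideal iZ)].
Qed.

Variables (D : set B) (Q c : nat).
Hypotheses (iD : ideal D) (Q0 : (0 < Q)%N).
Hypothesis DC : forall x y, D x -> D y -> x + y = y + x.
Hypothesis Dt : forall x, D x -> exists j, x *+ (Q ^ j) = 0.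
Hypothesis Dd : forall x, D x -> exists2 y, D y & x = y *+ Q.
Hypothesis Df : forall j, finite_set (D `&` [set x | x *+ (Q ^ j) = 0]).
Hypothesis hc : zs D c = setT.

(** Any a lies in an ideal W that meets D in a group of bounded exponent, so a
    centralises D modulo a bounded group; as D is divisible, a centralises D. *)
Lemma divisible_center : D `<=` center B.
Proof.
have lD := divisible_trivial dB iD Q0 DC Dt Dd Df.
have [[D0 DD DN] _] := ideal_sub iD.
pose Phi W := ideal W /\ exists j, forall t, W t -> D t -> t *+ (Q ^ j) = 0.
have PD W d : Phi W -> D d -> Phi (adj W d).
  move=> [iW [j hj]] Dd'; have [[W0 _ _] _] := ideal_sub iW.
  split; first by apply/dB/adj_sub; rewrite ?lD ?gopV.
  have [k dk] := Dt Dd'; exists (j + k)%N => t [n nt] Dt'.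
  have Dn : D (d *~ n) by apply: subgroup_gz (ideal_sub iD).1 Dd'.
  have Dnt : D (- (d *~ n) + t) by apply/DD => //; apply: DN.
  rewrite -(ginvK_r (addg B) (d *~ n) t) gpow_mul; last exact: DC.
  have -> : (d *~ n) *+ (Q ^ (j + k)) = 0.
    rewrite -gz_nat -gzM expnD PoszM mulrA mulrC gzM gz_nat dk; exact: gz_id.
  by rewrite gop1 expnD gpowM hj // gpow_id.
move=> x Dx; apply/act_center => i a.
have [V cV Va] := cyclic_chain_ex a iD hc.
have [|||W y [iW [j hj]] cy WD|W [PW WV hW]] :=
    @chain_lift D [set 0] V Phi iD _ _ _ PD _ cV.
- by move=> W [].
- by split; [exact: zero_ideal | exists 0%N => t -> _; rewrite gpow1].
- by move=> _ ->.
- split; first by apply/dB/adj_cen_sub.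
  by exists j => t Wt Dt'; apply: hj => //; apply: WD.
have [w [d [Ww Dd' aE]]] := hW a Va.
have [iW' [j hj]] := PD _ _ PW Dd'.
have W'a : adj W d a.
  have [[_ AD _] _] := ideal_sub iW'; rewrite aE; apply/AD; first exact: sub_adj.
  by apply: mem_adj; case: PW.
have [y Dy xy] := divisible_pow Dd j Dx.
have Day : D (act i a y) by apply: act_ideal.
have ayX : act i a x = act i a y *+ (Q ^ j).
  have pl z : D z -> gpow (act_law B i) z (Q ^ j) = z *+ (Q ^ j).
    by move=> Dz; apply: (gz_law i (Q ^ j)%N (lD z z Dz Dz)).
  rewrite xy -(pl _ Dy) -(pl _ Day); exact: (morph_gz y (Q ^ j)%N (act_morph i a)).
apply: (@gop_inj _ (addg B) (- x)); rewrite gopV ayX xy -gpow_inv -gpow_mul; last first.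
  by apply: DC => //; apply: DN.
apply: hj; last by apply/DD => //; apply: DN.
have [C [f [sf k]]] := quot_ex iW'; have fa : f a = 0 by apply/(ker0 k).
apply/k; rewrite act_bhom fa; case: (i) => /=; first by rewrite lambda_id.
  by rewrite ginv1 gopr1 gop1.
by rewrite -circ_id ginv1 gopr1 gop1.
Qed.

End Chains.

Section AbelianStep.
Variables (A : zmodType) (Q : nat) (gs : seq A) (B : skewBrace) (i : A -> B) (c : nat).
Hypotheses (dA : minimax_data Q gs) (dB : dedekind B).
Hypotheses (iD : {morph i : a b / (a + b)%R >-> a + b}) (iI : injective i).
Hypotheses (iM : ideal (range i)) (hc : zs (range i) c = setT).

(** Above the torsion subgroup T of the ideal A this is the elementary abelian
    case; T is a finite extension of its divisible part D; and D is central. *)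
Lemma abelian_step : exists n, zs [set (0 : B)] n = setT.
Proof.
have Q0 := data_pos dA.
have hT := torsion_quotient_nilpotent dA dB iD iI iM hc.
have Qj j : (0 < Q ^ j)%N by rewrite expn_gt0 Q0.
have [k0 div] := divisible_part (data_fin dA Q0).
pose D : set A := [set a | Qtors Q a /\ exists2 b, Qtors Q b & a = (b *+ (Q ^ k0))%R].
have [T0 TD TN] := Qtors_subgroup A Q.
have iDD : ideal (i @` D).
  apply: (char_ideal dB iD iI iM).
    split=> [|a b [Ta [a' Ta' ->]] [Tb [b' Tb' ->]]|a [Ta [a' Ta' ->]]].
    - by split=> //; exists 0%R; rewrite ?mul0rn.
    - by split; [apply/TD; rewrite -?zlaw_pow; apply: subgroup_gpow (Qtors_subgroup A Q) _
        | exists (a' + b')%R; [exact: TD | rewrite mulrnDl]].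
    - by split; [apply/TN; rewrite -?zlaw_pow; apply: subgroup_gpow (Qtors_subgroup A Q) _
        | exists (- a')%R; [exact: TN | rewrite mulNrn]].
  move=> g gD a [Ta [b Tb ->]].
  have gT a' : Qtors Q a' -> Qtors Q (g a').
    by move=> [j ja]; exists j; rewrite /= -(zaddX gD) ja zadd0.
  have TbX : Qtors Q (g b *+ (Q ^ k0))%R.
    by rewrite -zlaw_pow; apply: subgroup_gpow (Qtors_subgroup A Q) (gT _ Tb).
  by rewrite (zaddX gD); split=> //; exists (g b) => //; apply: gT.
have DC x y : (i @` D) x -> (i @` D) y -> x + y = y + x.
  by move=> [a _ <-] [b _ <-]; rewrite -!iD addrC.
have Dt x : (i @` D) x -> exists j, x *+ (Q ^ j) = 0.
  by move=> [a [[j ja] _] <-]; exists j; rewrite -zmorph_mul // ja zmorph0.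
have Dd x : (i @` D) x -> exists2 y, (i @` D) y & x = y *+ Q.
  move=> [a [[m ma] [b [j jb] ab]] <-]; have [b' ab'] := div a b m ma ab.
  have Tb' : Qtors Q b'.
    by exists (k0.+1 + m)%N; rewrite /= expnD mulrnA -ab' ma.
  exists (i (b' *+ (Q ^ k0))%R); last by rewrite -zmorph_mul // -mulrnA -expnSr -ab'.
  exists (b' *+ (Q ^ k0))%R => //; split; last by exists b'.
  by rewrite -zlaw_pow; apply: subgroup_gpow (Qtors_subgroup A Q) Tb'.
have Df j : finite_set ((i @` D) `&` [set x | x *+ (Q ^ j) = 0]).
  apply: (@sub_finite_set _ _ (i @` [set a | (a *+ (Q ^ j))%R = 0%R])).
    move=> _ [[a _ <-] /= aj]; exists a => //=; apply: iI.
    by rewrite zmorph_mul // aj zmorph0.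
  exact/finite_image/(data_fin dA).
have [n cT] : exists n, cover (addg B) (i @` D) (i @` Qtors Q) n.
  have /finite_seqP[s sE] := data_fin dA (Qj k0).
  exists (size s), (fun k => i (nth 0%R s k)) => _ [t Tt <-].
  have : (i @` D) (i (t *+ (Q ^ k0))%R).
    exists (t *+ (Q ^ k0))%R => //; split; last by exists t.
    by rewrite -zlaw_pow; apply: subgroup_gpow (Qtors_subgroup A Q) Tt.
  move=> /(divisible_pow Dd k0)[_ [d Dd' <-]]; rewrite -zmorph_mul // => /iI e.
  have ts : (t - d)%R \in s.
    have : [set` s] (t - d)%R by rewrite -sE /= mulrnBl e subrr.
    by [].
  exists (index (t - d)%R s); first by rewrite index_mem.
  rewrite nth_index // -zmorphN // -iD opprB subrK.
  by exists d.
have [m hm] : exists m, zs (i @` D) m = setT.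
  apply: (finite_ideal_nilpotent dB iDD _ _ cT hT).
    exact: (Qtors_ideal Q dB iD iI iM).
  by move=> _ [a [Ta _] <-]; exists a.
exists m.+1; apply: (zs_step _ hm); rewrite cen0.
exact: (divisible_center dB iDD Q0 DC Dt Dd Df hm).
Qed.

End AbelianStep.

(** * Abelian minimax groups *)

(** For N normal in M these are the chain conditions on M/N, expressed without
    forming the quotient. *)
Definition interval_min T (G : group_law T) (N M : set T) : Prop :=
  forall F : set (set T), F !=set0 ->
    (forall H, F H -> [/\ subgroup G H, N `<=` H & H `<=` M]) ->
    exists2 X, F X & forall H, F H -> H `<=` X -> H = X.

Definition interval_max T (G : group_law T) (N M : set T) : Prop :=
  forall F : set (set T), F !=set0 ->
    (forall H, F H -> [/\ subgroup G H, N `<=` H & H `<=` M]) ->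
    exists2 X, F X & forall H, F H -> X `<=` H -> H = X.

Definition interval_series T (G : group_law T) (n : nat) (S : nat -> set T) :=
  [/\ S 0%N = [set gid G], (forall i, (i <= n)%N -> subgroup G (S i)) &
    forall i, (i < n)%N -> S i `<=` S i.+1 /\
      (interval_min G (S i) (S i.+1) \/ interval_max G (S i) (S i.+1))].

Section AbelianMinimax.
Variable A : zmodType.
Local Open Scope ring_scope.
Implicit Types (a b x y : A) (N M H : set A) (gs : seq A).
Local Notation sg := (subgroup (zlaw A)).

Lemma sg0 H : sg H -> H 0. Proof. by case. Qed.
Lemma sgD H a b : sg H -> H a -> H b -> H (a + b). Proof. by case=> _ + _; apply. Qed.
Lemma sgN H a : sg H -> H a -> H (- a). Proof. by case=> _ _; apply. Qed.
Lemma sgB H a b : sg H -> H a -> H b -> H (a - b).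
Proof. by move=> sH Ha Hb; apply: sgD => //; apply: sgN. Qed.
Lemma sgX H a n : sg H -> H a -> H (a *+ n).
Proof. by rewrite -zlaw_pow; apply: subgroup_gpow. Qed.
Lemma sgZ H a n : sg H -> H a -> H (a *~ n).
Proof. by rewrite -zlaw_gz; apply: subgroup_gz. Qed.

Definition zadj H y : set A := [set a | exists n : int, H (a - y *~ n)].

Lemma zadj_sg H y : sg H -> sg (zadj H y).
Proof.
move=> sH; split=> [|a b [n an] [m bm]|a [n an]].
- by exists 0; rewrite mulr0z subr0; apply: sg0.
- exists (n + m); rewrite mulrzDr /= opprD addrACA; exact: sgD.
- by exists (- n); rewrite mulrNz /= -opprD; apply: sgN.
Qed.

Lemma sub_zadj H y : H `<=` zadj H y.
Proof. by move=> a Ha; exists 0; rewrite mulr0z subr0. Qed.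

Lemma mem_zadj H y : sg H -> zadj H y y.
Proof. by move=> sH; exists 1; rewrite mulr1z subrr; apply: sg0. Qed.

Lemma zadj_min H M y : sg M -> H `<=` M -> M y -> zadj H y `<=` M.
Proof.
move=> sM HM My a [n an]; rewrite -(subrK (y *~ n) a).
by apply: sgD => //; [apply: HM | apply: sgZ].
Qed.

Lemma coprime_kill N a (k m : nat) : sg N -> coprime k m ->
  N (a *+ k) -> N (a *+ m) -> N a.
Proof.
move=> sN ckm ak am; have /coprimezP[[u v] /= uv] : coprimez k m by rewrite coprimezE.
rewrite -[a]mulr1z -uv mulrzDr mulrC [v * _]mulrC !mulrzA.
by apply: sgD => //; apply: sgZ.
Qed.

Lemma interval_max_fg N M : sg N -> sg M -> N `<=` M ->
  interval_max (zlaw A) N M ->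
  exists gs, forall a, M a -> exists2 s, zspan gs s & N (a - s).
Proof.
move=> sN sM NM mx; pose F H := [/\ sg H, N `<=` H, H `<=` M &
  exists gs, forall a, H a -> exists2 s, zspan gs s & N (a - s)].
have [||H [sH NH HM [gs hgs]] Hmax] := mx F; last 1 first.
- have [MH|nMH] := pselect (M `<=` H); first by exists gs => a /MH/hgs.
  have [y [My nHy]] : exists y, M y /\ ~ H y.
    by apply: contrapT => no; apply: nMH => y My; apply: contrapT => nHy; apply: no; exists y.
  case: nHy; rewrite -(Hmax (zadj H y)).
  + exact: mem_zadj.
  + split; [exact: zadj_sg | | exact: zadj_min |].
      by move=> a /NH; apply: sub_zadj.
    exists (y :: gs) => a [n /hgs[s hs e]]; exists (y *~ n + s); first by exists n, s.
    by rewrite opprD addrA.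
  + exact: sub_zadj.
- exists N; split=> //; exists [::] => a Na; exists 0 => //; by rewrite subr0.
- by move=> H [].
Qed.

(** The chain of the N + <2^j a> shows that a has finite order modulo N. The
    orders involve finitely many primes because the subgroups of elements of
    order prime to Q, for varying Q, have a minimal member. *)
Lemma interval_min_torsion N M : sg N -> sg M -> N `<=` M ->
  interval_min (zlaw A) N M ->
  exists2 Q, (0 < Q)%N & forall a, M a -> exists j, N (a *+ (Q ^ j)).
Proof.
move=> sN sM NM mn.
have tors a : M a -> exists2 k, (0 < k)%N & N (a *+ k).
  move=> Ma; have [||_ [j _ <-] jmin] := mn [set zadj N (a *+ (2 ^ j)) | j in setT].
  - by exists (zadj N (a *+ (2 ^ 0))); exists 0%N.
  - move=> _ [j _ <-]; split; [exact: zadj_sg | exact: sub_zadj |].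
    by apply: zadj_min => //; apply: sgX.
  have : zadj N (a *+ (2 ^ j)) (a *+ (2 ^ j)) by apply: mem_zadj.
  rewrite -(jmin (zadj N (a *+ (2 ^ j.+1)))); first last.
  - apply: zadj_min; [exact: zadj_sg | exact: sub_zadj |].
    by rewrite expnSr mulrnA; exact: (sgX _ (zadj_sg _ sN) (mem_zadj _ sN)).
  - by exists j.+1.
  move=> [n]; pose k := (2 ^ j)%N%:Z * (1 - 2 * n).
  have -> : a *+ (2 ^ j) - a *+ (2 ^ j.+1) *~ n = a *~ k.
    rewrite !pmulrn -mulrzA -mulrzBr /k expnS PoszM; congr (_ *~ _); ring.
  move=> ak; exists `|k|%N.
    rewrite absz_gt0 mulf_eq0 negb_or; apply/andP; split; last by lia.
    by rewrite -lt0n expn_gt0.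
  case: (intP k) ak => [|m|m]; rewrite ?absz0 //.
    by rewrite mulrNz => /(sgN sN); rewrite opprK abszN.
pose MQ (Q : nat) : set A := [set a | M a /\ exists2 k, (0 < k)%N && coprime k Q & N (a *+ k)].
have [||_ [Q Q0 <-] Qmin] := mn [set MQ Q | Q in [set Q | (0 < Q)%N]].
- by exists (MQ 1%N); exists 1%N.
- move=> _ [Q Q0 <-]; split; last by move=> a [].
    split=> [|a b [Ma [k /andP[k0 kQ] ak]] [Mb [m /andP[m0 mQ] bm]]|a [Ma [k kQ ak]]].
    + by split; [apply: sg0 | exists 1%N; rewrite ?coprime1n // mulr1n; apply: sg0].
    + split; first exact: sgD; exists (k * m)%N; first by rewrite muln_gt0 k0 m0 coprimeMl kQ.
      rewrite mulrnDl; apply: sgD => //; first by rewrite mulrnA; apply: sgX.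
      by rewrite mulnC mulrnA; apply: sgX.
    + by split; [apply: sgN | exists k => //; rewrite /= mulNrn; apply: sgN].
  by move=> a Na; split; [apply: NM | exists 1%N; rewrite ?coprime1n // mulr1n].
exists Q => // a Ma; have [k k0 ak] := tors a Ma.
have [b [e [b0 bQ /dvdnP[r re]]]] := coprime_split k0 Q0; exists e.
have ab : N (a *+ (Q ^ e) *+ b).
  by rewrite -mulrnA mulnC re mulnC mulrnA; apply: sgX.
have : MQ Q (a *+ (Q ^ e)) by split; [apply: sgX | exists b; rewrite ?b0].
rewrite -(Qmin (MQ (Q * b)%N)).
- move=> [_ [k3 /andP[_ k3Q] h3]]; apply: (coprime_kill sN _ h3 ab).
  by move: k3Q; rewrite coprimeMr => /andP[].
- by exists (Q * b)%N; rewrite //= muln_gt0 Q0.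
- move=> y [My [k3 /andP[k30 k3Q] h3]]; split=> //; exists k3 => //; rewrite k30.
  by move: k3Q; rewrite coprimeMr => /andP[->].
Qed.

Lemma cover_zadj N H y p n : sg N -> sg H -> prime p -> N (y *+ p) ->
  cover (zlaw A) N H n -> cover (zlaw A) N (zadj H y) (p * n).
Proof.
move=> sN sH pp py [L cL]; have p0 := prime_gt0 pp.
exists (fun k => y *+ (k %% p) + L (k %/ p)%N) => a [m /cL[i il hi]].
pose r := `|(m %% p)%Z|%N; have rE : r%:Z = (m %% p)%Z.
  by rewrite /r gez0_abs ?modz_ge0 //; lia.
have rp : (r < p)%N by rewrite -ltz_nat rE ltz_pmod.
exists (i * p + r)%N.
  have : (i.+1 * p <= n * p)%N by rewrite leq_mul2r il orbT.
  by rewrite mulSn [(n * p)%N]mulnC; apply: leq_trans; rewrite addnC ltn_add2r.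
rewrite /= modnMDl modn_small // divnMDl // divn_small // addn0.
have -> : - (y *+ r + L i) + a = (- L i + (a - y *~ m)) + (y *+ p) *~ (m %/ p)%Z.
  have my : y *~ m = y *+ r + (y *+ p) *~ (m %/ p)%Z.
    rewrite {1}(divz_eq m p) -rE mulrzDr addrC; congr (_ + _).
    by rewrite mulrC mulrzA.
  by rewrite my !opprD -!addrA addNr addr0 addrCA [- _ + a]addrC.
by apply: sgD => //; apply: sgZ.
Qed.

(** Under the minimal condition, a minimal infinite subgroup H would be K + <h>
    with K maximal without h. *)
Lemma elementary_finite N E p : sg N -> sg E -> N `<=` E -> prime p ->
  (forall a, E a -> N (a *+ p)) ->
  interval_min (zlaw A) N E \/ interval_max (zlaw A) N E ->
  exists n, cover (zlaw A) N E n.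
Proof.
move=> sN sE NE pp pE [mn|mx]; last first.
  pose F H := [/\ sg H, N `<=` H, H `<=` E & exists n, cover (zlaw A) N H n].
  have [||H [sH NH HE [n cH]] Hmax] := mx F.
  - exists N; split=> //; exists 1%N, (fun=> 0) => a Na; exists 0%N => //=.
    by rewrite oppr0 add0r.
  - by move=> H [].
  suff EH : E `<=` H by exists n; case: cH => L cL; exists L => a /EH/cL.
  move=> y Ey; rewrite -(Hmax (zadj H y)); first exact: mem_zadj.
    split; [exact: zadj_sg | | exact: zadj_min |].
      by move=> a /NH; apply: sub_zadj.
    by exists (p * n)%N; apply: cover_zadj => //; apply: pE.
  exact: sub_zadj.
apply: contrapT => infE.
pose F H := [/\ sg H, N `<=` H, H `<=` E & ~ exists n, cover (zlaw A) N H n].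
have [||H [sH NH HE infH] Hmin] := mn F; first by exists E; split.
  by move=> H [].
have [h [Hh nNh]] : exists h, H h /\ ~ N h.
  apply: contrapT => no; apply: infH; exists 1%N, (fun=> 0) => a Ha; exists 0%N => //=.
  rewrite oppr0 add0r; apply: contrapT => nN; apply: no; by exists a.
pose Phi K := [/\ sg K, K `<=` H & ~ K h].
have [||K [[sK KH nKh] NK Kmax]] := @zorn_above A Phi N.
- by [].
- move=> C C0 CP tC; split.
  + by apply: subgroup_bigcup => // X /CP[].
  + by move=> a [X /CP[_ XH _]]; apply: XH.
  + by move=> [X /CP[_ _ nX]].
have [n cK] : exists n, cover (zlaw A) N K n.
  apply: contrapT => infK; apply: nKh; rewrite (Hmin K) //.
  by split=> //; apply: subset_trans HE.
apply: infH; exists (p * n)%N.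
have [L cL] := @cover_zadj N K h p n sN sK pp (pE _ (HE _ Hh)) cK.
exists L => y Hy; apply: cL; have [Ky|nKy] := pselect (K y); first exact: sub_zadj.
have Kyh : zadj K y h.
  apply: contrapT => nh; apply: nKy; rewrite -(Kmax (zadj K y)); first exact: mem_zadj.
    by split=> //; [exact: zadj_sg | exact: zadj_min].
  exact: sub_zadj.
case: Kyh => m hm; have mp : coprime `|m| p.
  rewrite coprime_sym prime_coprime //; apply/negP => pm; apply: nKh.
  have /dvdzP[r mr] : (p%:Z %| m)%Z by rewrite dvdzE.
  rewrite -(subrK (y *~ m) h); apply: sgD => //.
  by rewrite mr mulrC mulrzA; apply: sgZ => //; apply/NK/pE/HE.
have /coprimezP[[u v] /= uv] : coprimez m p by rewrite coprimezE.
exists u.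
have -> : y - h *~ u = (y *+ p) *~ v - (h - y *~ m) *~ u.
  rewrite mulrzBl opprB addrA [(y *+ p)%R]pmulrn -!mulrzA -mulrzDr.
  by rewrite [p%:Z * v]mulrC [m * u]mulrC [v * _ + _]addrC uv mulr1z.
by apply: sgB => //; apply: sgZ => //; apply/NK/pE/HE.
Qed.

Lemma interval_sub N E M : E `<=` M ->
  interval_min (zlaw A) N M \/ interval_max (zlaw A) N M ->
  interval_min (zlaw A) N E \/ interval_max (zlaw A) N E.
Proof.
by move=> EM [c|c]; [left|right] => F F0 FE; apply: c => // H /FE[? ? HE];
  split=> //; apply: subset_trans EM.
Qed.

Lemma finite_torsion : (forall p, prime p -> finite_set [set a : A | a *+ p = 0]) ->
  forall m, (0 < m)%N -> finite_set [set a : A | a *+ m = 0].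
Proof.
move=> primes.
  elim/ltn_ind => m IH m0; have [m1|m1] := leqP m 1.
    have -> : m = 1%N by apply/eqP; rewrite eqn_leq m1.
    by apply: (@sub_finite_set _ _ [set 0]); [move=> a | exact: finite_set1].
  have pp := pdiv_prime m1; have /dvdnP[m' mE] := pdiv_dvd m; set p := pdiv m in pp mE.
  have m'0 : (0 < m')%N by case: m' mE => // e; rewrite e in m0.
  have m'm : (m' < m)%N by rewrite mE ltn_Pmulr // prime_gt1.
  have fk := primes p pp; have fX := IH m' m'm m'0.
  pose r x : A := if pselect (exists a, a *+ p = x) is left e then sval (cid e) else 0.
  apply: (@sub_finite_set _ _ ((fun xb => r xb.1 + xb.2) @`
    ([set a | a *+ m' = 0] `*` [set a | a *+ p = 0]))); last first.
    by apply: finite_image; apply: finite_setX.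
  move=> a am.
  have rp : r (a *+ p) *+ p = a *+ p.
    by rewrite /r; case: pselect => [e|[]]; [exact: svalP (cid e) | exists a].
  exists (a *+ p, a - r (a *+ p)); last by rewrite /= addrC subrK.
  by split; rewrite /= ?mulrnBl ?rp ?subrr // -mulrnA mulnC -mE.
Qed.

Section Series.
Variables (n : nat) (S : nat -> set A).
Hypothesis serS : interval_series (zlaw A) n S.

Lemma series_torsion p i : prime p -> (i <= n)%N ->
  finite_set (S i `&` [set a | a *+ p = 0]).
Proof.
have [S0 sS stS] := serS.
move=> pp; elim: i => [|i IH] le_in.
  by apply: (@sub_finite_set _ _ [set 0]); [rewrite S0 => a [] | exact: finite_set1].
have [SS cond] := stS i le_in; have sN := sS i (ltnW le_in); have sM := sS _ le_in.
pose E := S i.+1 `&` [set a | S i (a *+ p)].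
have sE : sg E.
  split=> [|a b [Ma Na] [Mb Nb]|a [Ma Na]].
  - by split; [apply: sg0 | rewrite /= mul0rn; apply: sg0].
  - by split; [apply: sgD | rewrite /= mulrnDl; apply: sgD].
  - by split; [apply: sgN | rewrite /= mulNrn; apply: sgN].
have NE : S i `<=` E by move=> a Na; split; [exact: SS | apply: sgX].
have [||m [L cL]] := elementary_finite sN sE NE pp; first by move=> a [].
  by apply: interval_sub cond => a [].
pose X := S i.+1 `&` [set a | a *+ p = 0].
pose r k : A := if pselect (exists a, X a /\ S i (- L k + a)) is left e
  then sval (cid e) else 0.
apply: (@sub_finite_set _ _ ((fun kb => r kb.1 + kb.2) @`
    (`I_m `*` (S i `&` [set a | a *+ p = 0])))); last first.
  by apply: finite_image; apply: finite_setX; [exact: finite_II | exact/IH/ltnW].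
move=> a [Ma pa]; have [|k km Lka] := cL a; first by split; rewrite //= pa; apply: sg0.
have [Xr Lkr] : X (r k) /\ S i (- L k + r k).
  by rewrite /r; case: pselect => [e|[]]; [exact: svalP (cid e) | exists a].
exists (k, a - r k); last by rewrite /= addrC subrK.
split=> //=; split.
  have -> : a - r k = (- L k + a) - (- L k + r k) by rewrite opprD addrACA subrr add0r.
  exact: sgB.
by case: Xr => _ /= pr; rewrite mulrnBl pa pr subr0.
Qed.

Lemma series_gen i : (i <= n)%N -> exists Q gs, (0 < Q)%N /\
  forall a, S i a -> exists j, zspan gs (a *+ (Q ^ j)).
Proof.
have [S0 sS stS] := serS.
elim: i => [|i IH] le_in.
  exists 1%N, [::]; split=> // a; rewrite S0 => ->; exists 0%N; exact: mul0rn.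
have [Q [gs [Q0 hgs]]] := IH (ltnW le_in).
have [SS cond] := stS i le_in; have sN := sS i (ltnW le_in); have sM := sS _ le_in.
case: cond => [mn|mx].
  have [Q1 Q10 h1] := interval_min_torsion sN sM SS mn.
  exists (Q * Q1)%N, gs; split; first by rewrite muln_gt0 Q0.
  move=> a /h1[j /hgs[k hk]]; exists (j + k)%N.
  have -> : ((Q * Q1) ^ (j + k) = Q1 ^ j * Q ^ k * (Q ^ j * Q1 ^ k))%N.
    by rewrite expnMn !expnD [(Q ^ j * _)%N]mulnC mulnACA [(Q ^ k * _)%N]mulnC.
  by rewrite mulrnA pmulrn; apply: zspanZ; rewrite mulrnA.
have [xs hxs] := interval_max_fg sN sM SS mx.
exists Q, (xs ++ gs); split=> // a /hxs[s hs /hgs[k hk]]; exists k.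
rewrite -(subrK s a) mulrnDl.
have h2 : zspan xs (s *+ (Q ^ k)) by rewrite pmulrn; apply: zspanZ.
elim: (xs) (s *+ _) h2 => [|x l IHl] t /= h2; first by rewrite h2 addr0.
case: h2 => m [t' [ht' ->]]; exists m, ((a - s) *+ (Q ^ k) + t').
by split; [apply: IHl | rewrite addrCA].
Qed.

Definition lin k (g : 'I_k -> A) (c : 'I_k -> int) : A := \sum_i g i *~ c i.

Lemma zspan_lin gs a : zspan gs a -> exists c : 'I_(size gs) -> int,
  a = lin (fun i => nth 0 gs i) c.
Proof.
elim: gs a => [|g gs IH] a /=; first by move=> ->; exists (fun=> 0); rewrite /lin big_ord0.
move=> [n' [s [/IH[c ->] ->]]].
exists (fun i => oapp c n' (unlift ord0 i)); rewrite /lin big_ord_recl unlift_none /=.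
by congr (_ + _); apply: eq_bigr => i _; rewrite liftK.
Qed.

Lemma zspan_mem gs a : a \in gs -> zspan gs a.
Proof.
elim: gs => //= g gs IH; rewrite inE => /orP[/eqP ->|/IH h]; last exact: zspan_cons.
by exists 1, 0; rewrite mulr1z addr0; split=> //; apply: zspan0.
Qed.

Lemma lin_zspan k (g : 'I_k -> A) c : zspan (codom g) (lin g c).
Proof.
apply: (big_ind (zspan (codom g))); [exact: zspan0 | exact: zspanD |].
by move=> i _; apply/zspanZ/zspan_mem/codom_f.
Qed.

Lemma linZ k (g : 'I_k -> A) c m : lin g c *~ m = lin g (fun i => c i * m).
Proof. by rewrite /lin mulrz_suml; apply: eq_bigr => i _; rewrite mulrzA. Qed.

Lemma linB k (g : 'I_k -> A) c d : lin g c - lin g d = lin g (fun i => c i - d i).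
Proof. by rewrite /lin -sumrB; apply: eq_bigr => i _; rewrite mulrzBr. Qed.

Hypothesis topS : S n = setT.

Let generated k := exists Q (g : 'I_k -> A), (0 < Q)%N /\
  forall a, exists j c, a *+ (Q ^ j) = lin g c.

(** A generating family of minimal length is independent: a relation in which
    one of the generators has coefficient m allows to drop it, at the cost of
    inverting m. *)
Let minimal_independent k (g : 'I_k -> A) Q : (0 < Q)%N ->
  (forall a, exists j c, a *+ (Q ^ j) = lin g c) ->
  (forall k', generated k' -> (k <= k')%N) ->
  forall c, lin g c = 0 -> forall i, c i = 0.
Proof.
move=> Q0 gQ kmin c c0 i0; apply/eqP; apply: contrapT => /negP m0; set m := c i0 in m0.
case: k g gQ kmin c c0 i0 @m m0 => [|k] g gQ kmin c c0 i0 m m0; first by case: i0 {m m0} => [].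
suff : generated k by move/kmin; rewrite ltnn.
exists (Q * `|m|)%N, (g \o lift i0); split; first by rewrite muln_gt0 Q0 absz_gt0.
move=> a; have [j [d ad]] := gQ a.
have [u um] : exists u : int, `|m|%N%:Z = u * m.
  by exists (if 0 <= m then 1 else -1); case: ifP; lia.
pose t := u * (Q%:Z * (`|m| ^ j)%N%:Z).
exists j.+1, (fun i => (d (lift i0 i) * m - c (lift i0 i) * d i0) * t).
have -> : a *+ ((Q * `|m|) ^ j.+1) = a *+ (Q ^ j) *~ m *~ t.
  rewrite !pmulrn -!mulrzA; congr (_ *~ _); rewrite /t !expnMn !expnS.
  by rewrite !PoszM um; ring.
have -> : a *+ (Q ^ j) *~ m = lin g (fun i => d i * m - c i * d i0).
  by rewrite -linB ad linZ -(linZ g c) c0 mul0rz subr0.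
rewrite linZ /lin (bigD1_ord i0) //= -/m.
have -> : d i0 * m - m * d i0 = 0 by ring.
by rewrite mul0r mulr0z add0r.
Qed.

(** A family of minimal length among those that generate after inverting some Q
    is independent. So an element divisible by a large prime p has coordinates
    divisible by p, and only torsion is divisible by almost all primes. *)
Lemma interval_series_data : exists Q gs, @minimax_data A Q gs.
Proof.
have [S0 sS stS] := serS.
have [k0 [Q0 [g0 [Q00 h0]]]] : exists k, generated k.
  have [Q [gs [Q0 hgs]]] := series_gen (leqnn n).
  exists (size gs), Q, (fun i => nth 0 gs i); split=> // a.
  have [|j /zspan_lin[c e]] := hgs a; first by rewrite topS.
  by exists j, c.
have ex : exists k, `[< generated k >] by exists k0; apply/asboolP; exists Q0, g0.
case: (ex_minnP ex) => k /asboolP[Q [g [Qpos hg]]] kmin {k0 Q0 g0 Q00 h0 ex}.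
have ind := minimal_independent Qpos hg (fun k' h => kmin k' (asboolT h)).
have Qj j : (Q ^ j)%N%:Z != 0 :> int by rewrite -lt0n expn_gt0 Qpos.
exists Q, (codom g); split=> //.
- by move=> a; have [j [c e]] := hg a; exists j; rewrite e; apply: lin_zspan.
- move=> a P ha; have [j [c ac]] := hg a; exists j; rewrite ac.
  suff c0 i : c i = 0 by rewrite /lin big1 // => i _; rewrite c0 mulr0z.
  apply/eqP; apply: contrapT => /negP ci.
  have [p pb pp] := prime_above (maxn (maxn P Q) `|c i|).
  have cpQ : coprime p Q.
    rewrite prime_coprime //; apply/negP => /(dvdn_leq Qpos).
    by rewrite leqNgt (leq_trans _ pb) // ltnS -maxnA maxnCA leq_maxl.
  have [|b ab] := ha p pp; first by apply: leq_trans pb; rewrite ltnS -maxnA leq_maxl.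
  have [j' [d bd]] := hg b.
  have e : lin g (fun i => c i * (Q ^ j')%N%:Z - d i * (p%:Z * (Q ^ j)%N%:Z)) = 0.
    rewrite -linB -!linZ -ac -bd ab !pmulrn -!mulrzA -mulrzBr.
    by rewrite [X in _ *~ X](_ : _ = 0) ?mulr0z //; ring.
  have /eqP := ind _ e i; rewrite subr_eq0 => /eqP ei.
  have : (p %| `|c i| * Q ^ j')%N.
    by rewrite -[(Q ^ j')%N]absz_nat -abszM ei !abszM /= mulnCA dvdn_mulr.
  rewrite Gauss_dvdl ?coprimeXr // => /dvdn_leq.
  rewrite absz_gt0 => /(_ ci); rewrite leqNgt (leq_trans _ pb) //.
  by rewrite ltnS leq_maxr.
- move=> a m m0 am; have [j [c ac]] := hg a; exists j; rewrite ac.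
  have e : lin g (fun i => c i * m%:Z) = 0.
    by rewrite -linZ -ac -pmulrn -mulrnA mulnC mulrnA am mul0rn.
  rewrite /lin big1 // => i _; have /eqP := ind _ e i.
  by rewrite mulf_eq0 => /orP[/eqP -> //|/eqP m00]; case: m m0 m00 {am e}.
- apply: finite_torsion => p pp.
  by have := series_torsion pp (leqnn n); rewrite topS setTI.
Qed.

End Series.
End AbelianMinimax.

Section Factors.
Variables (T : Type) (G : group_law T) (N K : set T) (nN : normal_in G N K).

Lemma factor_proj x y (Kx : K x) (Ky : K y) (Kxy : K (gop G x y)) :
  gop (factor nN) (proj (coset G N) Kx) (proj (coset G N) Ky) =
  proj (coset G N) Kxy.
Proof.
apply: val_inj; case: nN => sN sK NK cN; rewrite /= image_opE.
by apply: (coset_compatible (And4 sN sK NK cN)); rewrite ?rep_proj //; apply: repK.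
Qed.

Lemma proj_eq x y (Kx : K x) (Ky : K y) :
  proj (coset G N) Kx = proj (coset G N) Ky <-> N (gop G (ginv G x) y).
Proof.
have [sN _ _ _] := nN.
rewrite -(cosetP _ _ sN); split=> [/(congr1 val) //|e].
exact: val_inj.
Qed.

Definition to_factor (H : set T) : set (coset G N @` K) :=
  [set A | exists x (Kx : K x), H x /\ A = proj (coset G N) Kx].

Lemma to_factor_subgroup H : subgroup G H -> H `<=` K ->
  subgroup (factor nN) (to_factor H).
Proof.
move=> [H1 HM HV] HK; have [_ [K1 KM KV] _ _] := nN.
have idE : proj (coset G N) K1 = gid (factor nN).
  apply: (@gop_inj _ (factor nN) (proj (coset G N) K1)).
  rewrite [RHS]gopr1 (factor_proj _ _ (KM _ _ K1 K1)); apply: val_inj => /=.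
  by rewrite gop1.
split.
- by exists (gid G), K1; rewrite -idE.
- move=> _ _ [x [Kx [Hx ->]]] [y [Ky [Hy ->]]].
  exists (gop G x y), (KM _ _ Kx Ky); split; first exact: HM.
  exact: factor_proj.
- move=> _ [x [Kx [Hx ->]]]; exists (ginv G x), (KV _ Kx); split; first exact: HV.
  symmetry; apply: ginv_uniq; rewrite (factor_proj _ _ (KM _ _ Kx (KV _ Kx))) -idE.
  by apply: val_inj => /=; rewrite goprV.
Qed.

Lemma to_factor_sub H H' : subgroup G H' -> N `<=` H' -> H `<=` K ->
  to_factor H `<=` to_factor H' -> H `<=` H'.
Proof.
move=> [_ HM HV] NH HK h x Hx; have Kx := HK x Hx.
have [|y [Ky [Hy /proj_eq]]] := h (proj (coset G N) Kx); first by exists x, Kx.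
move=> /NH/HV; rewrite ginvM ginv_inv => hN.
by rewrite -(ginvK_r G y x); apply: HM.
Qed.

Lemma to_factor_mono H H' : H `<=` H' -> to_factor H `<=` to_factor H'.
Proof. by move=> h A [x [Kx [Hx ->]]]; exists x, Kx; split=> //; apply: h. Qed.

Lemma factor_interval :
  min_condition (factor nN) \/ max_condition (factor nN) ->
  interval_min G N K \/ interval_max G N K.
Proof.
case=> c; [left|right] => F [H0 FH0] FP;
  (have [||_ [X FX <-] Xext] := c [set to_factor H | H in F];
  [ by exists (to_factor H0); exists H0
  | by move=> _ [H /FP[sH NH HK] <-]; apply: to_factor_subgroup |]);
  exists X => // H FH HX; apply/seteqP; split=> //;
  have [[sH NH HK] [sX NX XK]] := (FP H FH, FP X FX); apply: to_factor_sub => //;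
  by rewrite (Xext (to_factor H)); [|exists H|exact: to_factor_mono].
Qed.

End Factors.

(** ** Abelian sections of a minimax group *)

Section Section.
Variables (T : Type) (G : group_law T) (V : set T) (A : zmodType) (f : T -> A).
Hypotheses (sV : subgroup G V).
Hypothesis fM : forall x y, V x -> V y -> f (gop G x y) = (f x + f y)%R.
Hypothesis fS : forall a, exists2 x, V x & f x = a.

Let f1 : f (gid G) = 0%R.
Proof.
have [V1 _ _] := sV; apply: (addrI (f (gid G))).
by rewrite -fM // gop1 addr0.
Qed.

Let fV x : V x -> f (ginv G x) = (- f x)%R.
Proof.
have [_ _ VV] := sV => Vx; apply: (addrI (f x)).
by rewrite -fM ?goprV ?subrr //; apply: VV.
Qed.

Let im (H : set T) : set A := f @` (H `&` V).

Let im_sg H : subgroup G H -> subgroup (zlaw A) (im H).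
Proof.
move=> sH; have [H1 HM HV] := subgroup_cap sH sV; split.
- by exists (gid G).
- move=> _ _ [x Hx <-] [y Hy <-]; exists (gop G x y); first exact: HM.
  by rewrite fM //; [case: Hx | case: Hy].
- by move=> _ [x Hx <-]; exists (ginv G x); [exact: HV | rewrite fV //; case: Hx].
Qed.

Section Interval.
Variables N M : set T.
Hypothesis nN : normal_in G N M.

(** The chain conditions pass from M/N to im M / im N because H |-> lift H embeds
    the subgroups between im N and im M into those between N and M. *)
Let lift (H : set A) : set T :=
  [set t | exists s y, [/\ N s, M y, V y, H (f y) & t = gop G s y]].

Let lift_sg H : subgroup (zlaw A) H -> subgroup G (lift H).
Proof.
move=> [H0 HD HN]; have [[N1 NM NV] [M1 MM MV] NsM cN] := nN; have [V1 VM VV] := sV.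
split.
- by exists (gid G), (gid G); rewrite gop1 f1.
- move=> _ _ [s [y [Ns My Vy Hy ->]]] [s' [y' [Ns' My' Vy' Hy' ->]]].
  exists (gop G s (gop G (gop G y s') (ginv G y))), (gop G y y'); split.
  + by apply: NM => //; apply: cN.
  + exact: MM.
  + exact: VM.
  + by rewrite fM //; apply: HD.
  + by rewrite -!gopA ginvK_l.
- move=> _ [s [y [Ns My Vy Hy ->]]].
  exists (gop G (gop G (ginv G y) (ginv G s)) (ginv G (ginv G y))), (ginv G y); split.
  + by apply: cN; [apply: MV | apply: NV].
  + exact: MV.
  + exact: VV.
  + by rewrite fV //; apply: HN.
  + by rewrite ginvM ginv_inv -!gopA goprV gopr1.
Qed.

Let lift_mono H H' : H `<=` H' -> lift H `<=` lift H'.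
Proof.
move=> HH _ [s [y [Ns My Vy Hy ->]]]; exists s, y; split=> //; exact: HH.
Qed.

Let lift_sub H H' : subgroup (zlaw A) H' -> im N `<=` H' -> H `<=` im M ->
  lift H `<=` lift H' -> H `<=` H'.
Proof.
move=> [_ HD _] NH HM hl a Ha; have [x [Mx Vx] xa] := HM a Ha.
have [N1 _ _] : subgroup G N by case: nN.
have [|s [y [Ns My Vy Hy e]]] := hl x.
  by exists (gid G), x; rewrite gop1 xa.
have [_ VM VV] := sV.
have Vs : V s.
  have -> : s = gop G x (ginv G y) by rewrite e -gopA goprV gopr1.
  by apply: VM => //; apply: VV.
by rewrite -xa e fM //; apply: HD => //; apply: NH; exists s.
Qed.

Lemma interval_push : interval_min G N M \/ interval_max G N M ->
  interval_min (zlaw A) (im N) (im M) \/ interval_max (zlaw A) (im N) (im M).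
Proof.
have [sN [_ MM _] NsM _] := nN; have [N1 _ _] := sN.
have bounds H : subgroup (zlaw A) H -> [/\ subgroup G (lift H), N `<=` lift H & lift H `<=` M].
  move=> sH; split; first exact: lift_sg.
    move=> t Nt; exists t, (gid G); rewrite gopr1 f1; split=> //; first exact: NsM.
      by case: sV.
    by case: sH.
  by move=> _ [s [y [Ns My _ _ ->]]]; apply: MM => //; apply: NsM.
case=> c; [left|right] => F [H0 FH0] FP;
  (have [||_ [X FX <-] Xext] := c [set lift H | H in F];
  [by exists (lift H0); exists H0 | by move=> _ [H /FP[sH _ _] <-]; apply: bounds |]);
  exists X => // H FH HX; apply/seteqP; split=> //;
  have [[sH NH HM] [sX NX XM]] := (FP H FH, FP X FX); apply: lift_sub => //;
  by rewrite (Xext (lift H)); [|exists H|exact: lift_mono].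
Qed.

End Interval.

Lemma minimax_section : minimax G -> exists Q gs, @minimax_data A Q gs.
Proof.
move=> [n [S [nS [S0 Sn cS]]]].
apply: (@interval_series_data A n (fun i => im (S i))); last first.
  rewrite Sn; apply/seteqP; split=> // a _; have [x Vx <-] := fS a.
  by exists x.
have sS i : (i <= n)%N -> subgroup G (S i).
  case: n S nS S0 {Sn cS} => [|n] S nS S0; case: i => [|i] le.
  - by rewrite S0; split=> [|x y -> ->|x ->]; rewrite /= ?gop1 ?ginv1.
  - by [].
  - by have [] := nS ord0.
  - by have [] := nS (Ordinal le).
split.
- rewrite S0; apply/seteqP; split=> [_ [x [-> _] <-]|_ ->]; first exact: f1.
  by exists (gid G); rewrite ?f1 //; split=> //; case: sV.
- by move=> i /sS; apply: im_sg.
- move=> i lt; split; last exact: (interval_push (nS (Ordinal lt)) (factor_interval (cS (Ordinal lt)))).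
  have [_ _ SS _] := nS (Ordinal lt).
  by move=> _ [x [Sx Vx] <-]; exists x => //; split=> //; apply: SS.
Qed.

End Section.

(** ** Abelian laws as Z-modules *)

Definition zmod_of (T : Type) (G : group_law T) (cG : abelian_law G) : Type := T.

Section ZmodOf.
Variables (T : Type) (G : group_law T) (cG : abelian_law G).
HB.instance Definition _ := gen_eqMixin (zmod_of cG).
HB.instance Definition _ := gen_choiceMixin (zmod_of cG).
HB.instance Definition _ := GRing.isZmodule.Build (zmod_of cG)
  (@gopA _ G) cG (@gop1 _ G) (@gopV _ G).
End ZmodOf.

Lemma abelian_ideal_step (B : skewBrace) (M : set B) (sM : sub_skew_brace M)
    (cM : abelian_law (addg (sub_brace sM))) Q gs c :
  dedekind B -> @minimax_data (zmod_of cM) Q gs -> zs M c = setT ->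
  exists n, zs [set (0 : B)] n = setT.
Proof.
move=> dB dM hc; pose i : zmod_of cM -> B := sub_incl sM.
have rI : range i = M.
  apply/seteqP; split=> [_ [x _ <-]|x /(sub_inclP sM)[y yx]].
    by apply/(sub_inclP sM); exists x.
  by exists y.
have iD : {morph i : a b / (a + b)%R >-> a + b} := bhomD (sub_incl sM).
have iM : ideal (range i) by rewrite rI; exact: (dB _ sM).
by apply: (@abelian_step _ _ gs _ i c dM dB iD (@sub_incl_inj _ _ sM) iM); rewrite rI.
Qed.

(** * Soluble normal subgroups of finite index *)

Section Derived.
Variables (T : Type) (G : group_law T).
Implicit Types (H K M N X : set T).
Local Notation "x * y" := (gop G x y).

Definition gen X : set T := [set t | forall H, subgroup G H -> X `<=` H -> H t].

Lemma gen_subgroup X : subgroup G (gen X).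
Proof.
split=> [H [H1 _ _] _|x y gx gy H sH XH|x gx H sH XH].
- by [].
- by have [_ HM _] := sH; apply: HM; [apply: gx | apply: gy].
- by have [_ _ HV] := sH; apply: HV; apply: gx.
Qed.

Lemma sub_gen X : X `<=` gen X.
Proof. by move=> x Xx H _; apply. Qed.

Lemma gen_min X H : subgroup G H -> X `<=` H -> gen X `<=` H.
Proof. by move=> sH XH x; apply. Qed.

Definition comm x y := x * y * (ginv G x * ginv G y).

Definition derived H := gen [set t | exists x y, [/\ H x, H y & t = comm x y]].

Lemma derived_subgroup H : subgroup G (derived H).
Proof. exact: gen_subgroup. Qed.

Lemma comm_derived H x y : H x -> H y -> derived H (comm x y).
Proof. by move=> Hx Hy; apply: sub_gen; exists x, y. Qed.

Lemma derived_min H K : subgroup G K ->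
  (forall x y, H x -> H y -> K (comm x y)) -> derived H `<=` K.
Proof. by move=> sK h; apply: gen_min => // _ [x [y [Hx Hy ->]]]; apply: h. Qed.

Lemma derived_mono H K : H `<=` K -> derived H `<=` derived K.
Proof.
move=> HK; apply: derived_min; first exact: derived_subgroup.
by move=> x y /HK Kx /HK Ky; apply: comm_derived.
Qed.

Lemma derived_sub H : subgroup G H -> derived H `<=` H.
Proof.
move=> sH; have [_ HM HV] := sH; apply: derived_min => // x y Hx Hy.
by do 2 apply/HM => //; apply: HV.
Qed.

Definition dser H k := iter k derived H.

Lemma dser_subgroup H k : subgroup G H -> subgroup G (dser H k).
Proof. by case: k => // k _; apply: derived_subgroup. Qed.

Lemma dser_mono H K k : H `<=` K -> dser H k `<=` dser K k.
Proof. by move=> HK; elim: k => //= k; apply: derived_mono. Qed.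

Lemma dser_stable (s : T -> T) H k : {morph s : x y / x * y} ->
  (forall x, H x -> H (s x)) -> forall x, dser H k x -> dser H k (s x).
Proof.
move=> sM sH; elim: k => //= k IH.
apply: derived_min => [|x y Hx Hy].
  have [D1 DM DV] := derived_subgroup (dser H k); split=> /=.
  - by rewrite (morph_id sM).
  - by move=> x y Dx Dy; rewrite /= sM; apply: DM.
  - by move=> x Dx; rewrite /= (morph_inv _ sM); apply: DV.
by rewrite /= /comm !sM !(morph_inv _ sM); apply: comm_derived; apply: IH.
Qed.

Definition derived_soluble H := exists n, dser H n `<=` [set gid G].

Lemma soluble_derived H : soluble G H -> derived_soluble H.
Proof.
move=> [n [S [nS [S0 <- aS]]]]; exists n.
suff h k : (k <= n)%N -> dser (S n) k `<=` S (n - k)%N.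
  by have := h n (leqnn n); rewrite subnn S0.
elim: k => [|k IH] le; first by rewrite subn0.
apply: subset_trans (derived_mono (IH (ltnW le))) _.
have lt : (n - k.+1 < n)%N by lia.
have -> : (n - k = (n - k.+1).+1)%N by lia.
have nN := nS (Ordinal lt); have ab := aS (Ordinal lt); rewrite /= in nN ab.
have [sN [_ KM KV] _ _] := nN.
apply: derived_min => // x y Kx Ky.
have Kx' := KV _ Kx; have Ky' := KV _ Ky.
have := ab (proj _ Ky') (proj _ Kx').
rewrite (factor_proj _ _ _ (KM _ _ Ky' Kx')) (factor_proj _ _ _ (KM _ _ Kx' Ky')).
by move/(proj_eq nN); rewrite ginvM !ginv_inv /comm.
Qed.

Lemma normal_hom M : normal_in G M setT -> exists (U : Type) (L : group_law U) (p : T -> U),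
  {morph p : x y / gop G x y >-> gop L x y} /\
  (forall x y, p x = p y <-> M (ginv G x * y)).
Proof.
move=> nM; exists (coset G M @` setT), (factor nM).
exists (fun x => @proj _ _ setT (coset G M) x Logic.I); split.
  by move=> x y; rewrite (factor_proj _ _ _ Logic.I).
by move=> x y; apply: (proj_eq nM).
Qed.

Definition normal_join N M : set T := [set t | exists n m, [/\ N n, M m & t = n * m]].

Lemma normal_join_normal N M :
  normal_in G N setT -> normal_in G M setT -> normal_in G (normal_join N M) setT.
Proof.
move=> [[N1 NM NV] _ _ cN] [[M1 MM MV] _ _ cM]; split=> //.
- split.
  + by exists (gid G), (gid G); rewrite gop1.
  + move=> _ _ [n [m [Nn Mm ->]]] [n' [m' [Nn' Mm' ->]]].
    exists (n * (m * n' * ginv G m)), (m * m'); split; [|exact: MM|].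
      by apply: NM => //; apply: cN.
    by rewrite -!gopA ginvK_l.
  + move=> _ [n [m [Nn Mm ->]]].
    exists (ginv G m * ginv G n * ginv G (ginv G m)), (ginv G m); split.
    * by apply: cN => //; apply: NV.
    * exact: MV.
    * by rewrite ginvM -gopA gopV gopr1.
- move=> x _ _ [n [m [Nn Mm ->]]].
  exists (x * n * ginv G x), (x * m * ginv G x); split; [exact: cN|exact: cM|].
  by rewrite -!gopA ginvK_l.
Qed.

(** Modulo M, the derived series of N M is that of N. *)
Lemma normal_join_soluble N M : normal_in G N setT -> normal_in G M setT ->
  derived_soluble N -> derived_soluble M -> derived_soluble (normal_join N M).
Proof.
move=> nN nM [d hd] [e he]; have [U [L [p [pM pk]]]] := normal_hom nM.
have [sN _ _ _] := nN; have [sM _ _ _] := nM; have [M1 MM MV] := sM.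
pose X k : set T := [set t | exists2 n, dser N k n & p t = p n].
have sX k : subgroup G (X k).
  have [D1 DM DV] := dser_subgroup k sN; split.
  - by exists (gid G).
  - by move=> x y [n Dn xn] [m Dm ym]; exists (n * m); [exact: DM | rewrite !pM xn ym].
  - by move=> x [n Dn xn]; exists (ginv G n); [exact: DV | rewrite !(morph_inv _ pM) xn].
have hX k : dser (normal_join N M) k `<=` X k.
  elim: k => [|k IH].
    move=> _ [n [m [Nn Mm ->]]]; exists n => //; apply/pk.
    rewrite ginvM -gopA gopV gopr1; exact: MV.
  apply: subset_trans (derived_mono IH) _; apply: derived_min => // x y [n Dn xn] [m Dm ym].
  exists (comm n m); first exact: comm_derived.
  by rewrite /comm !pM !(morph_inv _ pM) xn ym.
exists (e + d)%N; rewrite /dser iterD.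
apply: subset_trans he; apply: dser_mono => t /hX[n /hd -> /pk].
by rewrite gopr1 => /MV; rewrite ginv_inv.
Qed.

Lemma finite_cover N : finite_set (coset G N @` setT) ->
  exists n, subgroup G N -> cover G N setT n.
Proof.
move=> fN; pose X := coset G N @` setT.
have fX : finite_set [set: X].
  have -> : [set: X] = (fun x : X => val x) @^-1` X.
    by apply/seteqP; split=> x _ //; exact: set_mem (valP x).
  by apply: finite_preimage fN => x z _ _; apply: val_inj.
pose F : finType := fin_of fX.
exists #|F| => sN; exists (fun k => if insub k is Some i then rep (enum_val (i : 'I_#|F|) : X) else gid G).
move=> y _; pose A : F := @proj _ _ setT (coset G N) y Logic.I.
exists (enum_rank A) => //; rewrite valK enum_rankK.
by apply/(cosetP _ _ sN); rewrite repE.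
Qed.

End Derived.

(** Among the soluble normal subgroups of finite index, one of minimal index
    absorbs its images under automorphisms. *)
Lemma soluble_radical T (G : group_law T) : soluble_by_finite G ->
  exists V n, [/\ normal_in G V setT, derived_soluble G V, cover G V setT n &
    forall s, {morph s : x y / gop G x y} -> bijective s ->
      forall x, V x -> V (s x)].
Proof.
move=> [N0 [nN0 /soluble_derived sN0 /finite_cover[n0 cN0]]].
pose P n := exists V, [/\ normal_in G V setT, derived_soluble G V & cover G V setT n].
have ex : exists n, `[< P n >].
  by exists n0; apply/asboolP; exists N0; split=> //; apply: cN0; case: nN0.
case: (ex_minnP ex) => n /asboolP[V [nV sV cV]] nmin {ex n0 N0 nN0 sN0 cN0}.
exists V, n; split=> // s sM [s' ss' s's] x Vx; apply: contrapT => nVs.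
have [[V1 VM VV] _ _ cjV] := nV.
pose M := s @` V.
have nM : normal_in G M setT.
  split=> //; first split.
  - by exists (gid G); rewrite ?(morph_id sM).
  - by move=> _ _ [a Va <-] [b Vb <-]; exists (gop G a b); rewrite ?sM //; apply: VM.
  - by move=> _ [a Va <-]; exists (ginv G a); rewrite ?(morph_inv _ sM) //; apply: VV.
  - move=> y _ _ [a Va <-]; exists (gop G (gop G (s' y) a) (ginv G (s' y))); first exact: cjV.
    by rewrite !sM (morph_inv _ sM) s's.
have solM : derived_soluble G M.
  have [d hd] := sV; exists d.
  have h k : dser G M k `<=` s @` dser G V k.
    elim: k => [|k IH] //=; apply: subset_trans (derived_mono IH) _.
    apply: derived_min.
      have [D1 DM DV] := derived_subgroup G (dser G V k); split.
      - by exists (gid G); rewrite ?(morph_id sM).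
      - by move=> _ _ [a Va <-] [b Vb <-]; exists (gop G a b); rewrite ?sM //; apply: DM.
      - by move=> _ [a Va <-]; exists (ginv G a); rewrite ?(morph_inv _ sM) //; apply: DV.
    move=> _ _ [a Da <-] [b Db <-]; exists (comm G a b); first exact: comm_derived.
    by rewrite /comm !sM !(morph_inv _ sM).
  by move=> t /h[a /hd -> <-]; rewrite /= (morph_id sM).
have nJ := normal_join_normal nV nM.
have [sJ _ _ _] := nJ; have [sVg _ _ _] := nV.
have VJ : V `<=` normal_join G V M.
  by move=> a Va; exists a, (gid G); rewrite gopr1; split=> //; case: nM => [[]].
have Jsx : normal_join G V M (s x).
  by exists (gid G), (s x); rewrite gop1; split=> //; exists x.
have [m nm cJ] := cover_merge (F := setT) sVg sJ VJ Logic.I Logic.I Jsx nVs cV.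
have Pm : P m by exists (normal_join G V M); split=> //; apply: normal_join_soluble.
by have := nmin m (asboolT Pm); rewrite nm ltnn.
Qed.

Section SolubleCase.
Variable B : skewBrace.
Hypotheses (dB : dedekind B) (mB : minimax (addg B)).

(** The abelian ideal V/J of B/J is a section of the minimax additive group. *)
Lemma derived_step (V J : set B) c : ideal V -> ideal J -> J `<=` V ->
  (forall x y, V x -> V y -> J (comm (addg B) x y)) -> zs V c = setT ->
  exists n, zs J n = setT.
Proof.
move=> iV iJ JV cV hc; have [C [f [sf k]]] := quot_ex iJ.
have iM := image_ideal sf iV; have sM := ideal_sub iM.
have cM : abelian_law (addg (sub_brace sM)).
  move=> x y; apply: (@sub_incl_inj _ _ sM); rewrite !(bhomD (sub_incl sM)).
  have /(sub_inclP sM)[a Va <-] : exists a', sub_incl sM a' = sub_incl sM x by exists x.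
  have /(sub_inclP sM)[b Vb <-] : exists a', sub_incl sM a' = sub_incl sM y by exists y.
  rewrite -!bhomD; apply/k.
  have [_ VN] : subgroup (addg B) V /\ (forall z, V z -> V (- z)).
    by have [[s _ _ _] _ _] := iV; split=> //; case: s.
  have := cV _ _ (VN _ Vb) (VN _ Va).
  by rewrite /comm !ginv_inv ginvM.
pose g x : zmod_of cM := if pselect ((f @` V) (f x)) is left h
  then exist _ (f x) (mem_set h) else 0%R.
have gE x : V x -> sub_incl sM (g x) = f x.
  by move=> Vx; rewrite /g; case: pselect => // -[]; exists x.
have [[[V0 VD VN] _ _ _] _ _] := iV.
have [|||Q [gs dM]] := @minimax_section _ (addg B) V (zmod_of cM) g _ _ _ mB.
- by split.
- move=> x y Vx Vy; apply: (@sub_incl_inj _ _ sM); rewrite gE; last exact: VD.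
  by rewrite (bhomD (sub_incl sM)) !gE // bhomD.
- move=> a; have /(sub_inclP sM)[x Vx xa] : exists a', sub_incl sM a' = sub_incl sM a by exists a.
  by exists x => //; apply: (@sub_incl_inj _ _ sM); rewrite gE.
have [|n hn] := abelian_ideal_step (c := c) (dedekind_surj sf dB) dM.
  apply/(zs_quot _ _ sf); rewrite -subTset -hc; apply: zs_sub => x Vx.
  by exists x.
by exists n; rewrite -(preim0 (ker0 k)); apply/(zs_quot _ _ sf).
Qed.

(** A normal soluble subgroup V that is invariant under the lambda maps is an
    ideal, and so are the terms of its derived series: B is reached from 0 by
    abelian steps and one finite step. *)
Lemma soluble_minimax_nilpotent : soluble_by_finite (addg B) ->
  exists n, zs [set (0 : B)] n = setT.
Proof.
move=> /soluble_radical[V [n [nV [d hd] cV sV]]].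
have Vl b x : V x -> V (lambda b x).
  by apply: sV; [exact: lambdaD | exists (lambda b^-1); [exact: lambdaK | exact: lambdaVK]].
have [sVg _ _ _] := nV.
have iV : ideal V by apply/dB/left_ideal_sub.
have iD k : ideal (dser (addg B) V k).
  apply/dB/left_ideal_sub; first exact: dser_subgroup.
  by move=> a x; apply: dser_stable; [exact: lambdaD | exact: Vl].
have iT : ideal [set: B] by [].
have [c hc] := finite_ideal_nilpotent (c := 0) dB iV iT (@subsetT _ _) cV (zs0T _ _).
have [m hm] : exists m, zs (dser (addg B) V d) m = setT.
  elim: (d) => [|k [m hm]]; first by exists c.
  apply: (derived_step (iD k) (iD k.+1) _ _ hm).
    by apply: derived_sub; apply: dser_subgroup.
  by move=> x y; apply: comm_derived.
exists m; rewrite -subTset -hm; exact: zs_sub.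
Qed.

End SolubleCase.

(** * Torsion-free centrally nilpotent Dedekind skew braces *)

Section TorsionFree.
Variable B : skewBrace.
Hypothesis dB : dedekind B.
Hypothesis Ztf : forall (z : B) n, (0 < n)%N -> center B z -> z *+ n = 0 -> z = 0.

Let Z := center B.
Let iZ : ideal Z. Proof. exact: center_ideal. Qed.

Let Ztf_int (z : B) (n : int) : n != 0%R -> Z z -> z *~ n = 0 -> z = 0.
Proof.
case: n => n n0 Zz /= zn; first by apply: Ztf zn => //; case: n n0.
apply: (@Ztf z n.+1) => //.
by rewrite -[LHS](ginv_inv (addg B)) zn ginv1.
Qed.

(** The commutator of u and b for one of the three actions. *)
Let cm i (u b : B) := gop (act_law B i) (ginv (act_law B i) b) (act i u b).

Let act_cm i u b : act i u b = gop (act_law B i) b (cm i u b).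
Proof. by rewrite ginvK_r. Qed.

Let cm_ideal i u b (J : set B) : ideal J -> cen J b -> J (cm i u b).
Proof.
move=> iJ cb; have [C [f [sf k]]] := quot_ex iJ; apply/(ker0 k).
have e : f (act i u b) = f b by symmetry; apply/k; exact: act_cen.
case: (i) e => e; rewrite /cm /act_law.
- by rewrite bhomD bhomN e gopV.
- by rewrite bhomD bhomN e gopV.
- by rewrite bhomM bhomV e gopV circ_id.
Qed.

Let cm0 i u b : cm i u b = 0 -> act i u b = b.
Proof.
by rewrite act_cm => ->; case: (i); [apply: gopr1 | apply: gopr1 | apply: circr0].
Qed.

(** Modulo the centre b is central, so commutators with b are additive in b. *)
Let isolated (b : B) n : cen Z b -> (0 < n)%N -> Z (b *+ n) -> Z b.
Proof.
move=> cb n0 Zn; apply/act_center => i u; apply: cm0.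
have Zt := cm_ideal i u iZ cb; set t := cm i u b in Zt *.
have Zbn : Z (gpow (act_law B i) b n).
  case: (i) => //=; have [[_ ZD _] _] := ideal_sub iZ.
  by rewrite -(ginvK_r (addg B) (b *+ n) (b ^+ n)); apply/ZD => //; apply: cen_pow.
have tn : gpow (act_law B i) t n = t *+ n.
  by apply: (gz_law i n (lambda_center t Zt)).
have comm_bt : gop (act_law B i) b t = gop (act_law B i) t b.
  by have [e1 e2 e3] := (centerE t).1 Zt b; case: (i); rewrite /= ?e1 // -e2 -e3.
apply: (Ztf n0 Zt); rewrite -tn.
have := (act_center _).1 Zbn i u.
have -> : act i u (gpow (act_law B i) b n) = gpow (act_law B i) (act i u b) n.
  exact: (morph_gz b n (act_morph i u)).
rewrite act_cm -/t gpow_mul // => e.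
have -> : gpow (act_law B i) t n = gid (act_law B i).
  by apply: (@gop_inj _ (act_law B i) (gpow (act_law B i) b n)); rewrite e gopr1.
by case: (i) => //=; apply: circ_id.
Qed.

(** For b in the second centre outside the centre, the ideal generated by 2b
    consists of the 2nb + 4mc with c = b * b, and it must contain 2c; so c = 0,
    and then the ideal generated by b is infinite cyclic and avoids the
    centre. *)
Lemma second_center b : cen Z b -> Z b.
Proof.
move=> cb; apply: contrapT => nZb.
have iso (n : int) : Z (b *~ n) -> n = 0%R.
  move=> h; apply: contrapT => /eqP n0; apply: nZb; apply: (@isolated b `|n|%N cb).
    by rewrite absz_gt0.
  have [[_ _ ZN] _] := ideal_sub iZ.
  by case: n h {n0} => n //= /ZN; rewrite ginv_inv.
have [[Z0 ZD ZN] _] := ideal_sub iZ.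
pose c := - b + lambda b b.
have Zc : Z c by apply: cen_lambda.
have lbb : lambda b b = b + c by rewrite ginvK_r.
have cc v : c + v = v + c by have [] := (centerE c).1 Zc v.
have Lc v : lambda v c = c by apply: lambda_center.
have cL v : lambda c v = v by case: Zc => [+ _ _]; apply.
clearbody c.
have c0 : c = 0.
  pose w := b *+ 2; have wb : w = b + b by rewrite /w /= gopr1.
  have lwb : lambda w b = b + c + c.
    have e : b ** b = c ** w by rewrite circE lbb gopA -wb circE cL cc.
    by rewrite -(cL (lambda w b)) -lambdaM -e lambdaM lbb lambdaD lbb Lc.
  have lw : - w + lambda w w = c *+ 4.
    have Zcc : Z (c *+ 2) by apply: subgroup_gpow Zc; case: iZ => [[]].
    have bcc : b + c *+ 2 = c *+ 2 + b by have [] := (centerE _).1 Zcc b.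
    have -> : lambda w w = (b + c *+ 2) *+ 2.
      have -> : b + c *+ 2 = b + c + c by rewrite /= gopr1 gopA.
      by rewrite {2}/w lambdaX lwb.
    by rewrite gpow_mul // -gpowM -/w ginvK_l.
  have iE : ideal (range (gz (addg B) (c *+ 4))).
    by apply/dB/cyclic_sub; rewrite lambdaX Lc.
  have iW : ideal (adj (range (gz (addg B) (c *+ 4))) w).
    by apply/dB/adj_sub => //; rewrite lw; exists 1%R; rewrite ?gz1.
  have [n [m _ e]] := cen_lambda b (sub_cen iW (mem_adj w iE)) iW.
  have lbw : - w + lambda b w = c *+ 2.
    by rewrite /w lambdaX lbb gpow_mul ?cc // ginvK_l.
  rewrite lbw in e.
  have wn : w *~ n = c *~ (2 - 4 * m)%R.
    have -> : (2 - 4 * m = 2%:Z + - (4%:Z * m))%R by [].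
    rewrite gzD gzN gzM gz_nat -[gz _ c 4%:Z]/(c *+ 4) e ginvM ginv_inv.
    by rewrite ginvK_r.
  have Zw : Z (w *~ n) by rewrite wn; apply: subgroup_gz Zc; case: iZ => [[]].
  have n0 : n = 0%R.
    have /iso : Z (b *~ (2%:Z * n)%R) by rewrite gzM.
    by move/eqP; rewrite mulf_eq0 => /orP[|/eqP].
  apply: (@Ztf_int c (2 - 4 * m)%R _ Zc); first by lia.
  by rewrite -wn n0 gz0.
have iS : ideal (range (gz (addg B) b)).
  by apply/dB/cyclic_sub; rewrite lbb c0 gopr1.
have Sb : range (gz (addg B) b) b by exists 1%R; rewrite ?gz1.
apply: nZb; apply/act_center => i u; apply: cm0.
have Zt := cm_ideal i u iZ cb; have [n _ e] := cm_ideal i u iS (sub_cen iS Sb).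
by rewrite -e in Zt *; rewrite (iso n Zt) gz0.
Qed.

Lemma torsion_free_center k : zs [set (0 : B)] k = setT -> center B = setT.
Proof.
suff h : zs [set (0 : B)] k `<=` center B by move=> e; rewrite -subTset -e.
elim: k => [|k IH] x; first by move=> ->; apply: center0.
by move=> cx; apply: second_center; apply: cen_sub cx.
Qed.

End TorsionFree.

Lemma center_trivial (B : skewBrace) : center B = setT -> trivial_brace B.
Proof.
by move=> e a b; have /centerE/(_ b)[] : center B a by rewrite e.
Qed.

(** * Independent integers and finite rank *)

Section Comaximal.
Local Open Scope ring_scope.

(** If a_i < b_i, cancelling V_i^(a_i) exhibits V_i as a divisor of a product of
    elements that are comaximal with it, hence as a unit. *)
Lemma comax_indep (D : idomainType) n (V : 'I_n -> D) :
  (forall i j, i != j -> exists u v, u * V i + v * V j = 1) ->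
  (forall i, V i != 0) -> (forall i, ~ exists w, w * V i = 1) ->
  forall a b : 'I_n -> nat,
    \prod_i V i ^+ a i = \prod_i V i ^+ b i -> forall i, a i = b i.
Proof.
move=> cm V0 Vu.
have cmM (x y z : D) : (exists u v, u * x + v * y = 1) ->
    (exists u v, u * x + v * z = 1) -> exists u v, u * x + v * (y * z) = 1.
  move=> [u [v e]] [u' [v' e']]; exists (u * (u' * x + v' * z) + v * y * u'), (v * v').
  by rewrite -[RHS](mulr1 1) -{1}e -e'; ring.
have cmX (x y : D) k : (exists u v, u * x + v * y = 1) -> exists u v, u * x + v * y ^+ k = 1.
  move=> h; elim: k => [|k IH]; first by exists 0, 1; rewrite expr0; ring.
  by rewrite exprS; apply: cmM.
have half (a b : 'I_n -> nat) :
    \prod_i V i ^+ a i = \prod_i V i ^+ b i -> forall i, ~ (a i < b i)%N.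
  move=> e i lt; apply: (Vu i).
  pose P c := \prod_(j < n | j != i) V j ^+ c j.
  have [u [v uv]] : exists u v, u * V i + v * P a = 1.
    apply: (big_ind (fun y => exists u v, u * V i + v * y = 1)).
    - by exists 0, 1; ring.
    - by move=> y z; apply: cmM.
    - by move=> j ji; apply/cmX/cm; rewrite eq_sym.
  have Pab : P a = V i ^+ (b i - a i) * P b.
    apply: (mulfI (expf_neq0 (a i) (V0 i))).
    move: e; rewrite (bigD1 i) // [in RHS](bigD1 i) //= => ->.
    by rewrite mulrA -exprD subnKC // ltnW.
  clearbody P; exists (u + v * (V i ^+ (b i - a i).-1 * P b)).
  rewrite -uv Pab -{2}(prednK (_ : 0 < b i - a i)%N) ?subn_gt0 // exprS.
  by move: ((b i - a i).-1) (P b) (V i) => k y z; ring.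
move=> a b e i; apply/eqP; rewrite eqn_leq; apply/andP; split; rewrite leqNgt; apply/negP.
  exact: half (esym e) i.
exact: half e i.
Qed.

(** Euclid's construction: each integer 1 + m_i n is 1 modulo the product of the
    previous ones. *)
Lemma int_family (n : int) k : n != 0 -> exists m : 'I_k -> int,
  forall a b : 'I_k -> nat,
    \prod_i (1 + m i * n) ^+ a i = \prod_i (1 + m i * n) ^+ b i -> a =1 b.
Proof.
move=> n0.
pose s := fix s k : seq int := if k is k'.+1 then
  rcons (s k') (1 + 2 * n * n * \prod_(y <- s k') y) else [::].
pose P j := \prod_(y <- s j) y.
have PS j : P j.+1 = P j * (1 + 2 * n * n * P j).
  by rewrite /P /= -cats1 big_cat big_seq1.
pose V j := 1 + 2 * n * P j * n.
have PP j : 0 < P j.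
  elim: j => [|j IH]; first by rewrite /P big_nil.
  have nn : 0 < n * n by nia.
  by rewrite PS; move: (P j) IH => y y0; nia.
have VV j : 1 < V j.
  have nn : 0 < n * n * P j by apply: mulr_gt0 => //; nia.
  by rewrite /V; move: (P j) nn => y; nia.
have VP i j : (i < j)%N -> exists c, P j = c * V i.
  elim: j => // j IH; rewrite ltnS leq_eqVlt => /orP[/eqP ->|/IH[c e]].
    by exists (P j); rewrite PS /V; ring.
  by exists (c * V j); rewrite PS {1}e /V; ring.
exists (fun i => 2 * n * P i); apply: (@comax_indep _ _ (fun i : 'I_k => V i)).
- move=> i j; wlog lt : i j / (i < j)%N => [WL ij|_].
    have [lt|gt|/val_inj e] := ltngtP i j; first exact: WL.
      by have [|u [v e]] := WL j i gt; [rewrite eq_sym | exists v, u; rewrite addrC].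
    by rewrite e eqxx in ij.
  have [c e] := VP i j lt.
  by exists (- (2 * n * c * n)), 1; rewrite [in V j]/V e; ring.
- by move=> i; have := VV i; lia.
- move=> i [w]; have := VV i; move: (V i) => v v1 e; have [w0|w0] := lerP w 0; nia.
Qed.

End Comaximal.

Section FiniteRank.
Local Open Scope ring_scope.

Lemma int_kernel s (c : 'I_s.+1 -> 'I_s -> int) : exists v : 'I_s.+1 -> int,
  (exists i, v i != 0) /\ forall k, \sum_i v i * c i k = 0.
Proof.
pose M : 'M[rat]_(s.+1, s) := \matrix_(i, k) (c i k)%:~R.
have : kermx M != 0.
  by rewrite kermx_eq0 /row_free neq_ltn ltnS rank_leq_col.
case/matrix0Pn => i [j]; set r := row i (kermx M) => rj.
have rM : r *m M = 0 by rewrite -row_mul mulmx_ker row0.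
have [q [a a0 e]] := rat_poly_scale (rVpoly r).
have vE k : r 0 k = a%:~R^-1 * (q`_k)%:~R.
  by rewrite -coef_map -coefZ -e coef_rVpoly_ord.
exists (fun k => q`_k); split.
  exists j; apply: contraNneq rj => qj.
  by have := vE j; rewrite mxE qj mulr0 => ->.
move=> k; apply/eqP; rewrite -(intr_eq0 rat) rmorph_sum /=.
have : a%:~R^-1 != 0 :> rat by rewrite invr_eq0 intr_eq0.
move/mulfI => /(_ _ 0) h; apply/eqP/h; rewrite mulr0 mulr_sumr.
have := congr1 (fun m : 'rV_s => m 0 k) rM; rewrite !mxE => e0; rewrite -[RHS]e0.
by apply: eq_bigr => l _; rewrite rmorphM mulrA -vE !mxE.
Qed.

(** Multiples of the u_i by powers of Q lie in the span of gs, where there are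
    more vectors than coordinates. *)
Lemma finite_rank (A : zmodType) Q gs : @minimax_data A Q gs ->
  forall u : 'I_(size gs).+1 -> A, exists w : 'I_(size gs).+1 -> int,
    (exists i, w i != 0) /\ \sum_i u i *~ w i = 0.
Proof.
move=> dA u.
have h i : exists jc : nat * ('I_(size gs) -> int),
    u i *+ (Q ^ jc.1) = lin (fun k => nth 0 gs k) jc.2.
  by have [j /zspan_lin[c e]] := data_gen dA (u i); exists (j, c).
have [f fE] := choice h.
have [v [[i vi] ve]] := int_kernel (fun i => (f i).2).
have Q0 := data_pos dA.
exists (fun i => (Q ^ (f i).1)%:Z * v i); split.
  by exists i; rewrite mulf_neq0 // eqz_nat -lt0n expn_gt0 Q0.
under eq_bigr do rewrite mulrzA -pmulrn fE linZ.
rewrite /lin exchange_big big1 // => k _; rewrite /= -mulrz_sumr.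
by under eq_bigr do rewrite mulrC; rewrite ve mulr0z.
Qed.

End FiniteRank.

(** * The ring of a skew brace with two abelian laws *)

Section Dorroh.
Variable C : skewBrace.
Hypotheses (cA : abelian_law (addg C)) (cM : abelian_law (circg C)).
Local Notation A := (zmod_of cA).
Local Open Scope ring_scope.

Definition star (x y : A) : A := (lambda (x : C) y : A) - y.

Lemma starE (x y : A) : (x : C) ** y = x + y + star x y :> A.
Proof. by rewrite circE /star -addrA [y + _]addrC subrK. Qed.

Fact starC : commutative star.
Proof.
move=> x y; apply: (addrI (x + y)); rewrite -starE cM starE.
by rewrite [y + x]addrC.
Qed.

Fact starDr (x : A) : {morph star x : y z / y + z}.
Proof. by move=> y z; rewrite /star [lambda _ _]lambdaD opprD addrACA. Qed.

Fact starDl (z : A) : {morph star^~ z : x y / x + y}.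
Proof. by move=> x y; rewrite starC starDr !(starC z). Qed.

Fact starA : associative star.
Proof.
move=> x y z; apply: (addrI (star x z + star y z)).
have e : star ((x : C) ** y : A) z = star x z + star y z + star (star x y) z.
  by rewrite starE !starDl.
rewrite -e /star [lambda (x ** y) z]lambdaM.
have -> : (lambda (x : C) (lambda (y : C) z) : A) - z = star x (star y z + z) + star y z.
  by rewrite /star subrK addrA subrK.
by rewrite starDr [LHS]addrC addrA.
Qed.

(** Adjoining a unit to the ring with product star; the elements 1 + x then
    multiply as x does for the circle law. *)
Definition dorroh of abelian_law (circg C) : Type := (int * A)%type.
Local Notation D := (dorroh cM).
HB.instance Definition _ := GRing.Zmodule.on D.

Definition dmul (s t : D) : D :=
  (s.1 * t.1, t.2 *~ s.1 + s.2 *~ t.1 + star s.2 t.2).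

Fact star_mulz (x y : A) n : star (x *~ n) y = star x y *~ n.
Proof. exact: zaddZ (starDl y) x n. Qed.

Fact star_mulzr (x y : A) n : star x (y *~ n) = star x y *~ n.
Proof. by rewrite ![star x _]starC star_mulz. Qed.

Fact dmulC : commutative dmul.
Proof.
by move=> s t; rewrite /dmul mulrC [_ + _ *~ t.1]addrC starC.
Qed.

Fact dmulDl : left_distributive dmul +%R.
Proof.
move=> s t u; rewrite /dmul; congr pair; rewrite /= ?mulrDl //.
rewrite starDl mulrzDr mulrzDl.
by rewrite [RHS]addrACA [X in _ = X + _]addrACA.
Qed.

Fact dmul1 : left_id (1%:Z, 0 : A) dmul.
Proof.
move=> [n x]; rewrite /dmul /= mul1r mulr1z mul0rz addr0; congr pair.
by rewrite -[X in star X](mulr0z x) star_mulz mulr0z addr0.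
Qed.

Fact dmulA : associative dmul.
Proof.
move=> s t u; rewrite /dmul; congr pair; rewrite /= ?mulrA //.
rewrite 2!starDr 2!starDl !star_mulz !star_mulzr starA.
move: (star s.2 t.2) (star _ u.2) (star _ u.2) (star _ u.2) => a b c d.
rewrite !mulrzDl -!mulrzA !addrA [LHS](ACl (1*2*4*6*3*5*7)) /=.
by rewrite [t.1 * s.1]mulrC [u.1 * s.1]mulrC.
Qed.

HB.instance Definition _ := GRing.Zmodule_isComNzRing.Build D
  dmulA dmulC dmul1 dmulDl isT.
End Dorroh.

(** A skew brace with two abelian laws is an ideal of a commutative ring, its
    circle law being the product of the elements 1 + x. *)
Record ring_model (C : skewBrace) (R : comNzRingType) (e : C -> R) : Prop :=
  RingModel {
    modD : forall x y, e (x + y) = (e x + e y)%R;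
    modM : forall x y, (1 + e (x ** y) = (1 + e x) * (1 + e y))%R;
    mod_inj : injective e;
    mod_absorb : forall x r, exists z, e z = (e x * r)%R }.

Lemma ring_model_ex (C : skewBrace) : abelian_law (addg C) -> abelian_law (circg C) ->
  exists (R : comNzRingType) (e : C -> R), ring_model e.
Proof.
move=> cA cM; exists (dorroh cA cM), (fun x : C => (0%Z, x : zmod_of cA)); split.
- by move=> x y; congr pair; rewrite addr0.
- move=> x y; congr pair; rewrite /= ?addr0 ?mulr1 //.
  rewrite !add0r !mulr1z starE; congr (_ + _)%R; exact: addrC.
- by move=> x y [].
- move=> x [n y]; exists ((x : zmod_of cA) *~ n + star (x : zmod_of cA) y)%R; congr pair.
    by rewrite /= mul0r.
  by rewrite /= mulr0z add0r.
Qed.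

Section Model.
Variables (C : skewBrace) (R : comNzRingType) (e : C -> R).
Hypothesis eR : ring_model e.
Local Open Scope ring_scope.

Lemma mod0 : e 0%SB = 0.
Proof. by apply: (addrI (e 0%SB)); rewrite -(modD eR) gop1 addr0. Qed.

Lemma mod_eq0 x : e x = 0 -> x = 0%SB.
Proof. by rewrite -mod0 => /(mod_inj eR). Qed.

Lemma modN x : e (- x)%SB = - e x.
Proof. by apply: (addrI (e x)); rewrite -(modD eR) goprV mod0 subrr. Qed.

Lemma mod_nat x n : e (x *+ n)%SB = e x *+ n.
Proof. by elim: n => [|n IH]; rewrite ?mod0 // mulrS -IH -(modD eR). Qed.

Lemma mod_gz x n : e (x *~ n)%SB = e x *~ n.
Proof. by case: n => n; rewrite /gz ?modN mod_nat. Qed.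

Lemma mod_inv x : (1 + e x) * (1 + e x^-1%SB) = 1.
Proof. by rewrite -(modM eR) goprV circ_id mod0 addr0. Qed.

Lemma mod_pow x n : 1 + e (x ^+ n)%SB = (1 + e x) ^+ n.
Proof. by elim: n => [|n IH]; rewrite /= ?circ_id ?mod0 ?addr0 // exprS -IH -(modM eR). Qed.

Lemma mod_lambda x y : e (lambda x y) = (1 + e x) * e y.
Proof.
have := modM eR x y; rewrite circE (modD eR) mulrDr mulr1 addrA.
by move/addrI.
Qed.

(** In the ring lambda_x is the multiplication by 1 + x, and the inverse of x for
    the circle law is its quasi-inverse. *)
Lemma mod_sub (P : set R) : P 0 -> (forall s t, P s -> P t -> P (s - t)) ->
  (forall s t, P s -> P t -> P (s * t)) ->
  (forall s t, P s -> (1 + s) * (1 + t) = 1 -> P t) ->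
  sub_skew_brace [set x | P (e x)].
Proof.
move=> P0 PB PM PV.
have PN s : P s -> P (- s) by rewrite -[- s]add0r; apply: PB.
have PD s t : P s -> P t -> P (s + t) by move=> Ps Pt; rewrite -[t]opprK; apply/PB/PN.
have sA : subgroup (addg C) [set x | P (e x)].
  split; first by rewrite /= mod0.
    by move=> x y /= Px Py; rewrite (modD eR); apply: PD.
  by move=> x /=; rewrite modN; apply: PN.
apply: sub_of_lambda => // x y /= Px Py; rewrite mod_lambda mulrDl mul1r.
  by apply/PD/PM.
by apply/PD/PM => //; apply: PV (mod_inv x).
Qed.

Hypothesis dC : dedekind C.

Lemma mod_ideal (P : set R) : P 0 -> (forall s t, P s -> P t -> P (s - t)) ->
  (forall s t, P s -> P t -> P (s * t)) ->
  (forall s t, P s -> (1 + s) * (1 + t) = 1 -> P t) ->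
  forall x y, P (e y) -> P (e x * e y).
Proof.
move=> P0 PB PM PV x y Py; have [_ L _] := dC (mod_sub P0 PB PM PV).
by have := PB _ _ (L x y Py) Py; rewrite mod_lambda mulrDl mul1r addrC addKr.
Qed.

End Model.

Lemma zmod_pow (T : Type) (G : group_law T) (cG : abelian_law G) (x : zmod_of cG) n :
  (x *+ n)%R = gpow G x n.
Proof. by elim: n => // n IH; rewrite mulrS IH. Qed.

(** ** Squares and cubes in Dedekind radical rings *)

Section Nil.
Variables (C : skewBrace) (R : comNzRingType) (e : C -> R).
Hypotheses (eR : ring_model e) (dC : dedekind C).
Local Open Scope ring_scope.

Lemma mod_unit x r : exists v, (1 - e x * r) * v = 1.
Proof.
have [z ze] := mod_absorb eR x (- r); exists (1 + e z^-1%SB).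
by have := mod_inv eR z; rewrite {1}ze mulrN.
Qed.

Lemma quasi_inverse (s t : R) : (1 + s) * (1 + t) = 1 -> t = - s + s ^+ 2 * (1 + t).
Proof.
move=> st; have st0 : s + t + s * t = 0.
  by apply: (addrI 1); rewrite addr0 -[RHS]st; ring.
apply/eqP; rewrite -subr_eq0 -[X in _ == X](mulr0 (1 - s)) -st0.
by apply/eqP; ring.
Qed.

(** The elements n x^2 + x^4 r form a sub-skew brace, hence an ideal, which
    therefore contains x^3; and x^3 = n x^2 + x^4 r says that y = x (1 - x r)
    multiplies x^2 by n. *)
Lemma square_rel x : exists (n : int) (y : C) (v : R),
  n%:~R * e x ^+ 2 = e y * e x ^+ 2 /\ e y * v = e x.
Proof.
pose P s := exists (n : int) r, s = n%:~R * e x ^+ 2 + e x ^+ 4 * r.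
have [y ye] := mod_absorb eR x (e x).
have [n [r E]] : P (e x * e y).
  apply: (mod_ideal eR dC).
  - by exists 0, 0; ring.
  - move=> _ _ [n [r ->]] [m [t ->]]; exists (n - m), (r - t); ring.
  - move=> _ _ [n [r ->]] [m [t ->]].
    exists 0, ((n%:~R + e x ^+ 2 * r) * (m%:~R + e x ^+ 2 * t)); ring.
  - move=> _ t [n [r ->]] /quasi_inverse ->.
    exists (- n), (- r + (n%:~R + e x ^+ 2 * r) ^+ 2 * (1 + t)); ring.
  - by exists 1, 0; rewrite ye; ring.
have [z ze] := mod_absorb eR x (1 - e x * r).
have [v ve] := mod_unit x r; exists n, z, v; rewrite ze; split; last by rewrite -mulrA ve mulr1.
move: E; rewrite ye => E.
transitivity (e x * (e x * e x) - e x ^+ 4 * r); last by ring.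
by rewrite E; ring.
Qed.

(** In the relation n x^2 = y x^2, either p divides n and y x^2 = 0, or n is
    invertible modulo p, so that 1 - b y kills x^2 for some integer b; but this
    element is a unit. *)
Lemma prime_cube p x : prime p -> (x *+ p)%SB = 0%SB -> e x ^+ 3 = 0.
Proof.
move=> pp px; have [n [y [v [E yv]]]] := square_rel x.
have cube : e x ^+ 3 = v * (e y * e x ^+ 2) by rewrite exprS -{1}yv; ring.
have pX : (p : int)%:~R * e x = 0 by rewrite -pmulrn mulr_natl -(mod_nat eR) px (mod0 eR).
have [/dvdzP[k nE]|ndv] := boolP (p %| n)%Z.
  by rewrite cube -E nE intrM -mulrA expr2 [_ * (e x * _)]mulrA pX mul0r !mulr0.
have cop : coprimez p n by rewrite coprimezE prime_coprime.
have [[a b] /= ab] := coprimezP _ _ cop.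
have abR : a%:~R * (p : int)%:~R + b%:~R * n%:~R = 1 :> R.
  by rewrite -!rmorphM -rmorphD /= ab.
have sq : e x ^+ 2 = b%:~R * (e y * e x ^+ 2).
  rewrite -E -[LHS]mul1r -{1}abR mulrDl -!mulrA expr2 [(p : int)%:~R * _]mulrA.
  by rewrite pX mul0r mulr0 add0r.
have [w we] := mod_unit y b%:~R.
have : (1 - e y * b%:~R) * e x ^+ 2 = 0 by rewrite mulrBl mul1r {1}sq; ring.
move=> /(congr1 (fun t => t * (w * e x))); rewrite mul0r => <-.
by rewrite -[LHS]mul1r -{1}we; ring.
Qed.

Hypothesis cM : abelian_law (circg C).
Variables (Q : nat) (gs : seq (zmod_of cM)).
Hypothesis dM : minimax_data Q gs.

Lemma circ_rank (u : 'I_(size gs).+1 -> C) : exists a b : 'I_(size gs).+1 -> nat,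
  ~ a =1 b /\ \prod_i (1 + e (u i)) ^+ a i = \prod_i (1 + e (u i)) ^+ b i.
Proof.
pose phi (x : zmod_of cM) : R := 1 + e x.
have phi0 : phi 0 = 1.
  by rewrite -[LHS]/(1 + e (gid (circg C))) circ_id (mod0 eR) addr0.
have phiD : {morph phi : x y / x + y >-> x * y} := modM eR.
have phiX x n : phi (x *+ n) = phi x ^+ n.
  by elim: n => [|n IH]; rewrite ?phi0 // mulrS phiD IH exprS.
have [w [[i wi] we]] := finite_rank dM (u : 'I_(size gs).+1 -> zmod_of cM).
exists (fun i => if w i is Posz n then n else 0%N),
  (fun i => if w i is Negz n then n.+1 else 0%N); split.
  by move/(_ i); case: (w i) wi => n //= n0 nE; rewrite nE in n0.
have prodE (a : 'I_(size gs).+1 -> nat) :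
    \prod_i (1 + e (u i)) ^+ a i = phi (\sum_i (u i : zmod_of cM) *+ a i).
  by rewrite (big_morph phi phiD phi0); apply: eq_bigr => k _; rewrite phiX.
rewrite !prodE; congr (phi _); apply/eqP; rewrite -subr_eq0 -sumrB -[X in _ == X]we.
apply/eqP/eq_bigr => k _; case: (w k) => n; first by rewrite mulr0n subr0.
by rewrite mulr0n sub0r NegzE mulrNz.
Qed.

(** If n x^2 = y x^2, then 1 + m y multiplies x^2 by the integer 1 + m n, and
    for n != 0 such integers form arbitrarily large independent families. *)
Lemma cube_zero x : (forall k : int, k != 0 -> e x ^+ 2 *~ k = 0 -> e x ^+ 2 = 0) ->
  e x ^+ 3 = 0.
Proof.
move=> tf; have [n [y [v [E yv]]]] := square_rel x.
have cube : e x ^+ 3 = v * (e y * e x ^+ 2) by rewrite exprS -{1}yv; ring.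
have [n0|n0] := eqVneq n 0; first by rewrite cube -E n0 mul0r mulr0.
suff -> : e x ^+ 3 = e x * 0 by rewrite mulr0.
rewrite exprS; congr (_ * _).
have [m mI] := int_family (size gs).+1 n0.
have [a [b [ab prodE]]] := circ_rank (fun i => (y *~ m i)%SB).
have act (c : 'I_(size gs).+1 -> nat) :
    (\prod_i (1 + e (y *~ m i)%SB) ^+ c i) * e x ^+ 2 =
    (\prod_i (1 + m i * n) ^+ c i)%:~R * e x ^+ 2.
  rewrite rmorph_prod /=.
  apply: (big_ind2 (fun s t : R => s * e x ^+ 2 = t * e x ^+ 2)) => //.
    by move=> s s' t t' h h'; rewrite -mulrA h' mulrCA h mulrCA mulrA.
  move=> i _; rewrite rmorphXn /=; elim: (c i) => [|k IH] //.
  rewrite exprS -mulrA IH [in RHS]exprS mulrCA -[RHS]mulrA [RHS]mulrCA; congr (_ * _).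
  rewrite (mod_gz eR) rmorphD rmorph1 rmorphM /= !mulrDl -mulrA E.
  by rewrite -[e y *~ _]mulrzr [e y * _%:~R]mulrC -mulrA.
apply: (tf (\prod_i (1 + m i * n) ^+ a i - \prod_i (1 + m i * n) ^+ b i)).
  by rewrite subr_eq0; apply: contra_notN ab => /eqP /mI.
by rewrite -mulrzl rmorphB /= mulrBl -!act prodE subrr.
Qed.

(** All cubes vanish, then all squares, and finally all products by
    polarisation. *)
Lemma torsion_free_trivial : torsion_free (addg C) -> trivial_brace C.
Proof.
move=> tfC.
have tf x r (k : int) : k != 0 -> (e x * r) *~ k = 0 -> e x * r = 0.
  have [z <-] := mod_absorb eR x r; rewrite -(mod_gz eR) => k0 /(mod_eq0 eR) zk.
  have {}zk : (z *+ `|k|)%SB = 0%SB.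
    by case: k k0 zk => // n _ /(congr1 (ginv (addg C))); rewrite ginv_inv ginv1.
  by rewrite (tfC z `|k|%N) ?(mod0 eR) // absz_gt0.
have cube x : e x ^+ 3 = 0.
  by apply: cube_zero => k k0; rewrite expr2; apply: tf.
have sq x : e x ^+ 2 = 0.
  have diff0 s t : (exists k, s - t = e x ^+ 3 * k) -> s = t.
    by move=> [k E]; apply/eqP; rewrite -subr_eq0 E cube mul0r.
  (* The sums of multiples of 2x and 4x^2 form an ideal, which has to contain
     2x^2. *)
  pose P s := exists n m : int, s = 2 * n%:~R * e x + 4 * m%:~R * e x ^+ 2.
  have [n [m E]] : P (e x * e (x + x)%SB).
    apply: (mod_ideal eR dC).
    - by exists 0, 0; ring.
    - move=> _ _ [n [m ->]] [n' [m' ->]]; exists (n - n'), (m - m'); ring.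
    - move=> _ _ [n [m ->]] [n' [m' ->]]; exists 0, (n * n'); apply: diff0.
      exists (8 * n%:~R * m'%:~R + 8 * m%:~R * n'%:~R + 16 * m%:~R * m'%:~R * e x).
      by ring.
    - move=> _ t [n [m ->]] /quasi_inverse tE; exists (- n), (n ^+ 2 - m).
      apply: diff0; rewrite {1}tE {1}tE.
      pose d := 2 * n%:~R + 4 * m%:~R * e x.
      exists (16 * n%:~R * m%:~R + 16 * m%:~R ^+ 2 * e x - d ^+ 3 + e x * d ^+ 4 * (1 + t)).
      by rewrite /d; ring.
    - by exists 1, 0; rewrite (modD eR); ring.
  have E' : e x ^+ 2 * (2 - 4 * m%:~R) = 2 * n%:~R * e x.
    rewrite (modD eR) in E.
    rewrite (_ : _ * _ = e x * (e x + e x) - 4 * m%:~R * e x ^+ 2); last by ring.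
    by rewrite E; ring.
  rewrite expr2; have [n0|n0] := eqVneq n 0.
    apply: (tf _ _ (2 - 4 * m)); first by lia.
    rewrite -mulrzr rmorphB rmorphM /= -expr2 E' n0; ring.
  apply: (tf _ _ (2 * n)); first by lia.
  rewrite -mulrzr; apply: diff0; rewrite subr0; exists (2 - 4 * m%:~R).
  transitivity (2 * n%:~R * e x * e x); first by ring.
  by rewrite -E'; ring.
move=> x y; apply: (mod_inj eR); apply: (addrI 1).
rewrite (modM eR) (modD eR) (_ : _ * _ = 1 + (e x + e y) + e x * e y); last by ring.
rewrite (tf x (e y) 2) ?addr0 // -mulrzr.
rewrite (_ : e x * e y * 2%:~R = e (x + y)%SB ^+ 2 - e x ^+ 2 - e y ^+ 2); last by rewrite (modD eR); ring.
by rewrite !sq !subr0.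
Qed.

Lemma pow_square_zero z k : e z ^+ 2 = 0 -> e (z ^+ k)%SB = e z *+ k.
Proof.
move=> zz; apply: (addrI 1); rewrite (mod_pow eR).
elim: k => [|k IH]; first by rewrite addr0.
rewrite exprS IH mulrDl mul1r mulrDr mulr1 mulrnAr -expr2 zz mul0rn addr0.
by rewrite mulrS -addrA [_ + e z]addrC.
Qed.

(** For z^2 = 0 the circle powers of z are its multiples, so the bound on the
    torsion of the circle group applies to z; and x or x^2 is such a z. *)
Lemma coprime_torsion p (x : C) : prime p -> coprime p Q -> (x *+ p)%SB = 0%SB -> x = 0%SB.
Proof.
move=> pp pQ.
have square z : e z ^+ 2 = 0 -> (z *+ p)%SB = 0%SB -> e z = 0.
  move=> zz pz; have zp : (z ^+ p)%SB = gid (circg C).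
    by rewrite circ_id; apply: (mod_eq0 eR); rewrite pow_square_zero // -(mod_nat eR) pz (mod0 eR).
  have [|j zQ] := data_tors dM (a := z) (prime_gt0 pp); first by rewrite zmod_pow.
  rewrite zmod_pow in zQ.
  by rewrite (gpow_gcd zp zQ) ?coprimeXr // circ_id (mod0 eR).
move=> px; have cube := prime_cube pp px; apply: (mod_eq0 eR).
have [z ze] := mod_absorb eR x (e x); apply: (square x) => //.
rewrite expr2 -ze; apply: (square z).
  by rewrite ze; transitivity (e x ^+ 3 * e x); [ring | rewrite cube mul0r].
by apply: (mod_inj eR); rewrite (mod_nat eR) ze -mulrnAl -(mod_nat eR) px (mod0 eR) mul0r.
Qed.

(** Since x^3 = 0 and p x = 0, the p-th power of 1 + x is 1 + 'C(p, 2) x^2, where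
    the binomial coefficient vanishes modulo p unless p = 2; one more p-th power
    gives 1 in all cases. *)
Lemma prime_exponent p (x : C) : prime p -> (x *+ p)%SB = 0%SB -> (x ^+ (p * p))%SB = 0%SB.
Proof.
move=> pp px; have cube := prime_cube pp px.
have pX : e x *+ p = 0 by rewrite -(mod_nat eR) px (mod0 eR).
have step (N c X : R) : X ^+ 3 = 0 ->
    (1 + (N * X + c * X ^+ 2)) * (1 + X) = 1 + ((1 + N) * X + (c + N) * X ^+ 2).
  move=> X3; apply: subr0_eq; transitivity (c * X ^+ 3); first by ring.
  by rewrite X3 mulr0.
have powE n : e (x ^+ n)%SB = n%:R * e x + 'C(n, 2)%:R * e x ^+ 2.
  apply: (addrI 1); rewrite (mod_pow eR).
  elim: n => [|n IH]; first by rewrite bin0n !mul0r !addr0.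
  by rewrite exprSr IH (step _ _ _ cube) binS bin1 natrD mulrS.
have pE : e (x ^+ p)%SB = 'C(p, 2)%:R * e x ^+ 2.
  by rewrite powE mulr_natl pX add0r.
apply: (mod_eq0 eR); rewrite (gpowM (circg C) x p p).
rewrite (pow_square_zero _ (z := (x ^+ p)%SB)) pE.
  by rewrite -mulrnAr expr2 -mulrnAl pX mul0r mulr0.
transitivity ('C(p, 2)%:R ^+ 2 * e x * e x ^+ 3); last by rewrite cube mulr0.
by move: ('C(p, 2)%:R) (e x) => c X; ring.
Qed.

End Nil.

(** * Abelian circle group *)

(** The circle group of C is a section of G; a partial homomorphism can be
    composed with quotient maps. *)
Definition circ_section T (G : group_law T) (C : skewBrace) : Prop :=
  exists (V : set T) (f : T -> C), [/\ subgroup G V,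
    (forall x y, V x -> V y -> f (gop G x y) = f x ** f y)
    & forall c, exists2 x, V x & f x = c].

Lemma circ_section_data T (G : group_law T) (C : skewBrace)
    (cM : abelian_law (circg C)) :
  minimax G -> circ_section G C -> exists Q gs, @minimax_data (zmod_of cM) Q gs.
Proof. by move=> mG [V [f [sV fV fs]]]; apply: (@minimax_section _ G V (zmod_of cM) f). Qed.

Lemma circ_section_surj T (G : group_law T) (C D : skewBrace) (f : bhom C D) :
  surj f -> circ_section G C -> circ_section G D.
Proof.
move=> sf [V [g [sV gV gs]]]; exists V, (f \o g); split=> //=.
  by move=> x y Vx Vy; rewrite gV // bhomM.
move=> d; have [c <-] := sf d; have [x Vx <-] := gs c.
by exists x.
Qed.

Lemma surj_abelian (C D : skewBrace) (f : bhom C D) : surj f ->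
  (abelian_law (addg C) -> abelian_law (addg D)) /\
  (abelian_law (circg C) -> abelian_law (circg D)).
Proof.
move=> sf; split=> ab x y; have [a <-] := sf x; have [b <-] := sf y.
  by rewrite -!bhomD ab.
by rewrite -!bhomM ab.
Qed.

Section Extension.
Local Open Scope ring_scope.

Lemma zspan_lift (A D : zmodType) (g : A -> D) (gs : seq D) :
  {morph g : x y / x + y} -> (forall d, exists x, g x = d) ->
  exists hs : seq A, forall a, zspan gs (g a) -> exists2 s, zspan hs s & g (a - s) = 0.
Proof.
move=> gD gs_onto; have [h hE] := choice gs_onto.
have gN x : g (- x) = - g x by apply: (addrI (g x)); rewrite -gD !subrr (zadd0 gD).
exists (map h gs); elim: gs => [|d gs IH] a /=.
  by move=> ga; exists 0; rewrite ?subr0.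
move=> [n [s [ss E]]].
have [|t ts gt] := IH (a - h d *~ n).
  by rewrite gD gN (zaddZ gD) hE E addrAC subrr add0r.
exists (h d *~ n + t); first by exists n, t.
by rewrite opprD addrA.
Qed.

(** Modulo the kernel of g an element is controlled by a power of Q2, and what
    remains in the kernel is killed by a power of Q1. *)
Lemma minimax_data_extension (A D : zmodType) (g : A -> D) Q1 Q2 (gs : seq D) :
  {morph g : x y / x + y} -> (forall d, exists x, g x = d) ->
  minimax_data Q2 gs -> (0 < Q1)%N ->
  (forall a, g a = 0 -> exists2 k, (0 < k)%N & a *+ k = 0) ->
  (forall (a : A) k, (0 < k)%N -> a *+ k = 0 -> exists j, a *+ (Q1 ^ j) = 0) ->
  (forall p, prime p -> finite_set [set a : A | a *+ p = 0]) ->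
  exists Q hs, @minimax_data A Q hs.
Proof.
move=> gD gs_onto dD Q10 gT tors fin.
have [hs hsE] := zspan_lift gs gD gs_onto.
have Q20 := data_pos dD.
have gX := zaddX gD.
have split i j : exists k, ((Q1 * Q2) ^ (i + j) = k * (Q2 ^ i * Q1 ^ j))%N.
  by apply/dvdnP; rewrite expnMn mulnC dvdn_mul // dvdn_exp2l ?leq_addr ?leq_addl.
have kill (a : A) i j : a *+ (Q2 ^ i) *+ (Q1 ^ j) = 0 -> a *+ ((Q1 * Q2) ^ (i + j)) = 0.
  by have [k ->] := split i j => h; rewrite mulnC !mulrnA h mul0rn.
have killT (a : A) i : g (a *+ (Q2 ^ i)) = 0 -> exists j, a *+ ((Q1 * Q2) ^ (i + j)) = 0.
  by move=> /gT[k k0 ak]; have [j aj] := tors _ k k0 ak; exists j; apply: kill.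
exists (Q1 * Q2)%N, hs; split.
- by rewrite muln_gt0 Q10.
- move=> a; have [i] := data_gen dD (g a); rewrite -gX => /hsE[s ss /gT[k k0 sk]].
  have [j] := tors _ k k0 sk; rewrite mulrnBl => /subr0_eq E.
  by exists (i + j)%N; have [m ->] := split i j; rewrite mulnC !mulrnA E -!mulrnA pmulrn; apply: zspanZ.
- move=> a P h; have [|i] := data_sep dD (a := g a) (P := P).
    by move=> p pp Pp; have [b ->] := h p pp Pp; exists (g b); rewrite gX.
  by rewrite -gX => /killT[j aj]; exists (i + j)%N.
- move=> a k k0 ak; have [j aj] := tors _ k k0 ak; exists (0 + j)%N.
  by apply: kill; rewrite expn0 mulr1n.
- exact: finite_torsion.
Qed.

End Extension.

Section BiAbelian.
Variables (T : Type) (G : group_law T) (C : skewBrace).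
Hypotheses (mG : minimax G) (sG : circ_section G C) (dC : dedekind C).
Hypotheses (cA : abelian_law (addg C)) (cM : abelian_law (circg C)).

Let torsion : set C := [set x | exists2 n, (0 < n)%N & x *+ n = 0].

Lemma torsion_ideal : ideal torsion.
Proof.
apply/dC/left_ideal_sub; last first.
  by move=> a x [n n0 xn]; exists n => //; rewrite -lambdaX xn lambda0.
split; first by exists 1%N; rewrite ?gpow1.
  move=> x y [n n0 xn] [m m0 ym]; exists (n * m)%N; first by rewrite muln_gt0 n0.
  by rewrite gpow_mul // gpowM xn mulnC gpowM ym !gpow_id gop1.
by move=> x [n n0 xn]; exists n; rewrite // gpow_inv xn ginv1.
Qed.

(** Modulo its torsion ideal C is trivial, so that there the additive group is a
    section of G as well. On the torsion ideal the elements of prime order are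
    nilpotent, which bounds them by torsion elements of the circle group. *)
Lemma bi_abelian_data : exists Q gs, @minimax_data (zmod_of cA) Q gs.
Proof.
have [R [e eR]] := ring_model_ex cA cM.
have [Q1 [gs1 d1]] := circ_section_data cM mG sG.
have [D [f [sf kf]]] := quot_ex torsion_ideal.
have [aA aM] := surj_abelian sf; have dD := dedekind_surj sf dC.
have [R' [e' eR']] := ring_model_ex (aA cA) (aM cM).
have [Q2 [gs2 d2]] := circ_section_data (aM cM) mG (circ_section_surj sf sG).
have tD : trivial_brace D.
  apply: (torsion_free_trivial eR' dD d2) => y n n0; have [x <-] := sf y.
  rewrite -/(gpow (addg D) _ n) -(bhomX f) => /(ker0 kf)[m m0 xm].
  by apply/(ker0 kf); exists (n * m)%N; rewrite ?muln_gt0 ?n0 // gpowM.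
have Q10 := data_pos d1.
apply: (@minimax_data_extension (zmod_of cA) (zmod_of (aM cM)) f Q1 Q2 gs2) => //.
- by move=> x y; rewrite [LHS](bhomD f) tD.
- move=> a fa; have /(ker0 kf)[n n0 an] : f a = 0 by rewrite -circ_id.
  by exists n => //; rewrite zmod_pow.
- move=> a k k0; rewrite zmod_pow => ak.
  have [b [j [b0 bQ /dvdnP[m E]]]] := coprime_split k0 Q10.
  exists j; rewrite zmod_pow.
  have : (a : C) *+ (Q1 ^ j) *+ b = 0 by rewrite -gpowM mulnC E mulnC gpowM ak gpow_id.
  move: (_ *+ _ ^ _) => y {E}.
  elim/ltn_ind: b b0 bQ => b IH b0 bQ yb.
  have [b1|b1] := leqP b 1.
    by rewrite (_ : b = 1%N) in yb; [rewrite /= gopr1 in yb | apply/eqP; rewrite eqn_leq b1].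
  have pp := pdiv_prime b1; have /dvdnP[c bE] := pdiv_dvd b.
  have [c0 cb] : (0 < c)%N /\ (c < b)%N.
    have c0 : (0 < c)%N by move: b0; rewrite {1}bE muln_gt0 => /andP[].
    by split=> //; rewrite [X in (_ < X)%N]bE ltn_Pmulr // prime_gt1.
  move: bQ; rewrite bE coprimeMl => /andP[cQ pQ].
  apply: (IH c) => //; apply: (coprime_torsion eR dC d1 pp pQ).
  by rewrite -gpowM -bE.
- move=> p pp; have := data_fin d1 (m := (p * p)%N); rewrite muln_gt0 prime_gt0 // => /(_ isT).
  apply: sub_finite_set => a /=; rewrite !zmod_pow => pa.
  by rewrite (prime_exponent eR dC pp pa) -circ_id.
Qed.

End BiAbelian.

Section Ito.
Variable B : skewBrace.
Hypothesis cM : abelian_law (circg B).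

Definition defect (a b : B) : B := lambda a b + - b.

Let N : set B := gen (addg B) [set x | exists a b, x = defect a b].

Let N_defect a b : N (defect a b).
Proof. by apply: sub_gen; exists a, b. Qed.

Lemma lambda_defect c a b : lambda c (defect a b) = defect a (lambda c b).
Proof. by rewrite /defect lambdaD lambdaN -!lambdaM cM. Qed.

(** The skew brace form of the conjugation step in Ito's theorem on products
    of two abelian groups. *)
Lemma conj_defect c a b :
  c + lambda c (defect a b) + - c = defect (a ** c + - c) b.
Proof.
have circN : b ** (- c) = b + - (b ** c) + b.
  have := circ_add b c (- c); rewrite goprV circr0 => E.
  by rewrite [X in _ = _ + X]E !greduce.
have e : (a ** c + - c) ** b = a ** c ** b + - (c ** b) + b.
  by rewrite cM circ_add circN (cM b (a ** c)) (cM b c) !greduce.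
rewrite /defect lambdaD lambdaN -lambdaM (cM c a).
by rewrite [lambda (_ + _) b]/lambda e /lambda !greduce.
Qed.

(** The automorphisms lambda_c and y |-> d + lambda_d y - d commute on the
    generators, so that their commutator, the conjugation by an element of the
    shape defect, fixes them. *)
Lemma defect_comm a b c d : defect c d + defect a b = defect a b + defect c d.
Proof.
have key x y z : lambda x y + defect a z + - lambda x y = y + defect a z + - y.
  have hom t : lambda x (y + lambda y t + - y) =
      lambda x y + lambda x (lambda y t) + - lambda x y.
    by rewrite !lambdaD lambdaN.
  pose z' := lambda y^-1 (lambda x^-1 z).
  have zE : lambda x (lambda y (defect a z')) = defect a z.
    by rewrite !lambda_defect /z' !lambdaVK.
  have zE' : lambda y (lambda x (defect a z')) = defect a z.
    by rewrite -lambdaM (cM y x) lambdaM zE.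
  rewrite -{1}zE -hom -zE' conj_defect.
  by rewrite [lambda x (defect a _)]lambda_defect conj_defect lambda_defect.
have := key c (- d) b; rewrite [defect c d]/defect lambdaN !ginv_inv.
move: (defect a b) (lambda c d) => D v E.
transitivity (v + (- d + D + d) + - d); first by rewrite !greduce.
by rewrite -E !greduce.
Qed.

Lemma defect_gen_abelian x y : N x -> N y -> x + y = y + x.
Proof.
have centr (S : set B) : subgroup (addg B) [set t | forall s, S s -> t + s = s + t].
  split=> [s _|t u ct cu s Ss|t ct s Ss] /=; first by rewrite gop1 gopr1.
    by rewrite -gopA cu // gopA ct // gopA.
  apply: (@gop_inj _ (addg B) t); rewrite !greduce.
  by rewrite gopA ct // !greduce.
have NX : N `<=` [set t | forall s, (exists a b, s = defect a b) -> t + s = s + t].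
  apply: gen_min => [|_ [c [d ->]] _ [a [b ->]]]; last exact: defect_comm.
  exact: (centr [set s | exists a b, s = defect a b]).
move=> Nx; move: y; have : N `<=` [set t | forall s, N s -> t + s = s + t].
  apply: gen_min => [|_ [c [d ->]] s Ns]; first exact: centr.
  by symmetry; apply: NX Ns _ _; exists c, d.
by apply.
Qed.

Lemma defect_sub : sub_skew_brace N.
Proof.
apply: left_ideal_sub => [|c]; first exact: gen_subgroup.
have sN := gen_subgroup (addg B) [set x | exists a b, x = defect a b].
have sub : subgroup (addg B) [set x | N (lambda c x)].
  have [N0 ND NN] := sN; split=> [|x y Nx Ny|x Nx] /=.
  - by rewrite lambda0.
  - by rewrite lambdaD; apply: ND.
  - by rewrite lambdaN; apply: NN.
apply: (gen_min sub) => _ [a [b ->]]; rewrite /= lambda_defect; exact: N_defect.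
Qed.

Hypothesis dB : dedekind B.

(** Modulo N the two laws coincide, and are therefore abelian. *)
Lemma cen_defect : zs N 1 = setT.
Proof.
have [D [f [sf kf]]] := quot_ex (dB defect_sub).
apply/seteqP; split=> // x _; apply/(cen_ker sf kf); apply/centerE => y.
have [b <-] := sf y.
have law u w : f u + f w = f u ** f w.
  rewrite circE; congr (_ + _); rewrite -bhomL; symmetry.
  have := N_defect u w => /(ker0 kf); rewrite /defect bhomD bhomN => E.
  by rewrite -[LHS](gopr1 (addg D)) -(gopV (addg D) (f w)) gopA E gop1.
by rewrite !law -!bhomM (cM b x).
Qed.

Hypothesis mB : minimax (circg B).

(** The ideal N has two abelian laws, and B/N is central. *)
Lemma circ_abelian_nilpotent : exists n, zs [set (0 : B)] n = setT.
Proof.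
have sN := defect_sub.
have cA : abelian_law (addg (sub_brace sN)).
  move=> x y; apply: val_inj; apply: defect_gen_abelian; exact: set_mem (valP _).
have cC : abelian_law (circg (sub_brace sN)) by move=> x y; apply/val_inj/cM.
have sec : circ_section (circg B) (sub_brace sN).
  have [h hE] : exists h : B -> sub_brace sN, forall x, N x -> sub_incl sN (h x) = x.
    have [N0 _ _] := sN.1.
    exists (fun x => if pselect (N x) is left h then exist _ x (mem_set h)
                     else exist _ 0 (mem_set N0)) => x Nx.
    by case: pselect.
  exists N, h; split; first exact: sN.2.
    move=> x y Nx Ny; apply: (@sub_incl_inj _ _ sN); rewrite bhomM !hE //.
    by have [_ [_ NM _]] := sN; apply: NM.
  move=> c; exists (sub_incl sN c); first by apply/(sub_inclP sN); exists c.
  by apply: (@sub_incl_inj _ _ sN); rewrite hE //; apply/(sub_inclP sN); exists c.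
have [Q [gs dN]] := bi_abelian_data mB sec (@dedekind_sub _ _ sN dB) cA cC.
exact: (abelian_ideal_step dB dN cen_defect).
Qed.

End Ito.

Theorem theorem4p14 (B : skewBrace) (hB : dedekind B) :
  (soluble_by_finite (addg B) -> minimax (addg B) -> centrally_nilpotent B)
  /\ (torsion_free (addg B) -> soluble_by_finite (addg B) ->
      minimax (addg B) -> trivial_brace B)
  /\ (minimax (circg B) -> abelian_law (circg B) ->
      centrally_nilpotent B /\ (torsion_free (circg B) -> trivial_brace B)).
Proof.
split; [|split].
- by move=> sB mB; apply/centrally_nilpotentP/soluble_minimax_nilpotent.
- move=> tf sB mB; have [n hn] := soluble_minimax_nilpotent hB mB sB.
  apply/center_trivial/(torsion_free_center hB _ hn) => z m m0 _; exact: tf.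
- move=> mB cM; have [n hn] := circ_abelian_nilpotent cM hB mB.
  split=> [|tf]; first by apply/centrally_nilpotentP; exists n.
  apply/center_trivial/(torsion_free_center hB _ hn) => z m m0 Zz zm.
  (* The two powers of a central element agree. *)
  have [lz _ _] := Zz.
  by rewrite -circ_id; apply: (tf z m m0); rewrite pow_self // zm circ_id.
Qed.
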